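(* Let $X$ be a Lévy process in $\mathbb{R}^d$ with Lévy measure $\pi$. Let $g\in\mathfrak{D}$ and $w\in\mathfrak{W}$ satisfy $\int_{0^+}g_1(w^{-1}(r))\,\sigma(dr)=\infty$. Then $F_w$ almost surely contains a set of the class $\mathrm{G}^{g_1}((0,\infty))$. Furthermore, with probability one, for every open subset $V$ of $(0,\infty)$, $\mathcal{H}^g(F_w\cap V)=\mathcal{H}^g(V)$.
   Context: A Lévy process $X$ in $\mathbb{R}^d$ has stationary independent increments, càdlàg paths and $X_0=0$; $\pi$ is its Lévy measure and $\sigma$ the image of $\pi$ under $x\mapsto\|x\|$. $S$ is the set of jump times of $X$. Gauge functions: nondecreasing $g$ on some $[0,\varepsilon]$ with $\lim_{0^+}g=g(0)=0$; $\mathfrak{D}$ is their set and $\mathcal{H}^g$ the Hausdorff $g$-measure. $g_1(r)=r\inf_{\rho\in(0,r]}g(\rho)/\rho$. $\int_{0^+}$ denotes the integral over any $(0,\varepsilon]$ on which the integrand is continuous. $\mathfrak{W}$ is the set of continuous increasing functions $w$ on some $[0,\varepsilon]$ with $w(0)=0$ and $1<\liminf_{\delta\to0}w(2\delta)/w(\delta)\le\limsup_{\delta\to0}w(2\delta)/w(\delta)<\infty$. A function $w\in\mathfrak{W}$ is a modulus of continuity of $X$ at $t\ge0$ if there are $c>0$ and a $d$-tuple $P$ of polynomials with $\|X_{t'}-P(t'-t)\|\le c\,w(|t'-t|)$ for nonnegative $t'$ in a neighborhood of $t$. $F_w$ is the set of $t\in[0,\infty)\setminus S$ at which $w$ is not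 a modulus of continuity of $X$. $\mathfrak{D}_1$ is the set of $g\in\mathfrak{D}$ with $g(r)/r$ positive and nonincreasing on some $(0,\varepsilon]$. For $g\in\mathfrak{D}_1$, let $\varepsilon_g$ be the supremum of $\varepsilon\in(0,1]$ with $g$ nondecreasing on $[0,\varepsilon]$ and $g(r)/r$ nonincreasing on $(0,\varepsilon]$; fix an integer $c\ge2$, let $\Lambda_{c,g}$ be the $c$-adic intervals $c^{-j}(k+[0,1))$ of diameter $<\varepsilon_g$, and $\mathcal{M}^g_\infty(F)=\inf\sum_pg(\mathrm{diam}\,\lambda_p)$ over covers of $F$ by $\lambda_p\in\Lambda_{c,g}\cup\{\emptyset\}$. $\bar g\prec g$ means $\bar g/g$ monotonically tends to infinity at $0$. For nonempty open $V\subseteq\mathbb{R}$, $\mathrm{G}^g(V)$ is the class of $G_\delta$-sets $F\subseteq\mathbb{R}$ with $\mathcal{M}^{\bar g}_\infty(F\cap U)=\mathcal{M}^{\bar g}_\infty(U)$ for every $\bar g\in\mathfrak{D}_1$ with $\bar g\prec g$ and every open $U\subseteq V$. *)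

(* Defs.v *)
From HB Require Import structures.
From mathcomp Require Import all_boot all_order all_algebra.
From mathcomp Require Import all_classical all_reals all_analysis.
Import Order.TTheory GRing.Theory Num.Theory.
Import numFieldNormedType.Exports.
Set Implicit Arguments. Unset Strict Implicit. Unset Printing Implicit Defensive.
Local Open Scope classical_set_scope.
Local Open Scope ring_scope.

Section Defs.
Context {R : realType}.

Definition eucl {d : nat} (x : 'rV[R]_d) : R :=
  Num.sqrt (\sum_(i < d) x ord0 i ^+ 2).

Definition borelRd (d : nat) : set (set 'rV[R]_d) :=
  <<s [set: 'rV[R]_d], @open 'rV[R]_d >>.

(* Levy processes.  X : R -> Omega -> R^d, only times t >= 0 matter.  *)

Definition is_levy_process {dO : measure_display} {Omega : measurableType dO}
  (P : probability Omega R) (d : nat) (X : R -> Omega -> 'rV[R]_d) : Prop :=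
  [/\
      (forall t B, 0 <= t -> borelRd B -> measurable (X t @^-1` B)),
      (forall w, X 0 w = 0),
      (forall w t, 0 <= t -> (X x w) @[x --> t^'+] --> X t w) /\
      (forall w t, 0 < t -> cvg ((X x w) @[x --> t^'-])),
      (forall s t B, 0 <= s <= t -> borelRd B ->
         P [set w | X t w - X s w \in B] = P [set w | X (t - s) w \in B]) &
      (forall (n : nat) (tt : nat -> R) (B : nat -> set 'rV[R]_d),
         0 <= tt 0%N -> (forall k, (k < n)%N -> tt k < tt k.+1) ->
         (forall k, borelRd (B k)) ->
         P (\bigcap_(k < n) [set w | X (tt k.+1) w - X (tt k) w \in B k])
         = (\prod_(k < n) P [set w | (X (tt k.+1) w - X (tt k) w)%R \in B k])%E)].

Definition jump {Omega : Type} {d : nat} (X : R -> Omega -> 'rV[R]_d)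
  (w : Omega) (t : R) : 'rV[R]_d :=
  if 0 < t then X t w - lim ((X x w) @[x --> t^'-]) else 0.

Definition jump_times {Omega : Type} {d : nat} (X : R -> Omega -> 'rV[R]_d)
  (w : Omega) : set R := [set t | 0 < t /\ jump X w t != 0].

Definition jumps_in {Omega : Type} {d : nat} (X : R -> Omega -> 'rV[R]_d)
  (A : set 'rV[R]_d) (w : Omega) : set R :=
  [set t | 0 < t <= 1 /\ jump X w t != 0 /\ A (jump X w t)].

Definition levy_measure {dO : measure_display} {Omega : measurableType dO}
  (P : probability Omega R) {d : nat} (X : R -> Omega -> 'rV[R]_d)
  (A : set 'rV[R]_d) : \bar R :=
  (\int[P]_w (\esum_(t in jumps_in X A w) (1%E : \bar R)))%E.

Definition norm_image {d : nat} (pi : set 'rV[R]_d -> \bar R) : set R -> \bar R :=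
  fun B => pi (eucl @^-1` B).

Definition is_gauge (g : R -> R) : Prop :=
  exists e : R, 0 < e /\
    {in `[0, e] &, {homo g : x y / x <= y}} /\ g 0 = 0 /\
    g x @[x --> 0^'+] --> 0.

Definition g1 (g : R -> R) (r : R) : R :=
  r * inf [set g rho / rho | rho in `]0, r]].

Definition is_modulus_fun (w : R -> R) : Prop :=
  exists e : R, 0 < e /\
    {within `[0, e], continuous w} /\
    {in `[0, e] &, {mono w : x y / x < y}} /\ w 0 = 0 /\
    (* 1 < liminf w(2δ)/w(δ) <= limsup w(2δ)/w(δ) < oo, as δ -> 0+ *)
    (exists a : R, 1 < a /\ \forall x \near 0^'+, a <= w (2 * x) / w x) /\
    (exists A : R, \forall x \near 0^'+, w (2 * x) / w x <= A).

Definition modulus_at {Omega : Type} {d : nat} (X : R -> Omega -> 'rV[R]_d)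
  (om : Omega) (w : R -> R) (t : R) : Prop :=
  exists (c : R) (Pol : 'I_d -> {poly R}) (delta : R), 0 < c /\ 0 < delta /\
    forall t', 0 <= t' -> `|t' - t| < delta ->
      eucl (X t' om - \row_(i < d) (Pol i).[t' - t]) <= c * w `|t' - t|.

Definition Fw {Omega : Type} {d : nat} (X : R -> Omega -> 'rV[R]_d)
  (w : R -> R) (om : Omega) : set R :=
  [set t | 0 <= t /\ ~ jump_times X om t /\ ~ modulus_at X om w t].

Definition diam (U : set R) : R := sup [set `|x - y| | x in U & y in U].

Definition hausdorff_pre (g : R -> R) (delta : R) (E : set R) : \bar R :=
  ereal_inf [set (\sum_(i <oo) (g (diam (U i)))%:E)%E
            | U in [set U : nat -> set R |
                      E `<=` \bigcup_i U i /\
                      forall i x y, U i x -> U i y -> `|x - y| <= delta]].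

Definition hausdorff (g : R -> R) (E : set R) : \bar R :=
  ereal_sup [set hausdorff_pre g delta E | delta in `]0, +oo[].

Definition is_gauge1 (g : R -> R) : Prop :=
  is_gauge g /\ exists e : R, 0 < e /\
    (forall r, 0 < r <= e -> 0 < g r / r) /\
    {in `]0, e] &, {homo (fun r => g r / r) : x y /~ x <= y}}.

Definition eps_g (g : R -> R) : R :=
  sup [set e : R | 0 < e <= 1 /\ {in `[0, e] &, {homo g : x y / x <= y}} /\
                   {in `]0, e] &, {homo (fun r => g r / r) : x y /~ x <= y}}].

Definition cadic (c : nat) (j : nat) (k : int) : set R :=
  [set x | k%:~R / (c%:R ^+ j) <= x < (k + 1)%:~R / (c%:R ^+ j)].

(* an element of Lambda_{c,g} \cup {emptyset} is coded by an option (j,k);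
   j ranges over nat: j < 0 would give a diameter >= c >= 2 > eps_g. *)
Definition lam_set (c : nat) (l : option (nat * int)) : set R :=
  if l is Some (j, k) then cadic c j k else set0.

Definition lam_diam (c : nat) (l : option (nat * int)) : R :=
  if l is Some (j, _) then (c%:R ^+ j)^-1 else 0.

Definition M_inf (c : nat) (g : R -> R) (F : set R) : \bar R :=
  ereal_inf [set (\sum_(p <oo) (g (lam_diam c (L p)))%:E)%E
            | L in [set L : nat -> option (nat * int) |
                      (forall p, lam_diam c (L p) < eps_g g) /\
                      F `<=` \bigcup_p lam_set c (L p)]].

Definition gauge_prec (gbar g : R -> R) : Prop :=
  (exists e : R, 0 < e /\
     {in `]0, e] &, {homo (fun r => gbar r / g r) : x y /~ x <= y}}) /\
  (gbar r / g r) @[r --> 0^'+] --> +oo.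

Definition G_delta (F : set R) : Prop :=
  exists O : nat -> set R, (forall n, open (O n)) /\ F = \bigcap_n O n.

Definition class_G (c : nat) (g : R -> R) (V : set R) : set (set R) :=
  [set F | G_delta F /\
     forall (gbar : R -> R) (U : set R), is_gauge1 gbar -> gauge_prec gbar g ->
       open U -> U `<=` V -> M_inf c gbar (F `&` U) = M_inf c gbar U].

End Defs.

(* Main.v *)
Require Import Defs.
From HB Require Import structures.
From mathcomp Require Import finmap.
From mathcomp Require Import all_boot all_order all_algebra.
From mathcomp Require Import all_classical all_reals all_analysis.
From mathcomp Require Import measurable_realfun.
From mathcomp Require Import zify ring lra.
Import Order.TTheory GRing.Theory Num.Theory.
Import numFieldNormedType.Exports.
Set Implicit Arguments. Unset Strict Implicit. Unset Printing Implicit Defensive.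
Local Open Scope classical_set_scope.
Local Open Scope ring_scope.

(* Everything is done on c-adic cells.  A jump s of X of norm at least w(c^-m)
   which lies within c^-(l+m) of t, for every l (with some m >= l), prevents w from
   being a modulus at t; so F_w contains the set F of non-jump times t that are
   approximated in this way for all l.

   Probability.  Call a cell of side c^-j hit (with shift k) if it contains a jump of
   norm at least w(c^-mu(j-k)), where g_1(c^-mu(i)) is comparable to c^-i.  For a point
   y the windows "level-j cell of y minus level-(j+1) cell of y" are disjoint, so the
   increments over them are independent and the probability that no hit occurs between
   levels n and m is at most exp(-1/2 sum_j c^-j L_j), L_j being the expected number of
   such jumps per unit time.  The integral condition says that sum_j c^-j L_j diverges.
   Hence almost surely, for all k and n, all but a small proportion of the deep
   subcells of any cell lie below a hit cell of level at least n ("rich_at").  The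
   Poisson structure enters only through increments along c-adic grids, Fatou's lemma
   and lower integrals.

   Geometry (mass transference).  Fix a cover by cells L_p and a gauge h with
   h(r)/r -> oo and h >= C g_1.  Call a cell good if no L_p contains it and the L_p inside
   it cost less than h of its side.  A good cell contains a good subcell within
   c^-(l+m) of a jump of norm at least w(c^-m): otherwise every hit cell I inside it is
   either covered by a single L_p or contains L_p's of total cost at least B |I|, with B
   arbitrarily large thanks to the shift k, and summing over disjoint hit cells would
   give more than the available cost.  Iterating, a good cell contains an uncovered point
   of F.  So a cover of F /\ U can be turned into a cover of U that is not more
   expensive.  The same argument with h = g_1 itself gives infinite Hausdorff measure when
   g_1(r)/r -> oo; when g_1(r)/r is bounded, hit cells with a large shift lie entirely in
   the approximation sets, and the complement of F is H^g-negligible. *)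

(** * c-adic cells and covers *)

Lemma big_nat_blocks (R : nmodType) (b k D : nat) (F : nat -> R) :
  \sum_(b * D <= y < (b + k) * D) F y =
  \sum_(0 <= a < k) \sum_((b + a) * D <= y < (b + a).+1 * D) F y.
Proof.
elim: k => [|k IHk]; first by rewrite addn0 !big_geq.
rewrite big_nat_recr//= -IHk addnS -big_cat_nat// leq_mul2r ?leq_addr ?orbT//.
by rewrite leqnSn orbT.
Qed.

Section Cells.
Context {R : realType} (c : nat) (hc : (1 < c)%N).

Lemma base_gt0 : (0 < c)%N. Proof. exact: ltnW. Qed.

Definition side (j : nat) : R := (c%:R ^+ j)^-1.

Lemma side_gt0 j : 0 < side j.
Proof. by rewrite invr_gt0 exprn_gt0// ltr0n base_gt0. Qed.

Lemma side_ge0 j : 0 <= side j.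
Proof. exact/ltW/side_gt0. Qed.

Lemma sideS j : side j = c%:R * side j.+1.
Proof.
by rewrite /side exprS invfM mulrA divff ?mul1r// pnatr_eq0 -lt0n base_gt0.
Qed.

Lemma sideD i j : side (i + j) = side i * side j.
Proof. by rewrite /side exprD invfM. Qed.

Lemma mul_side i j : (i <= j)%N -> c%:R ^+ (j - i) * side j = side i.
Proof.
move=> ij; rewrite -{2}(subnK ij) sideD mulrA divff ?mul1r//.
by rewrite expf_neq0// pnatr_eq0 -lt0n base_gt0.
Qed.

(* A cell is coded by (level, index). *)
Definition sub (p q : nat * nat) : bool :=
  (q.1 <= p.1)%N && (p.2 %/ c ^ (p.1 - q.1) == q.2)%N.

Definition child (I : nat * nat) (a : nat) : nat * nat := (I.1.+1, c * I.2 + a)%N.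

Lemma sub_refl p : sub p p.
Proof. by rewrite /sub leqnn subnn expn0 divn1 eqxx. Qed.

Lemma sub_trans q p r : sub p q -> sub q r -> sub p r.
Proof.
move=> /andP[qp /eqP pq] /andP[rq /eqP qr]; rewrite /sub (leq_trans rq qp)/=.
have -> : (p.1 - r.1 = (p.1 - q.1) + (q.1 - r.1))%N by lia.
by rewrite expnD divnMA pq qr.
Qed.

Lemma sub_comparable p q r : sub p q -> sub p r -> (r.1 <= q.1)%N -> sub q r.
Proof.
move=> /andP[qp /eqP pq] /andP[rp /eqP pr] rq; rewrite /sub rq/=.
have e : (p.1 - r.1 = (p.1 - q.1) + (q.1 - r.1))%N by lia.
by rewrite -pq -divnMA -expnD -e pr.
Qed.

Lemma sub_level p q : sub p q -> p.1 = q.1 -> p = q.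
Proof.
case: p q => [p1 p2] [q1 q2] /andP[/= _ /eqP <-] ->.
by rewrite subnn expn0 divn1.
Qed.

Lemma sub_child I a : (a < c)%N -> sub (child I a) I.
Proof.
move=> ac; rewrite /sub/= leqnSn subSnn expn1 mulnC divnMDl ?base_gt0//.
by rewrite divn_small ?addn0 ?eqxx.
Qed.

Lemma child_inj r I a b : (a < c)%N -> (b < c)%N ->
  sub r (child I a) -> sub r (child I b) -> a = b.
Proof.
move=> ac bc; rewrite /sub/= => /andP[_ /eqP ha] /andP[_ /eqP hb].
by apply: (@addnI (c * I.2)); rewrite -ha -hb.
Qed.

Lemma sub_child_sub r I a : (a < c)%N -> sub r (child I a) -> sub r I.
Proof. by move=> ac h; apply: (sub_trans h); exact: sub_child. Qed.

(* How much of the cell I a cell r of the cover accounts for: its length inside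
   I, plus v if r lies entirely inside I. *)
Definition share (v : R) (r I : nat * nat) : R :=
  if sub I r then side I.1 + (if sub r I then v else 0)
  else if sub r I then side r.1 + v else 0.

Lemma share_ge0 v r I : 0 <= v -> 0 <= share v r I.
Proof.
move=> v0; rewrite /share; case: ifP => _; case: ifP => _ //.
- by rewrite addr_ge0// side_ge0.
- by rewrite addr0 side_ge0.
- by rewrite addr_ge0// side_ge0.
Qed.

(** If [I] lies in [r], no child of [I] contains [r], so the children only share out the length of
    [I]. If [r] lies strictly inside [I], it lies in at most one child, which receives
    [side r.1 + v]; otherwise every term vanishes. *)
Lemma share_superadd v r I : 0 <= v ->
  \sum_(0 <= a < c) share v r (child I a) <= share v r I.
Proof.
move=> v0; rewrite {2}/share; case: ifPn => [Ir|nIr].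
  have -> : \sum_(0 <= a < c) share v r (child I a) = \sum_(0 <= a < c) side I.1.+1.
    apply: eq_big_nat => a /andP[_ ac]; rewrite /share.
    rewrite (sub_trans (sub_child I ac) Ir).
    case: ifPn; rewrite ?addr0//.
    by move=> /andP[/= h _]; move: Ir => /andP[h' _]; lia.
  rewrite sumr_const_nat subn0 -mulr_natl -sideS lerDl.
  by case: ifP.
have key a : (a < c)%N -> share v r (child I a) =
    if sub r (child I a) then side r.1 + v else 0.
  move=> ac; rewrite /share; case: ifPn => // cr; case: ifPn => [rc|nrc].
    congr (_ + _); congr side.
    by move: cr rc => /andP[/= h1 _] /andP[/= h2 _]; lia.
  exfalso.
  have [lt|ge] := leqP r.1 I.1.
    by move/negP: nIr; apply; apply: sub_comparable cr _; rewrite ?sub_child.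
  have e : r.1 = (child I a).1 by move: cr => /andP[/= ? _]; lia.
  by move: (sub_level cr (esym e)) nrc => ->; rewrite sub_refl.
have -> : \sum_(0 <= a < c) share v r (child I a) =
    \sum_(0 <= a < c) if sub r (child I a) then side r.1 + v else 0.
  by apply: eq_big_nat => a /andP[_ ac]; exact: key.
have [[a ac ra]|nex] := pselect (exists2 a, (a < c)%N & sub r (child I a)).
  rewrite (bigD1_seq a) ?iota_uniq ?mem_index_iota//= ra (sub_child_sub ac ra).
  rewrite big1_seq ?addr0// => b /andP[ba].
  rewrite mem_index_iota => /andP[_ bc].
  case: ifPn => // rb.
  by move: ba; rewrite (child_inj ac bc ra rb) eqxx.
rewrite big1_seq ?if_ge0//.
  by case: ifP => // _; rewrite addr_ge0 ?side_ge0.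
move=> a; rewrite mem_index_iota => /andP[_ /andP[_ ac]].
by case: ifPn => // ra; exfalso; apply: nex; exists a.
Qed.

(** Here [y] indexes a cell of level [m], and integer division by powers of [c] runs through its
    ancestors of levels [j] to [m - 1]. *)
Definition missed (hit : nat -> nat -> Prop) (n j m y : nat) : Prop :=
  forall j', (j <= j' < m)%N -> (n <= j')%N -> ~ hit j' (y %/ c ^ (m - j'))%N.

Definition rich_at (hit : nat -> nat -> Prop) (q : nat * nat) : Prop :=
  forall n (e : R), 0 < e -> exists m, [/\ (n <= m)%N, (q.1 <= m)%N &
    \sum_(q.2 * c ^ (m - q.1) <= y < q.2.+1 * c ^ (m - q.1))
       (`[< missed hit n q.1 m y >] : nat)%:R <= e * c%:R ^+ (m - q.1)].

(** A stopping-time argument in the form of an induction on the depth [d]. A hit cell is paid for by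
    [nu] alone; any other cell is split into its children, and superadditivity of [nu] adds up their
    bounds. Only missed cells of level [m] remain to be paid for by their length. *)
Lemma tree_cover (nu : nat * nat -> \bar R) (hit : nat -> nat -> Prop) q n m :
  (forall I, (0 <= nu I)%E) ->
  (forall I, (\sum_(0 <= a < c) nu (child I a) <= nu I)%E) ->
  (forall j i, sub (j, i) q -> (n <= j)%N -> hit j i -> ((side j)%:E <= nu (j, i))%E) ->
  forall d j i, (j + d = m)%N -> sub (j, i) q ->
   ((side j)%:E <= nu (j, i) + (side m *
    \sum_(i * c ^ d <= y < i.+1 * c ^ d) (`[< missed hit n j m y >] : nat)%:R)%:E)%E.
Proof.
move=> nu0 nuS bad; elim=> [|d IHd] j i jdm jq.
  move: jdm; rewrite addn0 => <-.
  rewrite expn0 !muln1 big_nat1.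
  (* At depth 0 the range of levels is empty, so the cell counts as missed and contributes its whole
     length. *)
  have -> : `[< missed hit n j j i >] = true.
    by apply/asboolP => j' /andP[h1 h2]; lia.
  by rewrite mulr1 leeDr.
have [[nj hji]|nohit] := pselect ((n <= j)%N /\ hit j i).
  apply: (le_trans (bad _ _ jq nj hji)); rewrite leeDl// lee_fin.
  rewrite mulr_ge0 ?side_ge0//; apply: sumr_ge0 => *; exact: ler0n.
have jm : (j < m)%N by lia.
have -> : \sum_(i * c ^ d.+1 <= y < i.+1 * c ^ d.+1) (`[< missed hit n j m y >] : nat)%:R
   = \sum_(0 <= a < c) \sum_((c * i + a) * c ^ d <= y < (c * i + a).+1 * c ^ d)
        (`[< missed hit n j.+1 m y >] : nat)%:R :> R.
  have -> : (i * c ^ d.+1 = (c * i) * c ^ d)%N by rewrite expnS; lia.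
  have -> : (i.+1 * c ^ d.+1 = (c * i + c) * c ^ d)%N by rewrite expnS; lia.
  rewrite big_nat_blocks.
  apply: eq_big_nat => a /andP[_ ac]; apply: eq_big_nat => y /andP[y1 y2].
  (* Seen from the parent, the only additional level is [j], where the ancestor of [y] is [i]
     itself; this cell is not hit. *)
  congr ((nat_of_bool _)%:R); apply/asboolP/asboolP => h j' /andP[h1 h2] h3.
    by apply: h => //; rewrite h2 andbT; lia.
  have [jj'|] := eqVneq j j'; last first.
    by move=> jj'; apply: h => //; rewrite h2 andbT; lia.
  rewrite -jj' => hj; apply: nohit; split; first by rewrite jj'.
  have -> // : i = (y %/ c ^ (m - j))%N.
  have -> : (m - j = d.+1)%N by lia.
  rewrite expnSr divnMA.
  have cd0 : (0 < c ^ d)%N by rewrite expn_gt0 base_gt0.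
  have -> : (y %/ c ^ d = c * i + a)%N.
    apply/eqP; rewrite eqn_leq leq_divRL// y1 andbT -ltnS ltn_divLR//.
  by rewrite mulnC divnMDl ?base_gt0// divn_small// addn0.
rewrite [side j]sideS mulr_sumr -sumEFin.
apply: (@le_trans _ _ (\sum_(0 <= a < c) (nu (child (j, i) a) + (side m *
     \sum_((c * i + a) * c ^ d <= y < (c * i + a).+1 * c ^ d)
        (`[< missed hit n j.+1 m y >] : nat)%:R)%:E))%E).
  apply: (@le_trans _ _ (\sum_(0 <= a < c) (side j.+1)%:E)%E).
    by rewrite sumEFin lee_fin sumr_const_nat subn0 mulr_natl.
  rewrite big_nat [leRHS]big_nat; apply: lee_sum => a /andP[_ ac].
  apply: IHd; first lia.
  by apply: sub_trans jq; exact: (sub_child (j, i)).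
by rewrite big_split/= leeD2r.
Qed.

End Cells.

Section Covers.
Context {R : realType} (c : nat) (hc : (1 < c)%N).
Notation side := (@side R c).
Notation sub := (@sub c).

Lemma nneseries_ge_term (u : nat -> \bar R) p : (forall n, 0 <= u n)%E ->
  (u p <= \sum_(n <oo) u n)%E.
Proof.
move=> u0; apply: (@le_trans _ _ (\sum_(0 <= n < p.+1) u n)%E).
  by rewrite big_nat_recr//= leeDr// sume_ge0.
by apply: nneseries_lim_ge => *; exact: u0.
Qed.

Definition cost (H : nat -> R) (L : nat -> option (nat * nat)) (I : nat * nat) : \bar R :=
  (\sum_(p <oo) (if L p is Some r then if sub r I then (H r.1)%:E else 0 else 0))%E.

Definition avoids (L : nat -> option (nat * nat)) (I : nat * nat) : Prop :=
  forall p r, L p = Some r -> ~~ sub I r.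

Definition good H L I : Prop := avoids L I /\ (cost H L I < (H I.1)%:E)%E.

Variables (H : nat -> R) (J0 : nat).
Hypothesis H_gt0 : forall j, (J0 <= j)%N -> 0 < H j.
Hypothesis H_ge : forall j, (J0 <= j)%N -> H j <= c%:R * H j.+1.

(** By [H_ge] the ratio [H j / side j] is nondecreasing in the level. *)
Lemma H_side j k : (J0 <= j)%N -> H j * side (j + k) <= side j * H (j + k).
Proof.
move=> Jj; elim: k => [|k IH]; first by rewrite addn0 mulrC.
have := H_ge (leq_trans Jj (leq_addr k j)).
rewrite addnS; move: IH; rewrite [side (j + k)](sideS hc).
set a := H j; set b := side j; set x := H (j + k); set y := H _.+1; set z := side _.+1.
move=> h1 h2.
have c0 : 0 < c%:R :> R by rewrite ltr0n base_gt0.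
have b0 : 0 < b by exact: side_gt0.
rewrite -(ler_pM2l c0); nra.
Qed.

Lemma term_ge0 (L : nat -> option (nat * nat)) I p : (J0 <= I.1)%N ->
  (0 <= if L p is Some r then if sub r I then (H r.1)%:E else 0 else 0)%E.
Proof.
move=> JI; case: (L p) => // r; case: ifPn => // /andP[h _].
by rewrite lee_fin ltW// H_gt0// (leq_trans JI).
Qed.

Lemma cost_ge0 L I : (J0 <= I.1)%N -> (0 <= cost H L I)%E.
Proof. by move=> JI; apply: nneseries_ge0 => p _ _; exact: term_ge0. Qed.

(** If no such hit cell existed, the superadditive function [nu] below would dominate the length of
    every deep hit cell, so [tree_cover] and richness would make [nu q] almost [side q.1]; goodness
    of [q] keeps it smaller by a fixed amount. The constant [B] depends on [L] and [q] only, which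
    later allows the shift in [hit] to be chosen after [B]. *)
Lemma exists_uncovered_hit L q : (J0 <= q.1)%N -> good H L q ->
  exists2 B : R, 0 < B & forall hit n, @rich_at R c hit q ->
    exists j i, [/\ sub (j, i) q, (n <= j)%N, hit j i, avoids L (j, i) &
                    (cost H L (j, i) < (B * side j)%:E)%E].
Proof.
move=> Jq [av costq].
have costf : cost H L q \is a fin_num.
  by rewrite ge0_fin_numE ?cost_ge0// (lt_trans costq)// ltry.
pose W := fine (cost H L q).
have WE : cost H L q = W%:E by rewrite fineK.
have W0 : 0 <= W by rewrite -lee_fin -WE cost_ge0.
have Hq := H_gt0 Jq.
have WH : W < H q.1 by rewrite -lte_fin -WE.
have sq := side_gt0 (R:=R) hc q.1.
(* By [H_side], cells in [q] of total cost [W] have total length at most [side q.1 * W / H q.1], so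
   [gam] is the length that they leave free. *)
pose gam := side q.1 * (1 - W / H q.1).
have gam0 : 0 < gam by rewrite mulr_gt0// subr_gt0 ltr_pdivrMr// mul1r.
(* This gives [W / B <= gam / 2]; the summand 1 keeps [B] positive when [W = 0]. *)
pose B := 2 * (W + 1) / gam.
have B0 : 0 < B by rewrite divr_gt0// mulr_gt0// ltr_wpDl.
exists B => // hit n rich.
apply: contrapT => nex.
pose nu I : \bar R := (\sum_(p <oo) (if L p is Some r then
   if sub r q then (share c (H r.1 / B) r I)%:E else 0 else 0))%E.
have v0 r : sub r q -> 0 <= H r.1 / B.
  by move=> /andP[h _]; rewrite divr_ge0 ?ltW// H_gt0// (leq_trans Jq).
have t0 I p : (0 <= if L p is Some r then
   if sub r q then (share c (H r.1 / B) r I)%:E else 0 else 0)%E.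
  case: (L p) => // r; case: ifPn => // rq.
  by rewrite lee_fin share_ge0// v0.
have nu0 I : (0 <= nu I)%E by apply: nneseries_ge0 => *; exact: t0.
have nuS I : (\sum_(0 <= a < c) nu (child c I a) <= nu I)%E.
  rewrite /nu -nneseries_sum; last by move=> *; exact: t0.
  apply: lee_nneseries => p *; first by apply: sume_ge0 => *; exact: t0.
  case: (L p) => [r|]; last by rewrite big1.
  case: ifPn => rq; last by rewrite big1.
  by rewrite sumEFin lee_fin share_superadd// v0.
have nuq : (nu q <= (side q.1 - gam / 2)%:E)%E.
  apply: (@le_trans _ _ ((side q.1 / H q.1 + B^-1)%:E * cost H L q)%E).
    rewrite /cost -nneseriesZl; last by move=> *; exact: term_ge0.
    apply: lee_nneseries => p *; first exact: t0.
    case: (L p) => [r|]; last by rewrite mule0.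
    case: ifPn => rq; last by rewrite mule0.
    rewrite -EFinM lee_fin /share.
    have [h _] := andP rq.
    have Hr := H_gt0 (leq_trans Jq h).
    have -> : (if sub q r then side q.1 + (if sub r q then H r.1 / B else 0)
        else if sub r q then side r.1 + H r.1 / B else 0) = side r.1 + H r.1 / B.
      rewrite rq; case: ifPn => // qr; congr (side _ + _).
      by move: qr => /andP[? _]; lia.
    rewrite mulrDl [B^-1 * _]mulrC lerD2r.
    have := H_side (r.1 - q.1) Jq.
    rewrite subnKC// => hs.
    by rewrite mulrAC ler_pdivlMr// [leLHS]mulrC.
  rewrite WE -EFinM lee_fin mulrDl /gam.
  have : B^-1 * W <= gam / 2.
    rewrite /B invf_div mulrAC ler_pdivrMr; last by lra.
    rewrite mulrC; nra.
  rewrite /gam mulrBr mulr1; nra.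
have bad j i : sub (j, i) q -> (n <= j)%N -> hit j i -> ((side j)%:E <= nu (j, i))%E.
  move=> jq nj hji.
  have [avj|] := pselect (avoids L (j, i)); last first.
    (* A cell [r] of the cover containing the hit cell cannot contain [q], hence lies in [q] and is
       counted by [nu]. *)
    move=> /existsNP[p /existsNP[r /not_implyP[Lp /negP/negPn jr]]].
    have rq : sub r q.
      have [le|lt] := leqP r.1 q.1.
        by have /negP[] := av _ _ Lp; exact: sub_comparable jq jr _.
      exact: sub_comparable jr jq (ltnW lt).
    apply: le_trans (nneseries_ge_term p (t0 (j, i))).
    rewrite Lp rq lee_fin /share jr lerDl; case: ifP => // _; exact: v0.
  have [//|lt] := leP (side j)%:E (nu (j, i)).
  exfalso; apply: nex; exists j, i; split => //.
  (* Each cover cell [r] inside [(j, i)] contributes at least [H r.1 / B] to [nu (j, i)], so a small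
     [nu] forces a small cost. *)
  apply: (@le_lt_trans _ _ (B%:E * nu (j, i)))%E; last first.
    by rewrite [ltRHS]EFinM lte_pmul2l ?lte_fin.
  rewrite /nu -nneseriesZl; last by move=> *; exact: t0.
  have Jj : (J0 <= (j, i).1)%N by apply: leq_trans Jq _; move: jq => /andP[].
  apply: lee_nneseries => p *; first exact: term_ge0.
  case: (L p) => [r|]; last by rewrite mule0.
  have [rj|nrj] := boolP (sub r (j, i)).
    have rq : sub r q by apply: sub_trans rj jq.
    rewrite rq -EFinM lee_fin /share rj.
    have vr := v0 _ rq.
    have sr := side_ge0 (R:=R) hc r.1; have sj := side_ge0 (R:=R) hc j.
    apply: (@le_trans _ _ (B * (H r.1 / B))); first by rewrite mulrC divfK ?gt_eqF.
    by rewrite ler_pM2l//; case: ifP => _ /=; lra.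
  case: ifPn => rq; last by rewrite mule0.
  by rewrite mule_ge0 ?lee_fin ?(ltW B0)// share_ge0// v0.
(* With this proportion the missed cells have total length at most [gam / 4], less than the
   [gam / 2] left free by [nuq]. *)
have e0 : 0 < gam / (4 * side q.1) by rewrite divr_gt0// mulr_gt0.
have [m [nm qm cnt]] := rich n _ e0.
have := tree_cover hc nu0 nuS bad (subnKC qm) (_ : sub (q.1, q.2) q).
rewrite -surjective_pairing => /(_ (sub_refl c q)).
move=> /le_trans/(_ (leeD2r _ nuq)).
rewrite -EFinD lee_fin => hle.
have := ler_wpM2l (side_ge0 (R:=R) hc m) cnt.
rewrite mulrCA [side m * c%:R ^+ _]mulrC mul_side// => h2.
have h3 : gam / (4 * side q.1) * side q.1 = gam / 4 by field; rewrite gt_eqF.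
by move: (le_trans hle (lerD (lexx _) h2)); rewrite h3; lra.
Qed.

End Covers.

(** * Nested good cells shrinking to uncovered points near large jumps *)

Section Descent.
Context {R : realType} (c : nat) (hc : (1 < c)%N).
Notation side := (@side R c).
Notation sub := (@sub c).

Definition cell (p : nat * nat) : set R :=
  [set t | p.2%:R * side p.1 <= t < p.2.+1%:R * side p.1].

Lemma sub_bounds p q : sub p q ->
  q.2%:R * side q.1 <= p.2%:R * side p.1 /\
  p.2.+1%:R * side p.1 <= q.2.+1%:R * side q.1.
Proof.
move=> /andP[qp /eqP <-]; rewrite -(mul_side hc qp) !mulrA.
rewrite !ler_pM2r ?side_gt0// -natrX -!natrM !ler_nat.
have cd : (0 < c ^ (p.1 - q.1))%N by rewrite expn_gt0 base_gt0.
by rewrite leq_trunc_div -ltn_divLR.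
Qed.

Lemma sub_cell p q : sub p q -> cell p `<=` cell q.
Proof.
move=> /sub_bounds[h1 h2] t /andP[t1 t2]; apply/andP; split.
  exact: le_trans t1.
exact: lt_le_trans h2.
Qed.

Lemma cell_sub p q t : cell p t -> cell q t -> (q.1 <= p.1)%N -> sub p q.
Proof.
move=> /andP[p1 p2] /andP[q1 q2] qp; rewrite /sub qp/=.
have cd : (0 < c ^ (p.1 - q.1))%N by rewrite expn_gt0 base_gt0.
move: q1 q2; rewrite -(mul_side hc qp) !mulrA -natrX -!natrM => q1 q2.
rewrite eqn_leq -ltnS ltn_divLR// leq_divRL//.
have := le_lt_trans q1 p2; have := le_lt_trans p1 q2.
by rewrite !ltr_pM2r ?side_gt0// !ltr_nat ltnS => -> ->.
Qed.

(** Jumps are located in cells open on the left and closed on the right, because the increment from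
    [a] to [b] includes a jump at [b] but none at [a]. *)
Lemma exists_lcell (s : R) j : 0 < s ->
  exists i : nat, i%:R * side j < s <= i.+1%:R * side j.
Proof.
move=> s0.
have ex : exists n : nat, s <= n%:R * side j.
  exists (Num.bound (s / side j)).
  rewrite -ler_pdivrMr ?side_gt0// ltW// archi_boundP// divr_ge0 ?ltW//.
  exact: side_gt0.
case: (ex_minnP ex) => -[|n] hn hmin.
  by move: hn; rewrite mul0r leNgt s0.
exists n; rewrite hn andbT ltNge; apply/negP => /hmin.
by rewrite ltnn.
Qed.

Lemma lcell_sub (s : R) j i j' i' : (j <= j')%N ->
  i%:R * side j < s <= i.+1%:R * side j ->
  i'%:R * side j' < s <= i'.+1%:R * side j' -> sub (j', i') (j, i).
Proof.
move=> jj' /andP[q1 q2] /andP[p1 p2]; rewrite /sub/= jj'/=.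
have cd : (0 < c ^ (j' - j))%N by rewrite expn_gt0 base_gt0.
move: q1 q2; rewrite -(mul_side hc jj') !mulrA -natrX -!natrM => q1 q2.
rewrite eqn_leq -ltnS ltn_divLR// leq_divRL//.
have := lt_le_trans q1 p2; have := lt_le_trans p1 q2.
by rewrite !ltr_pM2r ?side_gt0// !ltr_nat ltnS => -> ->.
Qed.

Definition near_big (big : nat -> R -> Prop) (l : nat) : set R :=
  [set t | exists s m, [/\ (l <= m)%N, big m s & `|t - s| < side (l + m)]].

(** A cell of level [j] is asked for a jump of the size that belongs to level [j - k]. The
    truncation of [j - k] is harmless, since only levels [j >= k] are ever exploited. *)
Definition hit (big : nat -> R -> Prop) (mu : nat -> nat) (k j i : nat) : Prop :=
  exists2 s, i%:R * side j < s <= i.+1%:R * side j & big (mu (j - k)%N) s.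

Variables (H : nat -> R) (J0 : nat).
Hypothesis H_gt0 : forall j, (J0 <= j)%N -> 0 < H j.
Hypothesis H_le : forall j, (J0 <= j)%N -> H j.+1 <= H j.
Hypothesis H_ge : forall j, (J0 <= j)%N -> H j <= c%:R * H j.+1.
Hypothesis H_oo : forall A : R, exists N, forall j, (N <= j)%N -> A * side j <= H j.
Variables (big : nat -> R -> Prop) (mu : nat -> nat).
Hypothesis mu_ge : forall j, (j <= mu j)%N.
Hypothesis H_mu : exists (C : R) (N : nat), 0 < C /\
  forall j, (N <= j)%N -> C * side j <= H (mu j).
Hypothesis rich : forall k q, @rich_at R c (hit big mu k) q.

Lemma H_mono j j' : (J0 <= j)%N -> (j <= j')%N -> H j' <= H j.
Proof.
move=> Jj jj'; rewrite -(subnKC jj'); elim: (j' - j)%N => [|d IH].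
  by rewrite addn0.
by rewrite addnS (le_trans _ IH)// H_le// (leq_trans Jj)// leq_addr.
Qed.

Lemma H_expand j d : (J0 <= j)%N -> H j <= c%:R ^+ d * H (j + d).
Proof.
move=> Jj; have := H_side hc H_ge d Jj.
rewrite sideD mulrCA ler_pM2l ?side_gt0// => h.
by rewrite -ler_pdivrMl ?exprn_gt0 ?ltr0n ?base_gt0// mulrC.
Qed.

Lemma cost_mono L p q : (J0 <= q.1)%N -> sub p q -> (cost c H L p <= cost c H L q)%E.
Proof.
move=> Jq pq; have Jp : (J0 <= p.1)%N by rewrite (leq_trans Jq)//; case/andP: pq.
apply: lee_nneseries => k *; first exact: (term_ge0 c H_gt0).
have := term_ge0 c H_gt0 L k Jq; case: (L k) => // r.
move=> h; case: ifPn => [rp|//].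
by rewrite (_ : sub r q)//; apply: sub_trans rp pq.
Qed.

Lemma cost_ge_term L I p r : (J0 <= I.1)%N -> L p = Some r -> sub r I ->
  ((H r.1)%:E <= cost c H L I)%E.
Proof.
move=> JI Lp rI; have := nneseries_ge_term p (fun p => term_ge0 c H_gt0 L p JI).
by rewrite Lp rI.
Qed.

(** Take an uncovered hit cell [(j, i)] with cost below [B * side j] and move into it towards its
    jump [s], just far enough to be within [side (l + m)] of [s]. The cell reached stays good
    because its [H] is still at least [B * side j]. *)
Lemma descent_step (L : nat -> option (nat * nat)) q l :
  (J0 <= q.1)%N -> good c H L q ->
  exists q', [/\ (q.1 < q'.1)%N, good c H L q', sub q' q,
    q'.2.+1%:R * side q'.1 < q.2.+1%:R * side q.1 &
    cell q' `<=` near_big big l].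
Proof.
move=> Jq gq.
have [B B0 hB] := exists_uncovered_hit hc H_gt0 H_ge Jq gq.
have [C [N1 [C0 hmu]]] := H_mu.
(* Two bounds on [H q'.1] are prepared. This one serves when [(j, i)] is already small enough, so
   that only one level is descended; the choice of [k] serves when the descent goes to level
   [m + (l + 2)], which costs a factor [c ^ (l + 2)]. *)
have [N2 hN2] := H_oo (c%:R * B).
have c0 : 0 < c%:R :> R by rewrite ltr0n base_gt0.
have [k hk] : exists k : nat, B * c%:R ^+ (l + 2) <= C * c%:R ^+ k.
  exists (Num.bound (B * c%:R ^+ (l + 2) / C)).
  rewrite -ler_pdivrMl// mulrC; apply: ltW.
  have z0 : 0 <= B * c%:R ^+ (l + 2) / C.
    by rewrite divr_ge0 ?ltW// mulr_gt0// exprn_gt0.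
  apply: lt_le_trans (archi_boundP z0) _.
  by set b := Num.bound _; rewrite -natrX ler_nat ltnW// ltn_expl.
pose n := (N1 + N2 + k + l + J0 + q.1.+1)%N.
have [j [i [jiq nj [s sji bigs] avI costI]]] := hB _ n (@rich k q).
have [[N1j N2j kj] [lj Jjk qj]] : [/\ N1 <= j - k, N2 <= j & k <= j]%N /\ [/\ l <= j - k, J0 <= j - k & q.1 < j]%N.
  by move: nj; rewrite /n; clear => h; split; split; lia.
have mj := mu_ge (j - k).
have [m mE] : exists m, m = mu (j - k) by exists (mu (j - k)).
rewrite -mE in bigs mj.
(* Level [l + m + 1] gives the required distance to [s], and level [j] keeps the cell inside
   [(j, i)]. *)
pose Q := maxn (l + m + 1) j.
have s0 : 0 < s by apply: le_lt_trans (andP sji).1; rewrite mulr_ge0 ?side_ge0.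
have [kap hkap] := exists_lcell Q s0.
have jQ : (j <= Q)%N by rewrite leq_maxr.
have subJ := lcell_sub jQ sji hkap.
(* The leftmost child has a strictly smaller right endpoint than its parent; this keeps the limit of
   the construction off the excluded right endpoints. *)
pose q' := child c (Q, kap) 0.
have subq'J : sub q' (Q, kap) by apply: sub_child => //; exact: base_gt0.
have subq'I : sub q' (j, i) by apply: sub_trans subq'J subJ.
have subq'q : sub q' q by apply: sub_trans subq'I jiq.
have Hq' : B * side j <= H q'.1.
  rewrite /q'/=; have [jlm|lmj] := leqP j (l + m + 1).
    have QE : Q = (l + m + 1)%N by apply/maxn_idPl.
    rewrite QE.
    have -> : (l + m + 1).+1 = (m + (l + 2))%N by clear; lia.
    have /H_expand : (J0 <= m)%N by exact: leq_trans mj.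
    move=> /(_ (l + 2)%N) h1.
    have h2 : C * side (j - k) <= H m by rewrite mE; exact: hmu.
    have h3 : side (j - k) = c%:R ^+ k * side j.
      by rewrite -(mul_side hc (leq_subr k j)) subKn.
    have cl : 0 < c%:R ^+ (l + 2) :> R by rewrite exprn_gt0.
    rewrite -(ler_pM2l cl); apply: le_trans h1; apply: le_trans h2.
    rewrite h3 mulrA mulrA ler_pM2r ?side_gt0//.
    by rewrite mulrC.
  have QE : Q = j by apply/maxn_idPr; exact: ltnW.
  rewrite QE.
  have h1 : c%:R * B * side j <= H j by exact: hN2.
  have h2 : H j <= c%:R * H j.+1 by apply: H_ge; rewrite (leq_trans Jjk)// leq_subr.
  by rewrite -(ler_pM2l c0) mulrA (le_trans h1).
have Jj : (J0 <= j)%N by rewrite (leq_trans Jjk)// leq_subr.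
exists q'; split => //.
- by rewrite /q'/= ltnS; exact: leq_trans (ltnW qj) jQ.
- split; last first.
    apply: (le_lt_trans (@cost_mono L q' (j, i) Jj subq'I)).
    by apply: (lt_le_trans costI); rewrite lee_fin.
  move=> p r Lp; apply/negP => q'r.
  (* A cover cell containing [q'] either contains [(j, i)], which is avoided, or lies inside it and
     then costs at least [H q'.1], more than is available there. *)
  have [le|lt] := leqP r.1 j.
    by have /negP[] := avI _ _ Lp; exact: sub_comparable subq'I q'r le.
  have rI : sub r (j, i) by exact: sub_comparable q'r subq'I (ltnW lt).
  have := @cost_ge_term L (j, i) p r Jj Lp rI; rewrite leNgt => /negP; apply.
  apply: lt_le_trans costI _; rewrite lee_fin; apply: le_trans Hq' _.
  apply: H_mono; last by case/andP: q'r.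
  by apply: leq_trans Jj _; exact: ltnW.
- have Jq' : sub (Q, kap) q by apply: sub_trans subJ jiq.
  have [_ hb] := sub_bounds Jq'; apply: lt_le_trans hb.
  rewrite /q'/= addn0 [side Q](sideS hc) mulrA -natrM ltr_pM2r ?side_gt0// ltr_nat.
  by rewrite mulSn [(c * _)%N]mulnC; move: hc; clear; lia.
- move=> t q't; exists s, m; split => //; first exact: leq_trans mj.
  have /andP[t1 t2] := sub_cell subq'J q't.
  have /andP[k1 k2] := hkap.
  have hside : side Q < side (l + m).
    rewrite /side ltf_pV2 ?posrE ?exprn_gt0//.
    by rewrite ltr_eXn2l ?ltr1n// (leq_trans _ (leq_maxl _ _))// addn1.
  apply: le_lt_trans hside; rewrite ler_norml; apply/andP; split.
    by move: k2; rewrite /= -natr1 mulrDl mul1r in t2 *; lra.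
  by move: t2; rewrite /= -natr1 mulrDl mul1r; lra.
Qed.

(** Iterating [descent_step] with [l = 0, 1, 2, ...] gives nested good cells. Their common point is
    uncovered: a cover cell [r] containing it would contain the cell number [r.1] of the sequence,
    whose level is at least [r.1]. *)
Lemma descent (L : nat -> option (nat * nat)) q :
  (J0 <= q.1)%N -> good c H L q ->
  exists t, [/\ cell q t, forall l, near_big big l t &
    forall p r, L p = Some r -> ~ cell r t].
Proof.
move=> Jq gq.
have /choice[f hf] : forall x : nat * (nat * nat), exists q',
    (J0 <= x.2.1)%N -> good c H L x.2 ->
    [/\ (x.2.1 < q'.1)%N, good c H L q', sub q' x.2,
    q'.2.+1%:R * side q'.1 < x.2.2.+1%:R * side x.2.1 &
    cell q' `<=` near_big big x.1].
  move=> [l x]; have [[h1 h2]|h] := pselect ((J0 <= x.1)%N /\ good c H L x).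
    by have [q' hq'] := descent_step l h1 h2; exists q'.
  by exists x => /= h1 h2; exfalso; apply: h.
pose s := fix s n := if n is n'.+1 then f (n', s n') else q.
have hs n : (J0 <= (s n).1)%N /\ good c H L (s n).
  elim: n => [//|n [h1 h2]] /=.
  have [h3 h4 _ _ _] := hf (n, s n) h1 h2.
  by split => //; apply: leq_trans (ltnW h3).
have step n : [/\ ((s n).1 < (s n.+1).1)%N, sub (s n.+1) (s n),
   (s n.+1).2.+1%:R * side (s n.+1).1 < (s n).2.+1%:R * side (s n).1 &
    cell (s n.+1) `<=` near_big big n].
  by have [h1 h2] := hs n; have [] := hf (n, s n) h1 h2.
have lvl n : (n <= (s n).1)%N.
  by elim: n => // n IH; have [h _ _ _] := step n; exact: leq_ltn_trans h.
have subs m n : (m <= n)%N -> sub (s n) (s m).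
  move=> mn; rewrite -(subnKC mn); elim: (n - m)%N => [|d IH].
    by rewrite addn0 sub_refl.
  by rewrite addnS; have [_ h _ _] := step (m + d)%N; apply: sub_trans h IH.
pose a n : R := (s n).2%:R * side (s n).1.
pose b n : R := (s n).2.+1%:R * side (s n).1.
have ab n : a n < b n by rewrite /a /b ltr_pM2r ?side_gt0// ltr_nat.
have ab' m n : a m <= b n.
  have [mn|nm] := leqP m n.
    by apply: le_trans (sub_bounds (subs _ _ mn)).1 (ltW (ab n)).
  apply: le_trans (ltW (ab m)) _.
  exact: (sub_bounds (subs _ _ (ltnW nm))).2.
pose A := [set a n | n in [set: nat]].
have A0 : A !=set0 by exists (a 0%N), 0%N.
have hub n : ubound A (b n) by move=> _ [m _ <-]; exact: ab'.
(* The supremum of the left endpoints is at most every right endpoint; strict decrease of the latter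
   makes the inequality strict. *)
have cellt n : cell (s n) (sup A).
  apply/andP; split.
    by apply: ub_le_sup; [exists (b 0%N) | exists n].
  have [_ _ h _] := step n; apply: le_lt_trans h.
  by apply: (ge_sup A0); exact: (hub n.+1).
exists (sup A); split.
- exact: (cellt 0%N).
- by move=> l; have [_ _ _ h] := step l; exact: h.
- move=> p r Lp rt; have [_ [av _]] := hs r.1.
  have /negP[] := av _ _ Lp.
  exact: cell_sub (cellt _) rt (lvl _).
Qed.

End Descent.

Definition interleave (T : Type) (u v : nat -> T) (n : nat) : T :=
  if odd n then v n./2 else u n./2.

Lemma interleave_even (T : Type) (u v : nat -> T) n : interleave u v n.*2 = u n.
Proof. by rewrite /interleave odd_double doubleK. Qed.

Lemma interleave_odd (T : Type) (u v : nat -> T) n : interleave u v n.*2.+1 = v n.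
Proof. by rewrite /interleave/= odd_double/= uphalf_double. Qed.

Lemma interleave_ind (T : Type) (A : T -> Prop) (u v : nat -> T) :
  (forall n, A (u n)) -> (forall n, A (v n)) -> forall n, A (interleave u v n).
Proof. by move=> Au Av n; rewrite /interleave; case: ifP. Qed.

Lemma nneseries_interleave_le (R : realType) (T : Type) (f : T -> \bar R) (u v : nat -> T) :
  (forall n, 0 <= f (u n))%E -> (forall n, 0 <= f (v n))%E ->
  (\sum_(p <oo) f (interleave u v p) <=
     \sum_(p <oo) f (u p) + \sum_(p <oo) f (v p))%E.
Proof.
move=> u0 v0; have uv0 := interleave_ind (A := fun x => (0 <= f x)%E) u0 v0.
apply: lime_le; first by apply: is_cvg_nneseries => p *; exact: uv0.
apply: nearW => n.
apply: (@le_trans _ _ (\sum_(0 <= p < n.*2) f (interleave u v p))%E).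
  rewrite -addnn [leRHS](big_cat_nat (leq0n n) (leq_addr n n))/= leeDl//.
  by apply: sume_ge0 => p *; exact: uv0.
have -> : (\sum_(0 <= p < n.*2) f (interleave u v p) =
   \sum_(0 <= p < n) f (u p) + \sum_(0 <= p < n) f (v p))%E.
  elim: n => [|n IH]; first by rewrite !big_geq// adde0.
  rewrite doubleS !big_nat_recr//= IH interleave_even interleave_odd.
  by rewrite -[RHS]/((_ + _) + (_ + _))%E addeACA addeA.
by apply: leeD; apply: nneseries_lim_ge => *; rewrite ?u0 ?v0.
Qed.

(** * Turning covers of the approximation set into covers of an open set *)

Section Transfer.
Context {R : realType} (c : nat) (hc : (1 < c)%N).
Notation side := (@side R c).
Notation sub := (@sub c).
Notation cell := (@cell R c).
Variables (H : nat -> R) (J0 : nat).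
Hypothesis H_gt0 : forall j, (J0 <= j)%N -> 0 < H j.
Hypothesis H_le : forall j, (J0 <= j)%N -> H j.+1 <= H j.
Hypothesis H_ge : forall j, (J0 <= j)%N -> H j <= c%:R * H j.+1.
Hypothesis H_oo : forall A : R, exists N, forall j, (N <= j)%N -> A * side j <= H j.
Variables (big : nat -> R -> Prop) (mu : nat -> nat).
Hypothesis mu_ge : forall j, (j <= mu j)%N.
Hypothesis H_mu : exists (C : R) (N : nat), 0 < C /\
  forall j, (N <= j)%N -> C * side j <= H (mu j).
Hypothesis rich : forall k q, @rich_at R c (hit c big mu k) q.

Definition weight (o : option (nat * nat)) : \bar R :=
  if o is Some r then (H r.1)%:E else 0%E.

Definition fine_cover (L : nat -> option (nat * nat)) : Prop :=
  forall p r, L p = Some r -> (J0 <= r.1)%N.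

Lemma weight_ge0 L p : fine_cover L -> (0 <= weight (L p))%E.
Proof.
move=> fL; rewrite /weight; case E : (L p) => [r|//].
by rewrite lee_fin ltW// H_gt0// (fL p).
Qed.

Lemma fine_cover_interleave L1 L2 :
  fine_cover L1 -> fine_cover L2 -> fine_cover (interleave L1 L2).
Proof.
move=> f1 f2 p.
exact: (@interleave_ind _ (fun o => forall r, o = Some r -> (J0 <= r.1)%N)).
Qed.

Lemma weight_interleave_le L1 L2 : fine_cover L1 -> fine_cover L2 ->
  (\sum_(p <oo) weight (interleave L1 L2 p) <=
     \sum_(p <oo) weight (L1 p) + \sum_(p <oo) weight (L2 p))%E.
Proof.
by move=> f1 f2; apply: nneseries_interleave_le => n; exact: weight_ge0.
Qed.

Definition covers (L : nat -> option (nat * nat)) (t : R) : Prop :=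
  exists p r, L p = Some r /\ cell r t.

Lemma covers_interleave L1 L2 t : covers (interleave L1 L2) t <-> covers L1 t \/ covers L2 t.
Proof.
split.
  move=> [p [r []]]; rewrite /interleave; case: ifP => _ Lr rt.
    by right; exists p./2, r.
  by left; exists p./2, r.
move=> [[p [r [Lr rt]]]|[p [r [Lr rt]]]].
  by exists p.*2, r; rewrite interleave_even.
by exists p.*2.+1, r; rewrite interleave_odd.
Qed.

Lemma exists_cell (t : R) j : 0 <= t -> exists i, cell (j, i) t.
Proof.
move=> t0; exists (Num.truncn (t / side j)); rewrite /cell/=.
have := truncn_itv (divr_ge0 t0 (side_ge0 hc j)).
by rewrite ler_pdivlMr ?side_gt0// ltr_pdivrMr ?side_gt0.
Qed.

Lemma side_cvg0 (e : R) : 0 < e -> exists N, forall j, (N <= j)%N -> side j < e.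
Proof.
move=> e0; exists (Num.bound e^-1) => j Nj.
rewrite /side invf_plt ?posrE ?exprn_gt0 ?ltr0n ?base_gt0//.
have h := archi_boundP (ltW (_ : 0 < e^-1)); apply: lt_le_trans (h _) _.
  by rewrite invr_gt0.
by rewrite -natrX ler_nat (leq_trans Nj)// ltnW// ltn_expl.
Qed.

Lemma open_contains_cell (U : set R) (t : R) : open U -> U t -> 0 <= t ->
  exists N, forall j i, (N <= j)%N -> cell (j, i) t -> cell (j, i) `<=` U.
Proof.
move=> oU Ut t0; have /nbhs_ballP[e /= e0 he] := oU _ Ut.
have [N hN] := side_cvg0 e0; exists N => j i Nj /andP[/= t1 t2] x /andP[/= x1 x2].
apply: he; rewrite /ball/=; apply: lt_trans (hN _ Nj).
by rewrite ltr_norml; move: t2 x2; rewrite -natr1 mulrDl mul1r => t2 x2; apply/andP; split; lra.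
Qed.

Definition maximal (U : set R) q : Prop := [/\ (J0 <= q.1)%N, cell q `<=` U &
  forall q', (J0 <= q'.1)%N -> sub q q' -> cell q' `<=` U -> (q.1 <= q'.1)%N].

Lemma maximal_eq (U : set R) q q' (t : R) : maximal U q -> maximal U q' -> cell q t -> cell q' t -> q = q'.
Proof.
move=> [q1 q2 q3] [q1' q2' q3'] qt q't.
wlog le : q q' q1 q2 q3 q1' q2' q3' qt q't / (q'.1 <= q.1)%N.
  by move=> hw; have /orP[h|h] := leq_total q'.1 q.1; [|symmetry]; apply: hw.
have s := cell_sub hc qt q't le.
by apply: (sub_level s); apply/eqP; rewrite eqn_leq le (q3 q').
Qed.

Lemma exists_maximal (U : set R) (t : R) : open U -> U t -> 0 <= t ->
  exists2 q, maximal U q & cell q t.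
Proof.
move=> oU Ut t0; have [N hN] := open_contains_cell oU Ut t0.
have ex : exists j, `[< (J0 <= j)%N /\ forall i, cell (j, i) t -> cell (j, i) `<=` U >].
  by exists (maxn J0 N); apply/asboolP; split; [exact: leq_maxl|
     move=> i; apply: hN; exact: leq_maxr].
case: (ex_minnP ex) => j /asboolP[Jj hj] jmin.
have [i ti] := exists_cell j t0.
exists (j, i) => //; split => //; first exact: hj.
move=> q' Jq' sq' q'U; apply: jmin; apply/asboolP; split => // i' ti'.
have q't : cell q' t by exact: sub_cell sq' _ ti.
suff -> : (q'.1, i') = q' by [].
by apply: sub_level => //; apply: cell_sub ti' q't _.
Qed.

(** Consider the maximal cells of [U]. One that lies in a cell of [L] is covered already. Any other
    has no uncovered point of the approximation set, so by [descent] it is not good; hence the cells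
    of [L] inside it cost at least as much as the maximal cell, which can replace them. *)
Lemma cover_transfer (L : nat -> option (nat * nat)) (U : set R) :
  open U -> U `<=` `]0, +oo[ -> fine_cover L ->
  (forall t, U t -> (forall l, near_big c big l t) ->
     covers L t) ->
  exists L', [/\ fine_cover L',
    forall t, U t -> covers L' t &
    (\sum_(p <oo) weight (L' p) <= \sum_(p <oo) weight (L p))%E].
Proof.
move=> oU U0 fL covL.
pose T q := maximal U q /\ avoids c L q.
have Tcost q : T q -> ((H q.1)%:E <= cost c H L q)%E.
  move=> [[q1 q2 q3] av]; rewrite leNgt; apply/negP => lt.
  have [t [qt nt unc]] := descent hc H_gt0 H_le H_ge H_oo mu_ge H_mu rich q1 (conj av lt).
  by have [p [r [Lp]]] := covL _ (q2 _ qt) nt; exact: unc Lp.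
(* [A] keeps the cells of [L] that lie in no replaced maximal cell, and [B] enumerates the replaced
   maximal cells by their codes. *)
pose inT p := exists q r, [/\ T q, L p = Some r & sub r q].
pose A p := if `[< inT p >] then None else L p.
pose B i := if @pickle_inv (nat * nat)%type i is Some q then if `[< T q >] then Some q else None else None.
have fA : fine_cover A by move=> p r; rewrite /A; case: ifP => // _; exact: fL.
have fB : fine_cover B.
  move=> i r; rewrite /B; case: (pickle_inv i) => // q; case: asboolP => // -[[? _ _] _].
  by move=> [<-].
exists (interleave A B); split.
- exact: fine_cover_interleave.
- move=> t Ut; apply/covers_interleave; have t0 : 0 <= t by have := U0 _ Ut; rewrite /= in_itv/= andbT => /ltW.
  have [q mq qt] := exists_maximal oU Ut t0.
  have [av|] := pselect (avoids c L q).
    right; exists (pickle q), q; split => //; rewrite /B pickleK_inv.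
    by case: asboolP => // -[]; split.
  move=> /existsNP[p /existsNP[r /not_implyP[Lp /negP/negPn qr]]].
  have rt : cell r t by exact: sub_cell qr _ qt.
  left; exists p, r; split => //; rewrite /A.
  case: asboolP => // -[q' [r' [[mq' av'] Lp' r'q']]]; exfalso.
  move: Lp'; rewrite Lp => -[rr']; rewrite -rr' in r'q'.
  have e := maximal_eq mq mq' qt (sub_cell hc r'q' rt).
  by have := av' _ _ Lp; rewrite -e qr.
- apply: le_trans (weight_interleave_le fA fB) _.
  (* The dropped cells [D] pay for [B]. Each lies in a single maximal cell, as maximal cells sharing
     a point coincide, so none is charged twice. *)
  pose D p := if `[< inT p >] then L p else None.
  have fD : fine_cover D by move=> p r; rewrite /D; case: ifP => // _; exact: fL.
  have -> : (\sum_(p <oo) weight (L p) =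
      \sum_(p <oo) weight (A p) + \sum_(p <oo) weight (D p))%E.
    rewrite -nneseriesD; [|by move=> *; exact: weight_ge0..].
    by apply: eq_eseriesr => p _; rewrite /A /D; case: ifP; rewrite ?add0e ?adde0.
  rewrite leeD2l//; apply: lime_le.
    by apply: is_cvg_nneseries => p *; exact: weight_ge0.
  apply: nearW => n.
  pose v i p := (if B i is Some q then if L p is Some r then
     if sub r q then (H r.1)%:E else 0 else 0 else 0)%E.
  have v0 i p : (0 <= v i p)%E.
    rewrite /v; case: (B i) => // q; case E: (L p) => [r|//]; case: ifP => // _.
    by rewrite lee_fin ltW// H_gt0// (fL p).
  apply: (@le_trans _ _ (\sum_(0 <= i < n) \sum_(p <oo) v i p)%E).
    apply: lee_sum => i _; rewrite /weight /v; case E : (B i) => [q|]; last first.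
      by apply: nneseries_ge0.
    apply: Tcost; move: E; rewrite /B; case: (pickle_inv i) => // q'.
    by case: asboolP => // Tq' [<-].
  rewrite -nneseries_sum; last by move=> *; exact: v0.
  apply: lee_nneseries => p *; first by apply: sume_ge0 => *; exact: v0.
  have [[i [ilt iN]]|nex] := pselect (exists i, (i < n)%N /\ v i p != 0%E); last first.
    rewrite big1_seq ?weight_ge0// => i; rewrite mem_index_iota => /andP[_ /andP[_ ilt]].
    by apply/eqP; apply: contrapT => /negP h; apply: nex; exists i.
  move: (iN); rewrite {1}/v; case EB : (B i) => [q|]; last by rewrite eqxx.
  case EL : (L p) => [r|]; last by rewrite eqxx.
  case: ifP => rq; last by rewrite eqxx.
  move=> _.
  have hB k q0 : B k = Some q0 -> T q0 /\ k = pickle q0.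
    rewrite /B; case E: (pickle_inv k) => [q1|//]; case: asboolP => // Tq1 [<-]; split => //.
    by have := @pickle_invK (nat * nat)%type k; rewrite E.
  have [Tq iq] := hB _ _ EB.
  have -> : weight (D p) = (H r.1)%:E.
    by rewrite /D; case: asboolP => [_|[]]; [rewrite EL|exists q, r].
  rewrite (bigD1_seq i) ?iota_uniq ?mem_index_iota//= {1}/v EB EL rq.
  rewrite big1_seq ?adde0// => k /andP[ki _]; rewrite /v.
  case EK : (B k) => [q'|//]; rewrite EL; case: ifP => // rq'; exfalso.
  have [[mq' _] kq'] := hB _ _ EK.
  have [rt0 _] : cell r (r.2%:R * side r.1) /\ True.
    split => //; rewrite /cell/= lexx/= ltr_pM2r ?side_gt0// ltr_nat//.
  have := maximal_eq Tq.1 mq' (sub_cell hc rq rt0) (sub_cell hc rq' rt0).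
  by move=> qq'; move/eqP: ki; rewrite kq' iq qq'.
Qed.

End Transfer.

(** * The net content of the approximation set in an open set *)

Section Content.
Context {R : realType} (c : nat) (hc : (1 < c)%N).
Notation side := (@side R c).
Notation sub := (@sub c).
Notation cell := (@cell R c).

(** [J0] is the first level with side below [eps_g h]. The supremum itself need not be admissible,
    but any smaller side lies below some admissible bound. *)
Lemma gauge1_levels (h : R -> R) : is_gauge1 h -> exists J0 : nat,
  [/\ forall j, (side j < eps_g h) = (J0 <= j)%N,
      forall j, (J0 <= j)%N -> 0 < h (side j),
      forall j, (J0 <= j)%N -> h (side j.+1) <= h (side j) &
      forall j, (J0 <= j)%N -> h (side j) <= c%:R * h (side j.+1)].
Proof.
move=> [[e1 [e10 [hmono [h0 hlim]]]] [e2 [e20 [hpos hratio]]]].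
set E := [set e : R | 0 < e <= 1 /\ {in `[0, e] &, {homo h : x y / x <= y}} /\
                   {in `]0, e] &, {homo (fun r => h r / r) : x y /~ x <= y}}].
pose e3 := Num.min 1 (Num.min e1 e2).
have e30 : 0 < e3 by rewrite !lt_min ltr01 e10 e20.
have Ee3 : E e3.
  split; first by rewrite e30 ge_min lexx.
  split=> x y; rewrite !in_itv/= => /andP[x0 xe] /andP[y0 ye].
    apply: hmono; rewrite in_itv/= ?x0 ?y0/=.
      by rewrite (le_trans xe)// !ge_min lexx orbT.
    by rewrite (le_trans ye)// !ge_min lexx orbT.
  apply: hratio; rewrite in_itv/= ?x0 ?y0/=.
    by rewrite (le_trans xe)// !ge_min lexx !orbT.
  by rewrite (le_trans ye)// !ge_min lexx !orbT.
have E0 : E !=set0 by exists e3.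
have eps0 : 0 < eps_g h.
  apply: lt_le_trans e30 _; apply: ub_le_sup => //.
  by exists 1 => x [/andP[]].
have ex : exists j, side j < eps_g h.
  by have [N hN] := side_cvg0 hc eps0; exists N; exact: hN.
case: (ex_minnP ex) => J0 hJ0 Jmin.
have side_le i j : (i <= j)%N -> side j <= side i.
  move=> ij; rewrite -(mul_side hc ij) ler_peMl ?side_ge0//.
  by rewrite exprn_ege1// ler1n base_gt0.
have get j : (J0 <= j)%N -> exists2 e, E e & side j < e.
  move=> Jj; apply: sup_gt => //.
  by apply: le_lt_trans hJ0; exact: side_le.
have sE j e : side j < e -> side j \in `[0, e].
  by move=> je; rewrite in_itv/= side_ge0//= ltW.
have sE' j e : side j < e -> side j \in `]0, e].
  by move=> je; rewrite in_itv/= side_gt0//= ltW.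
exists J0; split.
- by move=> j; apply/idP/idP => [/Jmin//|/side_le/le_lt_trans]; apply.
(* Positivity is only given up to [e2]; beyond it, monotonicity of [h] carries it over. *)
- move=> j Jj; have [le|lt] := leP (side j) e2.
    have hj : 0 < side j <= e2 by rewrite side_gt0.
    by have := hpos _ hj; rewrite ltr_pdivlMr ?(side_gt0 hc)// mul0r.
  have he2 : 0 < h e2.
    have := hpos e2; rewrite e20 lexx => /(_ isT).
    by rewrite ltr_pdivlMr// mul0r.
  have [e [e0 [hm _]] je] := get _ Jj.
  apply: lt_le_trans he2 _; apply: hm; [|exact: sE|exact: ltW].
  by rewrite in_itv/= (ltW e20)/= ltW// (lt_trans lt).
- move=> j Jj; have [e [e0 [hm _]] je] := get _ Jj.
  have jS : side j.+1 <= side j by exact: side_le.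
  by apply: hm => //; apply: sE => //; exact: le_lt_trans je.
- move=> j Jj; have [e [e0 [_ hr]] je] := get _ Jj.
  have jS : side j.+1 <= side j by exact: side_le.
  have := hr (side j) (side j.+1) (sE' _ _ je) (sE' _ _ (le_lt_trans jS je)) jS.
  rewrite ler_pdivrMr ?side_gt0// mulrAC ler_pdivlMr ?side_gt0//.
  rewrite [side j](sideS hc) mulrA ler_pM2r ?side_gt0//.
  by rewrite -sideS// mulrC.
Qed.

Lemma cadic_cell j (i : nat) : cadic c j (Posz i) = cell (j, i).
Proof.
rewrite /cadic /cell/=.
by have -> : (Posz i + 1)%:~R = i.+1%:R :> R by rewrite -natr1 intrD.
Qed.

Lemma near0rP (P : R -> Prop) :
  (\forall x \near 0^'+, P x) <-> exists2 e, 0 < e & forall x, 0 < x < e -> P x.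
Proof.
split; last first.
  by move=> [e e0 he]; near=> x; apply: he; apply/andP; split; near: x;
    [exact: nbhs_right_gt|exact: nbhs_right_lt].
move=> /nbhs_ballP[e /= e0 he]; exists e => // x /andP[x0 xe].
by apply: he => //; rewrite /ball/= sub0r normrN gtr0_norm.
Unshelve. all: by end_near. Qed.

Lemma gauge_small (h : R -> R) (e : R) : is_gauge h -> 0 < e ->
  exists N, forall j, (N <= j)%N -> h (side j) < e.
Proof.
move=> [e1 [e10 [hmono [h0 hlim]]]] e0.
have /near0rP[d d0 hd] : \forall x \near 0^'+, h x < e by exact: (cvgr_lt _ hlim).
have [N hN] := side_cvg0 hc d0; exists N => j /hN jd.
by apply: hd; rewrite side_gt0.
Qed.

Variables (big : nat -> R -> Prop) (mu : nat -> nat).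
Hypothesis mu_ge : forall j, (j <= mu j)%N.
Hypothesis rich : forall k q, @rich_at R c (hit c big mu k) q.
Variable e : nat -> R.

(** This makes countably many exceptional times, such as the jump times, removable at cost [eta]:
    the [n]-th receives a cell of cost below [eta / 2 ^ n.+1]. *)
Lemma cover_countable (H : nat -> R) (J0 : nat) (eta : R) : 0 < eta ->
  (forall j, (J0 <= j)%N -> 0 < H j) ->
  (forall x : R, 0 < x -> exists N, forall j, (N <= j)%N -> H j < x) ->
  exists L, [/\ fine_cover J0 L,
    forall n, 0 <= e n -> covers c L (e n) &
    (\sum_(p <oo) weight H (L p) <= eta%:E)%E].
Proof.
move=> eta0 H0 Hsmall.
have /choice[f hf] : forall n, exists j, (J0 <= j)%N /\ H j < eta / (2 ^ n.+1)%:R.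
  move=> n; have h : 0 < eta / (2 ^ n.+1)%:R by rewrite divr_gt0// ltr0n expn_gt0.
  have [N hN] := Hsmall _ h; exists (maxn J0 N); rewrite leq_maxl; split => //.
  by apply: hN; exact: leq_maxr.
have /choice[i hi] : forall n, exists i, 0 <= e n -> cell (f n, i) (e n).
  move=> n; have [h|h] := leP 0 (e n); last by exists 0%N.
  by have [i hi] := exists_cell hc (f n) h; exists i.
exists (fun n => Some (f n, i n)); split.
- by move=> p _ [<-] /=; have [] := hf p.
- by move=> n e0; exists n, (f n, i n); split => //; exact: hi.
- apply: le_trans (epsilon_trick0 xpredT (ltW eta0)).
  apply: lee_nneseries => n *; first by rewrite lee_fin ltW// H0//; have [] := hf n.
  by rewrite lee_fin ltW//; have [] := hf n.
Qed.

(** For the nontrivial inequality, a cover of the smaller set is completed by a cheap cover of [S],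
    and [cover_transfer] then yields a cover of [U] that costs at most [eta] more. *)
Lemma content_full (h : R -> R) (S U : set R) :
  is_gauge1 h ->
  (forall A : R, exists N, forall j, (N <= j)%N -> A * side j <= h (side j)) ->
  (exists (C : R) (N : nat), 0 < C /\
     forall j, (N <= j)%N -> C * side j <= h (side (mu j))) ->
  S `<=` range e -> open U -> U `<=` `]0, +oo[ ->
  M_inf c h ([set t | (forall l, near_big c big l t) /\ ~ S t] `&` U) = M_inf c h U.
Proof.
move=> g1 Hoo Hmu Se oU U0.
have [J0 [Jeps Hgt0 Hle Hge]] := gauge1_levels g1.
set F := [set t | _].
have h0 : h 0 = 0 by have [[? [? [? []]]]] := g1.
have eps0 : 0 < eps_g h by apply: lt_trans (side_gt0 hc J0) _; rewrite Jeps.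
apply/eqP; rewrite eq_le; apply/andP; split.
  apply: le_ereal_inf => _ [L [h1 h2] <-]; exists L => //; split => //.
  by move=> t [_ /h2].
apply: le_ereal_inf_tmp => _ [L [Leps LF] <-].
apply/lee_addgt0Pr => eta eta0.
(* Cells of negative index do not meet the positive half-line and are discarded. *)
pose Ln p := if L p is Some (j, Posz i) then Some (j, i) else None.
have wL p : (0 <= (h (lam_diam c (L p)))%:E)%E.
  have := Leps p; rewrite lee_fin; case: (L p) => [[j i]|] /=; last by rewrite h0.
  by rewrite -/(side j) Jeps => /Hgt0/ltW.
have fLn : fine_cover J0 Ln.
  move=> p r; rewrite /Ln; have := Leps p; case: (L p) => [[j [i|i]]|]//=.
  by rewrite -/(side j) Jeps => h1 [<-].
have [L2 [fL2 cov2 sum2]] := cover_countable eta0 Hgt0 (fun x x0 => gauge_small g1.1 x0).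
pose L3 := interleave Ln L2.
have fL3 : fine_cover J0 L3 by exact: fine_cover_interleave.
have cov3 t : U t -> (forall l, near_big c big l t) -> covers c L3 t.
  move=> Ut nt; have t0 : 0 < t by have := U0 _ Ut; rewrite /= in_itv/= andbT.
  apply/covers_interleave.
  have [/Se[n _ en]|nS] := pselect (S t).
    by right; rewrite -en; apply: cov2; rewrite en ltW.
  left; have [p _] := LF t (conj (conj nt nS) Ut).
  move=> ct; exists p; move: ct; rewrite /Ln.
  case: (L p) => [[j [i|i]]|]//= ct.
    by exists (j, i); rewrite -cadic_cell.
  exfalso; move: ct; rewrite /cadic/= => /andP[_]; apply/negP; rewrite -leNgt.
  apply: le_trans (ltW t0); rewrite pmulr_lle0; last exact: (side_gt0 hc j).
  by rewrite lerz0 NegzE -addn1 PoszD; lia.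
have [L4 [fL4 cov4 sum4]] := cover_transfer hc Hgt0 Hle Hge Hoo mu_ge Hmu rich oU U0 fL3 cov3.
apply: (@le_trans _ _ (\sum_(p <oo) weight (fun j => h (side j)) (L4 p))%E).
  apply: ereal_inf_lbound.
  exists (fun p => if L4 p is Some (j, i) then Some (j, Posz i) else None).
    split.
      move=> p; case E: (L4 p) => [[j i]|//=]; rewrite /= -/(side j) Jeps.
      exact: (fL4 _ _ E).
    move=> t /cov4[p [[j i] [Lp ct]]]; exists p => //; rewrite Lp/=.
    by rewrite cadic_cell.
  by apply: eq_eseriesr => p _; case: (L4 p) => [[j i]|] //=; rewrite h0.
apply: (le_trans sum4).
apply: (le_trans (weight_interleave_le Hgt0 fLn fL2)).
apply: leeD => //; apply: lee_nneseries => p *; first exact: (weight_ge0 Hgt0).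
by rewrite /Ln; have := wL p; case: (L p) => [[j [i|i]]|].
Qed.

End Content.

Definition lower_slope (R : realType) (g : R -> R) (r : R) : R :=
  inf [set g rho / rho | rho in `]0, r]].

(** * Regularity of the reduced gauge and the choice of jump levels *)

Section ReducedGauge.
Context {R : realType} (c : nat) (hc : (1 < c)%N).
Notation side := (@side R c).
Variable g : R -> R.
Hypothesis gg : is_gauge g.
Notation q := (lower_slope g).
Hypothesis g1_nz : forall e, 0 < e -> exists2 r, 0 < r <= e & g1 g r != 0.


(** The infimum is taken over a growing set, so [q] is nonincreasing; it is positive at a point
    where [g1] does not vanish. Monotonicity of [g1] uses that of [g]. *)
Lemma g1_facts : exists e1 : R, [/\ 0 < e1, 0 < q e1,
  {in `[0, e1] &, {homo g : x y / x <= y}},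
  forall r r', 0 < r -> r <= r' -> r' <= e1 -> g1 g r <= g1 g r' /\ q r' <= q r &
  forall r, 0 < r -> r <= e1 -> g1 g r <= g r].
Proof.
have [e0 [e00 [hmono [h0 hlim]]]] := gg.
have g0 r : 0 <= r -> r <= e0 -> 0 <= g r.
  move=> r0 re; rewrite -h0; apply: hmono => //; rewrite in_itv/=.
    by rewrite lexx ltW.
  by rewrite r0.
have lb r : r <= e0 -> has_lbound [set g rho / rho | rho in `]0, r]].
  move=> re; exists 0 => _ [x + <-]; rewrite /= in_itv/= => /andP[x0 xr].
  by rewrite divr_ge0 ?(ltW x0)// g0 ?(ltW x0)// (le_trans xr).
have ne r : 0 < r -> [set g rho / rho | rho in `]0, r]] !=set0.
  by move=> r0; exists (g r / r), r => //; rewrite /= in_itv/= r0 lexx.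
have qle r rho : r <= e0 -> 0 < rho -> rho <= r -> q r <= g rho / rho.
  move=> re h1 h2; apply: ge_inf; first exact: lb.
  by exists rho => //; rewrite /= in_itv/= h1.
have qge r x : 0 < r -> (forall rho, 0 < rho -> rho <= r -> x <= g rho / rho) -> x <= q r.
  move=> r0 hx; apply: lb_le_inf; first exact: ne.
  by move=> _ [y + <-]; rewrite /= in_itv/= => /andP[y0 yr]; exact: hx.
have qmono r r' : 0 < r -> r <= r' -> r' <= e0 -> q r' <= q r.
  move=> r0 rr' re; apply: qge => // rho h1 h2; apply: qle => //.
  exact: le_trans rr'.
have q0 r : 0 < r -> r <= e0 -> 0 <= q r.
  move=> r0 re; apply: qge => // rho h1 h2.
  by rewrite divr_ge0 ?(ltW h1)// g0 ?(ltW h1)// (le_trans h2).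
have [r1 /andP[r10 r1e] g1r] := g1_nz e00.
exists r1; split => //.
- rewrite lt_neqAle q0// andbT eq_sym; apply: contra g1r => /eqP qr.
  by rewrite /g1 -/(q r1) qr mulr0.
- by move=> x y; rewrite !in_itv/= => /andP[x0 x1] /andP[y0 y1]; apply: hmono;
    rewrite in_itv/= ?x0 ?y0/=; exact: le_trans r1e.
- move=> r r' r0 rr' re; have re' := le_trans re r1e.
  have r'0 := lt_le_trans r0 rr'.
  split; last exact: qmono.
  rewrite /g1 -/(q r) -/(q r') -ler_pdivrMl//.
  apply: qge => // rho h1 h2; rewrite ler_pdivrMl//.
  (* For [rho <= r] the infimum defining [q r] applies directly. For [rho > r] the chain is [r * q r
     <= g r <= g rho <= r' * (g rho / rho)]. *)
  have [le|lt] := leP rho r.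
    apply: ler_pM => //; [exact: ltW| |exact: qle (le_trans rr' re') _ _].
    by apply: q0 => //; exact: le_trans re'.
  apply: (@le_trans _ _ (g r)).
    by rewrite mulrC -ler_pdivlMr//; apply: qle => //; exact: le_trans re'.
  apply: (@le_trans _ _ (g rho)).
    apply: hmono; rewrite ?in_itv/= ?(ltW r0) ?(ltW h1) ?(ltW lt)//=.
    - exact: le_trans re'.
    - exact: le_trans re'.
  rewrite mulrCA ler_peMr//; first by rewrite g0 ?(ltW h1)// (le_trans h2).
  by rewrite ler_pdivlMr// mul1r.
- move=> r r0 re; rewrite /g1 -/(q r) mulrC -ler_pdivlMr//; apply: qle => //.
  exact: le_trans r1e.
Qed.

(** [mu j] is the least level [m], at least [j] and [J1], with [g1 g (side m) <= side j]. By
    minimality [g1] at that level is comparable to [side j], one level costing at most a factor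
    [c]. *)
Lemma reduced_levels (Jmin : nat) : exists (J1 : nat) (mu : nat -> nat) (K C1 : R),
  [/\ [/\ 0 < K, 0 < C1 & (Jmin <= J1)%N],
      forall j, (J1 <= j)%N -> [/\ K * side j <= g1 g (side j),
         g1 g (side j.+1) <= g1 g (side j), g1 g (side j) <= c%:R * g1 g (side j.+1) &
         g1 g (side j) <= g (side j)],
      forall j, [/\ (j <= mu j)%N, (J1 <= mu j)%N & g1 g (side (mu j)) <= side j],
      forall j, (J1 <= j)%N -> C1 * side j <= g1 g (side (mu j)) &
      exists2 e1, 0 < e1 & side J1 <= e1 /\
      [/\ 0 < q e1, {in `[0, e1] &, {homo g : x y / x <= y}},
      forall r r', 0 < r -> r <= r' -> r' <= e1 -> g1 g r <= g1 g r' /\ q r' <= q r &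
      forall r, 0 < r -> r <= e1 -> g1 g r <= g r]].
Proof.
have [e1 [e10 qe1 gm gmono gle]] := g1_facts.
have [J1 [Jmin1 hJ1]] : exists J1, (Jmin <= J1)%N /\ forall j, (J1 <= j)%N -> side j < e1.
  have [N hN] := side_cvg0 hc e10; exists (maxn N Jmin); split; first exact: leq_maxr.
  by move=> j; rewrite geq_max => /andP[/hN].
have side_le i j : (i <= j)%N -> side j <= side i.
  move=> ij; rewrite -(mul_side hc ij) ler_peMl ?side_ge0//.
  by rewrite exprn_ege1// ler1n base_gt0.
have G_le i j : (J1 <= i)%N -> (i <= j)%N -> g1 g (side j) <= g1 g (side i).
  move=> Ji ij.
  by have [] := gmono (side j) (side i) (side_gt0 hc j) (side_le _ _ ij) (ltW (hJ1 _ Ji)).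
have G_K j : (J1 <= j)%N -> q e1 * side j <= g1 g (side j).
  move=> Jj; rewrite /g1 -/(q _) mulrC ler_pM2l ?side_gt0//.
  by have [] := gmono (side j) e1 (side_gt0 hc j) (ltW (hJ1 _ Jj)) (lexx _).
have G_c j : (J1 <= j)%N -> g1 g (side j) <= c%:R * g1 g (side j.+1).
  move=> Jj; rewrite /g1 -/(q _) -/(q _) mulrA -sideS// ler_pM2l ?side_gt0//.
  by have [] := gmono (side j.+1) (side j) (side_gt0 hc _) (side_le _ _ (leqnSn _))
    (ltW (hJ1 _ Jj)).
have G_g j : (J1 <= j)%N -> g1 g (side j) <= g (side j).
  by move=> Jj; apply: gle; rewrite ?side_gt0// ltW// hJ1.
have ex j : exists m, [&& (j <= m)%N, (J1 <= m)%N & g1 g (side m) <= side j].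
  have [N hN] := gauge_small hc gg (side_gt0 hc j).
  exists (maxn N (maxn j J1)).
  have h1 : (j <= maxn N (maxn j J1))%N by rewrite !leq_max leqnn !orbT.
  have h2 : (J1 <= maxn N (maxn j J1))%N by rewrite !leq_max leqnn !orbT.
  rewrite h1 h2/=; apply: le_trans (G_g _ h2) _; apply/ltW/hN.
  exact: leq_maxl.
pose mu j := ex_minn (ex j).
have hmu j : [/\ (j <= mu j)%N, (J1 <= mu j)%N & g1 g (side (mu j)) <= side j].
  by rewrite /mu; case: ex_minnP => m /and3P[].
have c0 : 0 < c%:R :> R by rewrite ltr0n base_gt0.
(* In the minimum, [q e1] serves when [mu j = j], by the linear lower bound on [g1]; [c^-1] serves
   when [mu j > j], by minimality. *)
exists J1, mu, (q e1), (Num.min (q e1) c%:R^-1); split => //.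
- by split => //; rewrite lt_min qe1 invr_gt0 c0.
- by move=> j Jj; split; [exact: G_K|apply: G_le|exact: G_c|exact: G_g].
- move=> j Jj; have [h1 h2 h3] := hmu j.
  have [jm|jm] := eqVneq (mu j) j.
    rewrite jm; apply: le_trans (G_K _ Jj).
    by rewrite ler_pM2r ?side_gt0// ge_min lexx.
  have jlt : (j < mu j)%N by rewrite ltn_neqAle eq_sym jm h1.
  have lt : side j < g1 g (side (mu j).-1).
    rewrite ltNge; apply/negP => le.
    have : (mu j <= (mu j).-1)%N.
      rewrite {1}/mu; case: ex_minnP => m _; apply.
      rewrite le andbT; move: jlt Jj; case: (mu j) => // m'.
      by rewrite ltnS/= => jm' Jj; rewrite jm' (leq_trans Jj).
    by case: (mu j) jlt => // m' _; rewrite /= ltnn.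
  have /G_c : (J1 <= (mu j).-1)%N by apply: leq_trans Jj _; rewrite -ltnS (ltn_predK jlt).
  rewrite (ltn_predK jlt) => /(lt_le_trans lt)/ltW le.
  apply: (@le_trans _ _ (c%:R^-1 * side j)).
    by rewrite ler_pM2r ?side_gt0// ge_min lexx orbT.
  by rewrite ler_pdivrMl.
- by exists e1 => //; split => //; exact/ltW/hJ1.
Qed.

End ReducedGauge.

Lemma prec_levels (R : realType) (c : nat) (hc : (1 < c)%N) (g gbar : R -> R)
    (J1 : nat) (K : R) :
  0 < K -> (forall j, (J1 <= j)%N -> K * side c j <= g (side c j)) -> gauge_prec gbar g ->
  forall A, exists N, forall j, (N <= j)%N -> A * g (side c j) <= gbar (side c j) :> R.
Proof.
move=> K0 hK [_ hoo] A.
have /near0rP[d d0 hd] : \forall x \near 0^'+, A <= gbar x / g x by exact: (cvgryPge _).1 hoo A.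
have [N hN] := side_cvg0 hc d0; exists (maxn N J1) => j; rewrite geq_max => /andP[Nj Jj].
have gpos : 0 < g (side c j) by apply: lt_le_trans (hK _ Jj); rewrite mulr_gt0// side_gt0.
by rewrite -ler_pdivlMr//; apply: hd; rewrite side_gt0//= hN.
Qed.

(** * Càdlàg paths and singular times *)

Section EuclideanNorm.
Context {R : realType} {d : nat}.
Implicit Types x y : 'rV[R]_d.

Lemma eucl_ge0 x : 0 <= eucl x.
Proof. exact: sqrtr_ge0. Qed.

Lemma eucl0 : eucl (0 : 'rV[R]_d) = 0.
Proof. by rewrite /eucl big1 ?sqrtr0// => i _; rewrite mxE expr0n. Qed.

Lemma eucl_gt0 x : (0 < eucl x) = (x != 0).
Proof.
rewrite lt_neqAle eucl_ge0 andbT eq_sym; congr negb; apply/eqP/eqP; last first.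
  by move=> ->; rewrite eucl0.
move=> /eqP; rewrite sqrtr_eq0 => h; apply/rowP => i; rewrite mxE.
have : x ord0 i ^+ 2 <= 0.
  apply: le_trans h; rewrite (bigD1 i)//= lerDl sumr_ge0// => j _.
  exact: sqr_ge0.
by rewrite le_eqVlt ltNge sqr_ge0 orbF sqrf_eq0 => /eqP.
Qed.

Lemma eucl_sub_le x y (M : R) : eucl x <= M -> eucl y <= M -> eucl (x - y) <= 2 * M.
Proof.
move=> xM yM; have M0 : 0 <= M := le_trans (eucl_ge0 x) xM.
have sq (z : 'rV[R]_d) : \sum_(i < d) z ord0 i ^+ 2 = eucl z ^+ 2.
  by rewrite sqr_sqrtr// sumr_ge0// => i _; exact: sqr_ge0.
rewrite -(@ler_pXn2r _ 2)// ?nnegrE ?eucl_ge0 ?mulr_ge0// -sq.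
apply: (@le_trans _ _ (2 * (eucl x ^+ 2 + eucl y ^+ 2))).
  rewrite -!sq mulrDr !mulr_sumr -big_split/=; apply: ler_sum => i _.
  by rewrite !mxE; have := sqr_ge0 (x ord0 i + y ord0 i); nra.
have hx : eucl x ^+ 2 <= M ^+ 2 by rewrite ler_pXn2r ?nnegrE ?eucl_ge0.
have hy : eucl y ^+ 2 <= M ^+ 2 by rewrite ler_pXn2r ?nnegrE ?eucl_ge0.
by rewrite exprMn; nra.
Qed.

(** Hypotheses by coordinates suit rows of polynomials as well as paths. *)
Lemma cvg_eucl_coord (T : Type) (F : set_system T) (f h : T -> 'rV[R]_d) (A B : 'rV[R]_d) :
  Filter F -> (forall i, f t ord0 i @[t --> F] --> A ord0 i) ->
  (forall i, h t ord0 i @[t --> F] --> B ord0 i) ->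
  eucl (f t - h t) @[t --> F] --> eucl (A - B).
Proof.
move=> FF fA hB.
apply: (@cvg_comp _ _ _ _ Num.sqrt _ (nbhs (\sum_(i < d) (A - B) ord0 i ^+ 2)));
  last exact: sqrt_continuous.
have -> : (fun t => \sum_(i < d) (f t - h t) ord0 i ^+ 2) =
  (fun t => \sum_(i < d) ((f t ord0 i - h t ord0 i) * (f t ord0 i - h t ord0 i))).
  by apply/funext => t; apply: eq_bigr => i _; rewrite !mxE expr2.
have -> : \sum_(i < d) (A - B) ord0 i ^+ 2 =
    \sum_(i < d) ((A ord0 i - B ord0 i) * (A ord0 i - B ord0 i)).
  by apply: eq_bigr => i _; rewrite !mxE expr2.
apply: cvg_big => [| i _]; first exact: add_continuous.
by apply: cvgM; apply: cvgB.
Qed.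

Lemma cvg_coord (T : Type) (F : set_system T) (f : T -> 'rV[R]_d) (A : 'rV[R]_d) i :
  Filter F -> f @ F --> A -> f t ord0 i @[t --> F] --> A ord0 i.
Proof.
move=> FF fA.
apply: (@cvg_comp _ _ _ f (fun M : 'rV[R]_d => M ord0 i) F (nbhs A) _ fA).
exact: coord_continuous.
Qed.

Lemma cvg_eucl_sub (T : Type) (F : set_system T) (f h : T -> 'rV[R]_d) (A B : 'rV[R]_d) :
  Filter F -> f @ F --> A -> h @ F --> B ->
  eucl (f t - h t) @[t --> F] --> eucl (A - B).
Proof. by move=> FF fA hB; apply: cvg_eucl_coord => i; exact: cvg_coord. Qed.

Lemma cvg_eucl_sub2 (T U : Type) (F : set_system T) (G : set_system U)
  (FF : Filter F) (GG : Filter G) (f : T -> 'rV[R]_d) (h : U -> 'rV[R]_d)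
  (A B : 'rV[R]_d) : f @ F --> A -> h @ G --> B ->
  eucl (h p.2 - f p.1) @[p --> filter_prod F G] --> eucl (B - A).
Proof.
move=> fA hB; apply: cvg_eucl_sub.
  exact: (cvg_comp _ _ cvg_snd hB).
exact: (cvg_comp _ _ cvg_fst fA).
Qed.

End EuclideanNorm.

Section Paths.
Context {R : realType} {Omega : Type} {d : nat} (X : R -> Omega -> 'rV[R]_d) (om : Omega).
Hypothesis Xr : forall t, 0 <= t -> (X s om) @[s --> t^'+] --> X t om.
Hypothesis Xl : forall t, 0 < t -> cvg ((X s om) @[s --> t^'-]).

Let x t := X t om.

Lemma near_leftP (P : R -> Prop) t :
  (\forall s \near t^'-, P s) -> exists2 e, 0 < e & forall s, t - e < s < t -> P s.
Proof.
move=> /nbhs_ballP[e /= e0 he]; exists e => // s /andP[s1 s2].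
by apply: he => //; rewrite /ball/= gtr0_norm; lra.
Qed.

(* Closed on the right at t, unlike the punctured filter t^'+. *)
Let rt (t : R) := within (fun s => t <= s) (nbhs t).

#[local] Instance rt_filter t : Filter (rt t).
Proof. exact: within_filter. Qed.

Let lt_filter (t : R) : Filter t^'-.
Proof. exact: within_filter. Qed.

Lemma cvg_rt t : 0 <= t -> x @ rt t --> x t.
Proof.
move=> t0 A hA; have := Xr t0 hA; rewrite /rt /within/= !nbhs_simpl/=.
rewrite /at_right /within/= => h; near=> s.
rewrite le_eqVlt => /predU1P[<-|ts]; first exact: nbhs_singleton.
by move: ts; near: s.
Unshelve. all: by end_near. Qed.

Lemma rtP (P : R -> R -> Prop) t :
  filter_prod (rt t) (rt t) (fun p => P p.1 p.2) ->
  exists2 e, 0 < e & forall s u, t <= s < t + e -> t <= u < t + e -> P s u.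
Proof.
move=> [[/= A B] [/= /nbhs_ballP[e1 /= e10 h1] /nbhs_ballP[e2 /= e20 h2]] h].
exists (Num.min e1 e2); first by rewrite lt_min e10.
move=> s u /andP[ts se] /andP[tu ue]; apply: (h (s, u)); split.
  apply: h1 => //; rewrite /ball/= distrC ger0_norm ?subr_ge0//.
  by move: se; rewrite -ltrBlDl lt_min => /andP[].
apply: h2 => //; rewrite /ball/= distrC ger0_norm ?subr_ge0//.
by move: ue; rewrite -ltrBlDl lt_min => /andP[].
Qed.

Lemma right_small t (eta : R) : 0 <= t -> 0 < eta -> exists2 e, 0 < e &
  forall p q, t <= p < t + e -> t <= q < t + e -> eucl (x q - x p) < eta.
Proof.
move=> t0 eta0; apply: (@rtP (fun p q => eucl (x q - x p) < eta)).
have hcv := cvg_eucl_sub2 (rt_filter t) (rt_filter t) (cvg_rt t0) (cvg_rt t0).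
by rewrite subrr eucl0 in hcv; exact: (cvgr_lt _ hcv _ eta0).
Qed.

Lemma left_small t (eta : R) : 0 < t -> 0 < eta -> exists2 e, 0 < e &
  forall p q, t - e < p < t -> t - e < q < t -> eucl (x q - x p) < eta.
Proof.
move=> t0 eta0.
have hcv := cvg_eucl_sub2 (lt_filter t) (lt_filter t) (Xl t0) (Xl t0).
rewrite subrr eucl0 in hcv; have [[/= A B] [/= /near_leftP[e1 e10 h1]
  /near_leftP[e2 e20 h2]] h] :=
  cvgr_lt _ hcv _ eta0.
exists (Num.min e1 e2); first by rewrite lt_min e10.
move=> s u /andP[se st] /andP[ue ut]; apply: (h (s, u)); split; [apply: h1|apply: h2].
  by rewrite st andbT; apply: le_lt_trans se; rewrite lerB// ge_min lexx.
by rewrite ut andbT; apply: le_lt_trans ue; rewrite lerB// ge_min lexx orbT.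
Qed.

Lemma jump_near t (eta : R) : 0 < t -> 0 < eta -> exists2 e, 0 < e &
  forall p q, t - e < p < t -> t <= q < t + e ->
    `|eucl (x q - x p) - eucl (jump X om t)| < eta.
Proof.
move=> t0 eta0.
have := cvg_eucl_sub2 (lt_filter t) (rt_filter t) (Xl t0) (cvg_rt (ltW t0)).
have -> : x t - lim (X s om @[s --> t^'-]) = jump X om t by rewrite /jump t0.
move=> /cvgrPdist_lt/(_ _ eta0)[[/= A B] [/= /near_leftP[e1 e10 h1]
  /nbhs_ballP[e2 /= e20 h2]] h].
exists (Num.min e1 e2); first by rewrite lt_min e10.
move=> s u /andP[se st] /andP[tu ue]; rewrite distrC; apply: (h (s, u)); split.
  apply: h1; rewrite st andbT; apply: le_lt_trans se.
  by rewrite lerB// ge_min lexx.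
apply: h2 => //; rewrite /ball/= distrC ger0_norm ?subr_ge0//.
by move: ue; rewrite -ltrBlDl lt_min => /andP[].
Qed.

(** Near a fixed [u], two times on the same side of [u] have nearby values, and times on both sides
    have an increment close in norm to the jump at [u], which is below [r]. Compactness of [[a, b]]
    makes the scale uniform. *)
Lemma small_increments (a b r : R) : 0 <= a -> 0 < r ->
  (forall s, a < s -> s <= b -> eucl (jump X om s) < r) ->
  exists2 e, 0 < e & forall p q, a <= p -> p <= q -> q <= b -> q - p < e ->
    eucl (x q - x p) <= r.
Proof.
move=> a0 r0 small.
have local u : a <= u -> u <= b -> exists2 e, 0 < e & forall p q,
    a <= p -> p <= q -> q <= b -> u - e < p -> q < u + e -> eucl (x q - x p) <= r.
  move=> au ub; have [e1 e10 h1] := right_small (le_trans a0 au) r0.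
  (* At [u = a] no time lies to the left, so the jump at [a], on which nothing is assumed, does not
     enter. *)
  have [ua|ua] := eqVneq a u.
    exists e1 => // p q ap pq qb _ qe; apply: ltW; apply: h1; apply/andP; split; lra.
  have ltau : a < u by rewrite lt_neqAle ua.
  have u0 := le_lt_trans a0 ltau.
  have [e2 e20 h2] := left_small u0 r0.
  have eta0 : 0 < r - eucl (jump X om u) by rewrite subr_gt0 small.
  have [e3 e30 h3] := jump_near u0 eta0.
  have [e [e0 ee1 ee2 ee3]] : exists e, [/\ 0 < e, e <= e1, e <= e2 & e <= e3].
    exists (Num.min e1 (Num.min e2 e3)).
    by rewrite !lt_min e10 e20 e30 !ge_min !lexx !orbT.
  exists e => // p q ap pq qb pe qe; apply: ltW.
  have [up|pu] := leP u p.
    by apply: h1; apply/andP; split; lra.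
  have [uq|qu] := leP u q.
    have := h3 p q; rewrite ltr_norml => h.
    have /andP[_] : - (r - eucl (jump X om u)) < eucl (x q - x p) - eucl (jump X om u) < r - eucl (jump X om u).
      by apply: h; apply/andP; split; lra.
    by rewrite ltrD2r.
  by apply: h2; apply/andP; split; lra.
pose P (e p : R) := a <= p -> forall q, p <= q -> q <= b -> q - p < e -> eucl (x q - x p) <= r.
have cover u : `[a, b]%classic u -> \forall p \near u & e \near 0^'+, P e p.
  rewrite /= in_itv/= => /andP[au ub]; have [e e0 he] := local _ au ub.
  (* Half for the distance of [p] from [u] and half for the length [q - p] keep both times within
     [e] of [u]. *)
  exists (ball u (e / 2), [set e' | 0 < e' < e / 2]) => /=.
    split; first by apply: nbhsx_ballx; rewrite divr_gt0.
    by apply/near0rP; exists (e / 2) => //; rewrite divr_gt0.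
  move=> [p e'] [/= pu /andP[e'0 e'e]] ap q pq qb qpe.
  move: pu; rewrite /ball/= ltr_norml => /andP[pu1 pu2].
  by apply: he => //; lra.
have F0 : Filter (0^'+ : set_system R) by exact: within_filter.
have ncov := (compact_near_coveringP _).1 (@segment_compact R a b) R (0^'+) P F0 cover.
have [e e0 he] := (near0rP _).1 ncov; exists (e / 2); first by rewrite divr_gt0.
move=> p q ap pq qb qpe; apply: (he (e / 2) _ p) => //; first by apply/andP; split; lra.
by rewrite /= in_itv/= ap (le_trans pq).
Qed.

Lemma jump_persists s r : 0 < s -> r < eucl (jump X om s) ->
  exists2 e, 0 < e & forall p q, p < s -> s <= q -> q - p < e -> r < eucl (x q - x p).
Proof.
move=> s0 rs; have eta0 : 0 < eucl (jump X om s) - r by rewrite subr_gt0.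
have [e e0 he] := jump_near s0 eta0; exists e => // p q ps sq qpe.
have := he p q; rewrite ltr_norml => h.
have /andP[] : - (eucl (jump X om s) - r) < eucl (x q - x p) - eucl (jump X om s) <
    eucl (jump X om s) - r.
  by apply: h; apply/andP; split; lra.
lra.
Qed.

(** A jump of norm at least [k.+1^-1] is the first such jump after some rational, because the left
    limit forces the jumps just before it to be smaller. The pair of [k] and this rational
    determines the jump time. *)
Lemma jump_times_range : exists e : nat -> R, jump_times X om `<=` range e.
Proof.
pose Q (k : nat) (q : rat) (t : R) := [/\ 0 < t, k.+1%:R^-1 <= eucl (jump X om t), ratr q < t &
  forall u, ratr q < u -> u < t -> eucl (jump X om u) < k.+1%:R^-1].
exists (fun n => if unpickle n is Some kq then xget 0 (Q kq.1 kq.2) else 0).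
move=> t [t0 jt]; rewrite -eucl_gt0 in jt.
pose k := Num.bound (eucl (jump X om t))^-1.
have hk : k.+1%:R^-1 <= eucl (jump X om t).
  rewrite invf_ple ?posrE//; apply: ltW.
  apply: lt_le_trans (archi_boundP _) _; first by rewrite invr_ge0 ltW.
  by rewrite ler_nat leqnSn.
have k0 : 0 < k.+1%:R^-1 :> R by rewrite invr_gt0.
(* The jump at [u] exceeds the increment from [p] to [u] by less than [eta], and that increment is
   itself below [eta]. *)
pose eta : R := k.+1%:R^-1 / 2.
have eta0 : 0 < eta by rewrite divr_gt0.
have [e e0 he] := left_small t0 eta0.
have : Num.max 0 (t - e) < t by rewrite gt_max t0/= gtrBl.
move=> /rat_in_itvoo[q]; rewrite in_itv/= gt_max => /andP[/andP[q0 qe] qt].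
have Qt : Q k q t.
  split => // u qu ut; have u0 : 0 < u by exact: lt_trans qu.
  have [e' e'0 he'] := jump_near u0 eta0.
  have [p [pu p1 p2 tep]] : exists p, [/\ p < u, u - e' < p, ratr q < p & t - e < p].
    exists (Num.max (u - e' / 2) ((ratr q + u) / 2)).
    have lt1 : ratr q < (ratr q + u) / 2 by rewrite midf_lt.
    have lt2 : (ratr q + u) / 2 < u by rewrite midf_lt.
    have lt3 : u - e' < u - e' / 2 by rewrite ltrD2l ltrN2 ltr_pdivrMr// ltr_pMr// ltr1n.
    have lt4 : u - e' / 2 < u by rewrite gtrBl divr_gt0.
    by rewrite gt_max !lt_max lt1 lt2 lt3 lt4 (lt_trans qe lt1) !orbT.
  have pt := lt_trans pu ut; have teu := lt_trans tep pu.
  have h1 : `|eucl (x u - x p) - eucl (jump X om u)| < eta.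
    by apply: he'; rewrite ?p1 ?pu ?lexx ?ltrDl.
  have h2 : eucl (x u - x p) < eta by apply: he; apply/andP.
  move: h1; rewrite ltr_norml => /andP[h1 _].
  have -> : k.+1%:R^-1 = eta + eta by rewrite -splitr.
  move: (eucl (x u - x p)) (eucl (jump X om u)) (eta) h1 h2 => E J z h1 h2.
  lra.
exists (pickle (k, q)) => //; rewrite pickleK/=.
case: xgetP => [t' _ [t'0 t'k t'q t'm]|/(_ t)//].
have [_ _ tq tm] := Qt.
have [lt|lt|//] := ltgtP t' t.
  by have := tm _ t'q lt; rewrite ltNge t'k.
by have := t'm _ tq lt; rewrite ltNge hk.
Qed.

End Paths.

Section Singular.
Context {R : realType} {Omega : Type} {d : nat} (X : R -> Omega -> 'rV[R]_d) (om : Omega).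
Hypothesis Xl : forall t, 0 < t -> cvg ((X s om) @[s --> t^'-]).
Context (c : nat) (hc : (1 < c)%N) (w : R -> R).
Hypothesis hw : is_modulus_fun w.
Notation side := (@side R c).

Definition big_jump (m : nat) (s : R) : Prop :=
  jump_times X om s /\ w (side m) <= eucl (jump X om s).

(** The lower bound on [w (2 * x) / w x] is iterated [l] times. *)
Lemma modulus_fun_decay : exists (a r0 : R), [/\ 1 < a, 0 < r0,
  forall x y, 0 <= x -> x < y -> y <= r0 -> w x < w y &
  forall l x, 0 < x -> x <= r0 -> a ^+ l * w (x / 2 ^+ l) <= w x].
Proof.
have [e [e0 [_ [wmono [w0 [[a [a1 /near0rP[e' e'0 hlow]]] _]]]]]] := hw.
exists a, (Num.min (e' / 2) e); split => //.
- by rewrite lt_min e0 divr_gt0.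
- move=> x y x0 xy; rewrite le_min => /andP[_ ye].
  rewrite wmono// in_itv/= ?x0/= ?ye ?andbT; first exact: le_trans (ltW xy) ye.
  exact: le_trans x0 (ltW xy).
- elim=> [|l IH] x x0; first by rewrite !expr0 divr1 mul1r.
  move=> xr; apply: le_trans (IH x x0 xr).
  set y := x / 2 ^+ l.
  have y0 : 0 < y by rewrite divr_gt0// exprn_gt0.
  have yx : y <= x by rewrite ler_pdivrMr ?exprn_gt0// ler_peMr ?(ltW x0)// exprn_ege1// ler1n.
  have -> : x / 2 ^+ l.+1 = y / 2 by rewrite exprSr invfM mulrA.
  move: xr; rewrite le_min => /andP[xe' xe].
  rewrite exprSr -mulrA ler_pM2l ?exprn_gt0 ?(lt_trans _ a1)//.
  have y20 : 0 < y / 2 by rewrite divr_gt0.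
  have wy : 0 < w (y / 2).
    rewrite -w0 wmono// in_itv/= ?lexx ?(ltW e0) ?(ltW y20)//=.
    by lra.
  rewrite -ler_pdivlMr//.
  have := hlow (y / 2); rewrite mulrCA divff ?mulr1 ?pnatr_eq0// mulrC.
  rewrite mulrC; apply; rewrite y20/=; lra.
Qed.

(** If [w] were a modulus at [t] with constant [C], a jump at [s] within [side (l + m)] of [t] would
    have norm at most [2 * C * w (side (l + m))], since polynomials are continuous. But it is at
    least [w (side m) >= a ^+ l * w (side (l + m))], and [l] is chosen with [a ^+ l > 2 * C]. *)
Lemma near_big_singular (t : R) : 0 < t -> ~ jump_times X om t ->
  (forall l, near_big c big_jump l t) -> Fw X w om t.
Proof.
move=> t0 nSt nt; split; first exact: ltW.
split => //.
move=> [C [Pol [dl [C0 [dl0 hmod]]]]].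
have [a [r0 [a1 r00 wmono decay]]] := modulus_fun_decay.
have a0 : 0 < a by exact: lt_trans a1.
have [l1 hl1] : exists l, 2 * C < a ^+ l.
  have z0 : 0 <= 2 * C / (a - 1) by rewrite divr_ge0 ?mulr_ge0 ?(ltW C0)// subr_ge0 ltW.
  exists (Num.bound (2 * C / (a - 1))).
  have := archi_boundP z0; set n := Num.bound _.
  rewrite ltr_pdivrMr ?subr_gt0// => h; apply: lt_le_trans h _.
  elim: (n) => [|k IH]; first by rewrite mul0r exprn_ge0// ltW.
  have ak : 1 <= a ^+ k by rewrite exprn_ege1// ltW.
  by rewrite -natr1 exprS; nra.
have min0 : 0 < Num.min r0 dl by rewrite lt_min r00.
have [l2 hl2] := side_cvg0 hc min0.
have {}hl2 : forall j : nat, (l2 <= j)%N -> side j < r0 /\ side j < dl.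
  by move=> j /hl2; rewrite lt_min => /andP.
pose l := maxn l1 l2.
have [s [m [lm [[s0 js] ws] ts]]] := nt l.
have l2l : (l2 <= l)%N by exact: leq_maxr.
have [sm1 sm2] := hl2 m (leq_trans l2l lm).
have [slm1 slm2] := hl2 (l + m)%N (leq_trans l2l (leq_addr _ _)).
set ka := side (l + m) in ts slm1 slm2.
have ka0 : 0 < ka by exact: side_gt0.
have st : s != t by apply/eqP => st; apply: nSt; rewrite -st; split.
pose M := C * w ka.
have bound s' : 0 <= s' -> `|s' - t| < ka -> eucl (X s' om - \row_(i < d) (Pol i).[s' - t]) <= M.
  move=> s'0 s't; apply: le_trans (hmod _ s'0 (lt_trans s't slm2)) _.
  rewrite ler_pM2l//.
  exact/ltW/wmono/ltW.
have Ms : eucl (X s om - \row_(i < d) (Pol i).[s - t]) <= M.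
  by apply: bound; [exact: ltW|rewrite distrC].
have st' : `|s - t| < ka by rewrite distrC.
have lim_le : eucl (jump X om s) <= 2 * M.
  (* The jump is a difference of two deviations from the same polynomial value; the second is a left
     limit of deviations at times near [t]. *)
  have -> : jump X om s = (X s om - \row_(i < d) (Pol i).[s - t]) -
      (lim (X u om @[u --> s^'-]) - \row_(i < d) (Pol i).[s - t]).
    by rewrite /jump s0 opprB addrA subrK.
  apply: (cvgr_to_le (F := s^'-) (f := fun u => eucl ((X s om - \row_(i < d) (Pol i).[s - t]) -
       (X u om - \row_(i < d) (Pol i).[u - t])))).
    apply: cvg_eucl_coord => i; first exact: cvg_cst.
    under eq_cvg do rewrite !mxE.
    rewrite !mxE; apply: cvgB; first exact: cvg_coord (Xl s0).
    apply: (@cvg_comp _ _ _ (fun u => u - t) (horner (Pol i)) _ (nbhs (s - t)));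
      last exact: continuous_horner.
    by apply: cvgB; [exact: cvg_within|exact: cvg_cst].
  near=> u; apply: eucl_sub_le => //; apply: bound.
    by apply/ltW; near: u; exact: nbhs_left_gt.
  near: u; have hcv : `|u - t| @[u --> s^'-] --> `|s - t|.
    by apply: cvg_norm; apply: cvgB; [exact: cvg_within|exact: cvg_cst].
  exact: (cvgr_lt _ hcv _ st').
(* Because [c >= 2], one level down at least halves the side, so the dyadic decay of [w] applies for
   every base. *)
have side2 : ka <= side m / 2 ^+ l.
  rewrite /ka sideD mulrC ler_pM2l ?side_gt0// /side lef_pV2 ?posrE ?exprn_gt0//.
    by rewrite lerXn2r ?nnegrE ?ler0n// ler_nat.
  by rewrite ltr0n base_gt0.
have sm0 := side_gt0 (R := R) hc m.
have w2 : w ka <= w (side m / 2 ^+ l).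
  move: side2; rewrite le_eqVlt => /predU1P[->//|lt]; apply/ltW/wmono => //.
    exact: ltW.
  apply: le_trans (ltW sm1); rewrite ler_pdivrMr ?exprn_gt0//.
  by rewrite ler_peMr ?(ltW sm0)// exprn_ege1// ler1n.
have w3 := decay l (side m) sm0 (ltW sm1).
have wm0 : 0 < w (side m).
  by apply: le_lt_trans (wmono _ _ (lexx 0) sm0 (ltW sm1)); have [? [? [? [? [-> ?]]]]] := hw.
have al : a ^+ l1 <= a ^+ l by apply: ler_weXn2l; [exact: ltW|exact: leq_maxl].
suff : w (side m) < w (side m) by rewrite ltxx.
apply: le_lt_trans (le_trans ws lim_le) _.
apply: lt_le_trans w3; rewrite /M mulrA.
have wk0 : 0 < w ka.
  by apply: le_lt_trans (wmono _ _ (lexx 0) ka0 (ltW slm1)); have [? [? [? [? [-> ?]]]]] := hw.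
apply: (@lt_le_trans _ _ (a ^+ l * w ka)); last by rewrite ler_pM2l// exprn_gt0.
by rewrite ltr_pM2r//; exact: lt_le_trans al.
Unshelve. all: by end_near. Qed.

End Singular.

(** * Jumps and independence of increments *)

Section LowerIntegral.
Import HBNNSimple.
Local Open Scope ereal_scope.

Lemma ereal_sup_add_le (R : realType) (S1 S2 : set (\bar R)) (K : \bar R) :
  S1 !=set0 -> S2 !=set0 -> (forall a, S1 a -> 0 <= a) -> (forall b, S2 b -> 0 <= b) ->
  (forall a b, S1 a -> S2 b -> a + b <= K) -> ereal_sup S1 + ereal_sup S2 <= K.
Proof.
move=> [a0 Sa0] [b0 Sb0] S10 S20 hK.
have K0 : 0 <= K by apply: (le_trans _ (hK _ _ Sa0 Sb0)); apply: adde_ge0; [exact: S10|exact: S20].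
have [->|Kfin] := eqVneq K +oo; first by rewrite leey.
have Kf : K \is a fin_num by rewrite ge0_fin_numE// ltey.
have s20 : 0 <= ereal_sup S2 by apply: le_trans (S20 _ Sb0) _; exact: ereal_sup_ubound.
have s2K : ereal_sup S2 <= K.
  apply: ge_ereal_sup => b Sb; apply: le_trans (hK _ _ Sa0 Sb).
  by rewrite leeDr// S10.
have s2f : ereal_sup S2 \is a fin_num.
  by rewrite ge0_fin_numE// (le_lt_trans s2K)// ltey.
rewrite -leeBrDr//; apply: ge_ereal_sup => a Sa; rewrite leeBrDr//.
have af : a \is a fin_num.
  rewrite ge0_fin_numE ?S10//; apply: le_lt_trans (_ : K < _); last by rewrite ltey.
  by apply: le_trans (hK _ _ Sa Sb0); rewrite leeDl// S20.
rewrite -leeBrDl//; apply: ge_ereal_sup => b Sb; rewrite leeBrDl//.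
exact: hK.
Qed.

Lemma lt_limn_einf (R : realType) (u : nat -> \bar R) (Q : \bar R) :
  Q < limn_einf u -> exists n, forall N, (n <= N)%N -> Q < u N.
Proof.
rewrite limn_einf_lim => lt; apply: contrapT => nex.
have : limn (einfs u) <= Q.
  apply: lime_le; first exact: is_cvg_einfs.
  apply: nearW => n; rewrite leNgt; apply/negP => ltn; apply: nex; exists n => N nN.
  by apply: lt_le_trans ltn _; apply: ereal_inf_lbound; exists N.
by rewrite leNgt lt.
Qed.

Lemma le_limn_einf (R : realType) (u : nat -> \bar R) (Q : \bar R) n :
  (forall N, (n <= N)%N -> Q <= u N) -> Q <= limn_einf u.
Proof.
move=> h; rewrite limn_einf_lim; apply: lime_ge; first exact: is_cvg_einfs.
near=> m; apply: le_ereal_inf_tmp => _ [N /= mN <-]; apply: h.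
by apply: leq_trans mN; near: m; exact: nbhs_infty_ge.
Unshelve. all: by end_near. Qed.

Context d (T : measurableType d) (R : realType) (mu : {measure set T -> \bar R}).
Implicit Types f g : T -> \bar R.

(* No measurability is assumed: the integral of a nonnegative function is then a
   lower integral, hence superadditive. *)
Lemma ge0_le_integral_lower f g : (forall x, 0 <= f x) -> (forall x, f x <= g x) ->
  \int[mu]_x f x <= \int[mu]_x g x.
Proof.
move=> f0 fg; rewrite !ge0_integralTE//; last by move=> x; exact: le_trans (fg x).
by apply: le_ereal_sup => _ [h hf <-]; exists h => // x; exact: le_trans (hf x) (fg x).
Qed.

Lemma integralD_lower f g : (forall x, 0 <= f x) -> (forall x, 0 <= g x) ->
  \int[mu]_x f x + \int[mu]_x g x <= \int[mu]_x (f x + g x).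
Proof.
move=> f0 g0; rewrite !ge0_integralTE//; last by move=> x; rewrite adde_ge0.
have nn0 (h : T -> \bar R) : (forall x, 0 <= h x) ->
    [set sintegral mu k | k in [set k : {nnsfun T >-> R} | forall x : T, (k x)%:E <= h x]] !=set0.
  by move=> h0; exists (sintegral mu (nnsfun0 : {nnsfun T >-> R})), nnsfun0.
apply: ereal_sup_add_le; [exact: nn0|exact: nn0| | |].
- by move=> _ [h _ <-]; exact: sintegral_ge0.
- by move=> _ [h _ <-]; exact: sintegral_ge0.
- move=> _ _ [h hf <-] [k kg <-]; rewrite -sintegralD//.
  apply: ereal_sup_ubound; exists (add_nnsfun h k) => // x.
  by rewrite /= EFinD leeD.
Qed.

Lemma integralZ_lower f (k : R) : (forall x, 0 <= f x) -> (0 <= k)%R ->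
  k%:E * \int[mu]_x f x <= \int[mu]_x (k%:E * f x).
Proof.
move=> f0 k0.
have [->|kn0] := eqVneq k 0%R.
  by rewrite mul0e; apply: integral_ge0 => x _; rewrite mule_ge0.
have kgt0 : (0 < k)%R by rewrite lt_neqAle eq_sym kn0.
rewrite muleC -lee_pdivlMr//.
rewrite !ge0_integralTE//; last by move=> x; rewrite mule_ge0.
apply: ge_ereal_sup => _ [h hf <-].
rewrite lee_pdivlMr// muleC -sintegralrM.
apply: ereal_sup_ubound; exists (scale_nnsfun h k0) => // x.
by rewrite /= EFinM lee_pmul2l.
Qed.

Lemma integral_sum_lower (I : Type) (s : seq I) (k : I -> R) (f : I -> T -> \bar R) :
  (forall i x, 0 <= f i x) -> (forall i, (0 <= k i)%R) ->
  \sum_(i <- s) (k i)%:E * \int[mu]_x f i x <= \int[mu]_x \sum_(i <- s) ((k i)%:E * f i x).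
Proof.
move=> f0 k0; elim: s => [|i s IH].
  rewrite big_nil; apply: integral_ge0 => x _; by rewrite big_nil.
rewrite big_cons [leRHS](_ : _ = \int[mu]_x ((k i)%:E * f i x +
    \sum_(j <- s) ((k j)%:E * f j x))); last first.
  by apply: eq_integral => x _; rewrite big_cons.
apply: le_trans (leeD (integralZ_lower (f0 i) (k0 i)) IH) _.
apply: integralD_lower => x; first by rewrite mule_ge0// lee_fin.
by apply: sume_ge0 => j _; rewrite mule_ge0// lee_fin.
Qed.

End LowerIntegral.

(** * Large increments along c-adic grids *)

Section Increments.
Context (R : realType) (dO : measure_display) (Omega : measurableType dO)
  (P : probability Omega R) (d : nat) (X : R -> Omega -> 'rV[R]_d).
Hypothesis hX : is_levy_process P X.
Context (c : nat) (hc : (1 < c)%N).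
Notation side := (@side R c).

Lemma levy_right om t : 0 <= t -> (X s om) @[s --> t^'+] --> X t om.
Proof. by have [_ _ [h _] _ _] := hX; exact: h. Qed.

Lemma levy_left om t : 0 < t -> cvg ((X s om) @[s --> t^'-]).
Proof. by have [_ _ [_ h] _ _] := hX; exact: h. Qed.

Lemma measurable_coord t i : 0 <= t -> measurable_fun setT (fun om => X t om ord0 i).
Proof.
move=> t0; apply: (measurability _ (RGenOInfty.measurableE R)) => _ [_ [y ->] <-].
rewrite setTI; have [hm _ _ _ _] := hX.
apply: (hm t ((fun v : 'rV[R]_d => v ord0 i) @^-1` `]y, +oo[)) => //.
apply: sub_gen_smallest; apply: open_comp => [v _|]; first exact: coord_continuous.
exact: interval_open.
Qed.

Lemma measurable_eucl_incr s t : 0 <= s -> 0 <= t ->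
  measurable_fun setT (fun om => eucl (X t om - X s om)).
Proof.
move=> s0 t0; apply: (@measurableT_comp _ _ _ _ _ _ (@Num.sqrt R)).
  by apply: continuous_measurable_fun; exact: sqrt_continuous.
apply: measurable_sum => i.
have -> : (fun om => (X t om - X s om) ord0 i ^+ 2) =
    (fun om => (X t om ord0 i - X s om ord0 i) ^+ 2) by apply/funext => om; rewrite !mxE.
by apply: measurable_funX; apply: measurable_funB; exact: measurable_coord.
Qed.

Lemma open_eucl_gt (r : R) : open [set x : 'rV[R]_d | r < eucl x].
Proof.
rewrite (_ : [set x | _] = (fun x : 'rV[R]_d => eucl (x - 0)) @^-1` `]r, +oo[); last first.
  by apply/seteqP; split => x /=; rewrite in_itv/= andbT subr0.
apply: open_comp => [v _|]; last exact: interval_open.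
apply: (@cvg_eucl_coord R d _ (nbhs v) id (fun=> 0) v 0 (nbhs_filter v)) => i.
  exact: coord_continuous.
exact: cvg_cst.
Qed.

Lemma borel_eucl_gt r : borelRd [set x : 'rV[R]_d | r < eucl x].
Proof. apply: sub_gen_smallest; exact: open_eucl_gt. Qed.

Lemma borel_eucl_le r : borelRd [set x : 'rV[R]_d | eucl x <= r].
Proof.
rewrite (_ : [set x | _] = [set: 'rV[R]_d] `\` [set x | r < eucl x]); last first.
  apply/seteqP; split => x /=; first by rewrite leNgt => /negP h; split.
  by move=> [_ /negP]; rewrite -leNgt.
have [_ h _] := smallest_sigma_algebra [set: 'rV[R]_d] (@open 'rV[R]_d).
by apply: h; exact: borel_eucl_gt.
Qed.

Definition big_incr (r : R) (N i : nat) : set Omega :=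
  [set om | r < eucl (X (i.+1%:R * side N) om - X (i%:R * side N) om)].

(** By stationarity this is the probability of [big_incr r N i] for every [i]. *)
Definition tail (r : R) (N : nat) : R := fine (P [set om | r < eucl (X (side N) om)]).

Lemma time_ge0 i N : 0 <= i%:R * side N :> R.
Proof. by rewrite mulr_ge0// side_ge0. Qed.

Lemma measurable_big_incr r N i : measurable (big_incr r N i).
Proof.
have := measurable_eucl_incr (time_ge0 i N) (time_ge0 i.+1 N).
move=> /(_ measurableT `]r, +oo[%classic (measurable_itv _)).
rewrite setTI; congr (measurable _); apply/seteqP; split => om /=;
  by rewrite in_itv/= andbT.
Qed.

Lemma prob_big_incr r N i : P (big_incr r N i) = (tail r N)%:E.
Proof.
have [_ _ _ st _] := hX.
have := st (i%:R * side N) (i.+1%:R * side N) _ _ (borel_eucl_gt r).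
rewrite time_ge0/= ler_wpM2r ?side_ge0 ?ler_nat// => /(_ isT).
rewrite -mulrBl -natr1 addrAC subrr add0r mul1r => h.
rewrite /tail fineK ?fin_num_measure//; last first.
  have := measurable_big_incr r N 0; have [_ X0 _ _ _] := hX.
  rewrite /big_incr mul0r mul1r; congr (measurable _).
  by apply/seteqP; split => om /=; rewrite X0 subr0.
transitivity (P [set w | X ((i%:R + 1) * side N) w - X (i%:R * side N) w \in
   [set x : 'rV[R]_d | r < eucl x]]).
  by congr (P _); apply/funext => om; rewrite /big_incr/= in_setE -natr1.
by rewrite h; congr (P _); apply/funext => om; rewrite /= in_setE.
Qed.

Lemma tail_itv r N : 0 <= tail r N <= 1.
Proof.
rewrite -!lee_fin -(prob_big_incr r N 0) measure_ge0/=.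
by apply: probability_le1; exact: measurable_big_incr.
Qed.

Definition incr_count (r : R) (N : nat) (om : Omega) : R :=
  \sum_(0 <= i < c ^ N) \1_(big_incr r N i) om.

(** Once the grid is finer than the gaps between the times of [T] and than the scale at which each
    large jump is visible, these jumps lie in distinct grid steps, each with a large increment. *)
Lemma jumps_le_count r om (T : seq R) : uniq T ->
  (forall s, s \in T -> 0 < s <= 1) ->
  \forall N \near \oo, \sum_(s <- T) ((r < eucl (jump X om s))%R : nat)%:R <= incr_count r N om.
Proof.
move=> uT T01.
have /choice[e he] : forall s, exists e, 0 < e /\ (s \in T -> r < eucl (jump X om s) ->
    forall p q, p < s -> s <= q -> q - p < e -> r < eucl (X q om - X p om)).
  move=> s; have [sT|] := boolP (s \in T); last by exists 1.
  have [rs|] := ltP r (eucl (jump X om s)); last by exists 1.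
  have s0 : 0 < s by have /andP[] := T01 _ sT.
  have [e e0 he] := jump_persists (@levy_right om) (@levy_left om) s0 rs.
  by exists e.
have [dl dl0 hdl] : exists2 dl : R, 0 < dl & forall s, s \in T ->
    dl <= e s /\ forall s', s' \in T -> s' != s -> dl <= `|s - s'|.
  pose A := [seq e s | s <- T] ++ [seq `|p.1 - p.2| | p <- [seq (a, b) | a <- T, b <- T] & p.1 != p.2].
  have Apos x : x \in A -> 0 < x.
    rewrite mem_cat => /orP[/mapP[s _ ->]|]; first by have [] := he s.
    move=> /mapP[p]; rewrite mem_filter => /andP[h _] ->.
    by rewrite normr_gt0 subr_eq0.
  have [dl dl0 hA] : exists2 dl : R, 0 < dl & forall x, x \in A -> dl <= x.
    elim: (A) Apos => [|x A' IH] hpos; first by exists 1.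
    have [|dl dl0 h] := IH; first by move=> y yA; apply: hpos; rewrite inE yA orbT.
    exists (Num.min x dl); first by rewrite lt_min dl0 hpos// mem_head.
    move=> y; rewrite inE => /predU1P[->|yA]; first by rewrite ge_min lexx.
    by rewrite ge_min h// orbT.
  exists dl => // s sT; split; first by apply: hA; rewrite mem_cat map_f.
  move=> s' s'T ss'; apply: hA; rewrite mem_cat; apply/orP; right.
  apply/mapP; exists (s, s') => //; rewrite mem_filter/= eq_sym ss'/=.
  by apply/allpairsP; exists (s, s').
have [N0 hN0] := side_cvg0 hc dl0.
exists N0 => // N /= /hN0 sN.
pose T' := [seq s <- T | r < eucl (jump X om s)].
have /choice[idx hidx] : forall s, exists i : nat, 0 < s -> i%:R * side N < s <= i.+1%:R * side N.
  move=> s; have [s0|] := ltP 0 s; last by exists 0%N.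
  by have [i hi] := exists_lcell hc N s0; exists i.
have inj : {in T' &, injective idx}.
  move=> s s'; rewrite !mem_filter => /andP[_ sT] /andP[_ s'T] ss'.
  apply: contrapT => /eqP ne.
  have [_ /(_ _ s'T)] := hdl s sT; rewrite eq_sym => /(_ ne); rewrite leNgt => /negP; apply.
  apply: lt_trans sN.
  have /andP[s0 _] := T01 _ sT; have /andP[s'0 _] := T01 _ s'T.
  have := hidx _ s0; have := hidx _ s'0; rewrite ss' -natr1 mulrDl mul1r.
  move=> /andP[h1 h2] /andP[h3 h4]; rewrite ltr_norml; apply/andP; split; lra.
have -> : \sum_(s <- T) ((r < eucl (jump X om s))%R : nat)%:R = (size T')%:R :> R.
  rewrite size_filter -sum1_count natr_sum [RHS]big_mkcond/=; apply: eq_bigr => s _.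
  by case: ifP.
rewrite -(size_map idx).
pose D := [seq i <- index_iota 0 (c ^ N) | `[< big_incr r N i om >]].
have -> : incr_count r N om = (size D)%:R :> R.
  rewrite size_filter -sum1_count natr_sum [RHS]big_mkcond/=; apply: eq_bigr => i _.
  rewrite indicE; case: asboolP => h; first by rewrite mem_set.
  by rewrite memNset.
rewrite ler_nat; apply: uniq_leq_size; first by rewrite map_inj_in_uniq ?filter_uniq.
move=> _ /mapP[s sT' ->]; move: sT'; rewrite !mem_filter => /andP[rs sT].
have /andP[s0 s1] := T01 _ sT; have /andP[h1 h2] := hidx _ s0.
have [_ hes] := he s; have [dle _] := hdl _ sT.
apply/andP; split.
  apply/asboolP; apply: hes => //; rewrite -mulrBl -natr1 addrAC subrr add0r mul1r.
  exact: lt_le_trans sN dle.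
rewrite mem_index_iota/= -(@ltr_nat R) natrX.
have := lt_le_trans h1 s1; rewrite /side ltr_pdivrMr ?mul1r//.
by rewrite exprn_gt0// ltr0n base_gt0.
Qed.

Lemma integral_incr_count r N :
  (\int[P]_om (incr_count r N om)%:E = (c%:R ^+ N * tail r N)%:E)%E.
Proof.
rewrite /incr_count; under eq_integral do rewrite -sumEFin.
rewrite ge0_integral_sum//=; last first.
  by move=> i; apply/measurable_EFinP; apply: measurable_indic; exact: measurable_big_incr.
rewrite (eq_bigr (fun=> (tail r N)%:E)); last first.
  move=> i _; rewrite integral_indic ?setIT//; last exact: measurable_big_incr.
  exact: prob_big_incr.
by rewrite sumEFin sumr_const_nat subn0 -natrX mulr_natl.
Qed.

End Increments.

Lemma esum_scale_le (R : realType) (T : choiceType) (A : set T) (y : R) :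
  0 <= y -> (y%:E * (\esum_(t in A) (1%E : \bar R)) <=
     \esum_(t in [set: T]) (if `[< A t >] then y%:E else 0))%E.
Proof.
move=> y0.
have -> : (\esum_(t in [set: T]) (if `[< A t >] then y%:E else 0) = \esum_(t in A) y%:E)%E.
  rewrite [RHS]esum_mkcond; apply: eq_esum => t _.
  by case: asboolP => h; [rewrite mem_set|rewrite memNset].
have [->|yn0] := eqVneq y 0.
  by rewrite mul0e; apply: esum_ge0.
have ygt0 : 0 < y by rewrite lt_neqAle eq_sym yn0.
rewrite muleC -lee_pdivlMr//; apply: ge_ereal_sup => _ [F [finF FA] <-].
rewrite lee_pdivlMr//; apply: le_trans (ereal_sup_ubound _).
  2: by exists F; [split|reflexivity].
rewrite !fsbig_finite//= muleC ge0_sume_distrr//.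
by apply: lee_sum => t _; rewrite mule1.
Qed.

(** * From the integral condition to divergent sums of tail probabilities *)

Section Divergence.
Import HBNNSimple.
Context (R : realType) (dO : measure_display) (Omega : measurableType dO)
  (P : probability Omega R) (d : nat) (X : R -> Omega -> 'rV[R]_d).
Hypothesis hX : is_levy_process P X.
Context (c : nat) (hc : (1 < c)%N).
Notation side := (@side R c).
Variables (phi : R -> R) (r : nat -> R) (e0 : R).
Hypothesis e00 : 0 < e0.
Hypothesis phi_inf : \forall e \near 0^'+,
  (\int[norm_image (levy_measure P X)]_(x in `]0%R, e]) (phi x)%:E)%E = +oo%E.
Hypothesis phi_ge0 : forall x, 0 < x -> x <= e0 -> 0 <= phi x.
Hypothesis phi_small : forall eta, 0 < eta ->
  exists2 e, 0 < e & forall x, 0 < x -> x <= e -> phi x <= eta.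
Hypothesis phi_level : forall j x, 0 < x -> x <= e0 -> side j < phi x -> r j < x.

Notation sigma := (norm_image (levy_measure P X)).
Notation jcount B om := (\esum_(t in jumps_in X (eucl @^-1` B) om) (1%E : \bar R))%E.

(** A layer-cake bound: for the first level [j] with [side j < h], one has [h <= c * side j], and
    [phi_level] gives [r j < x], so a single term of the sum suffices. *)
Lemma level_bound n e (h : R) x : (forall x, 0 < x -> x <= e -> phi x <= side n) ->
  e <= e0 -> 0 < x -> x <= e -> 0 < h -> h <= phi x ->
  forall m, side m < h ->
  h <= c%:R * \sum_(n <= j < m.+1) side j * ((r j < x)%R : nat)%:R.
Proof.
move=> hphi ee x0 xe h0 hx m sm.
have ex : exists j, side j < h by exists m.
case: (ex_minnP ex) => j sj jmin.
have nj : (n < j)%N.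
  rewrite ltnNge; apply/negP => jn.
  have : side n <= side j.
    by rewrite -(mul_side hc jn) ler_peMl ?side_ge0// exprn_ege1// ler1n base_gt0.
  by rewrite leNgt (lt_le_trans sj)// (le_trans hx)// hphi.
have jm : (j <= m)%N by exact: jmin.
have rj : r j < x by apply: (phi_level x0 (le_trans xe ee)); exact: lt_le_trans hx.
have c0 : 0 < c%:R :> R by rewrite ltr0n base_gt0.
apply: (@le_trans _ _ (c%:R * side j)).
  case: j nj jmin {sj jm rj} => // j _ jmin; rewrite -sideS// leNgt.
  by apply/negP => /jmin; rewrite ltnn.
rewrite ler_pM2l// (bigD1_seq j) ?iota_uniq ?mem_index_iota ?(ltnW nj) ?ltnS//=.
rewrite rj mulr1 lerDl; apply: sumr_ge0 => i _.
by rewrite mulr_ge0 ?side_ge0.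
Qed.

(** Path by path: a jump lies in one level set of [h] only and is weighted by the value there. That
    value is bounded by the sum over thresholds, and the jumps above each threshold are counted by
    the increments of fine grids. *)
Lemma weighted_jumps_le (s : seq R) (h : R -> R) n m om :
  uniq s -> (forall y, y \in s -> 0 <= y) ->
  (forall x, 0 < h x -> h x <= c%:R * \sum_(n <= j < m) side j * ((r j < x)%R : nat)%:R) ->
  (\sum_(y <- s) `|y|%:E * jcount (h @^-1` [set y]) om <=
    limn_einf (fun N => (c%:R * \sum_(n <= j < m) side j * incr_count X c (r j) N om)%:E))%E.
Proof.
move=> us s0 hh.
have c0 : 0 < c%:R :> R by rewrite ltr0n base_gt0.
pose A y := jumps_in X (eucl @^-1` (h @^-1` [set y])) om.
apply: (@le_trans _ _ (\sum_(y <- s) \esum_(t in [set: R])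
    (if `[< A y t >] then `|y|%:E else 0))%E).
  by apply: lee_sum => y _; apply: esum_scale_le.
rewrite -esum_sum; last by move=> y t _ _; case: ifP.
apply: ge_ereal_sup => _ [F [finF _] <-].
rewrite fsbig_finite//=.
pose T : seq R := [seq t <- (fset_set F : seq R) | 0 < t <= 1].
have uT : uniq T by rewrite filter_uniq// fset_uniq.
have T01 t : t \in T -> 0 < t <= 1 by rewrite mem_filter => /andP[].
have key t : (\sum_(y <- s) (if `[< A y t >] then `|y|%:E else 0) <=
    (if 0 < t <= 1 then c%:R * \sum_(n <= j < m) side j *
      ((r j < eucl (jump X om t))%R : nat)%:R else 0)%:E)%E.
  have rhs0 (x : R) : 0 <= c%:R * \sum_(n <= j < m) side j * ((r j < x)%R : nat)%:R.
    by apply: mulr_ge0; [exact: ltW|apply: sumr_ge0 => i _; rewrite mulr_ge0 ?side_ge0].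
  have [[y [ys At]]|nex] := pselect (exists y, y \in s /\ A y t); last first.
    rewrite big1_seq; first by case: ifP => _; rewrite lee_fin// rhs0.
    move=> y /andP[_ ys]; case: asboolP => // At; exfalso; apply: nex; by exists y.
  have [t01 [jn hy]] := At; rewrite t01.
  rewrite (bigD1_seq y)//= big1_seq; last first.
    move=> y' /andP[y'y _]; case: asboolP => // -[_ [_ hy']].
    by move: y'y; rewrite -hy' -hy eqxx.
  rewrite adde0; case: asboolP => // _; rewrite lee_fin ger0_norm ?s0//.
  have := s0 _ ys; rewrite le_eqVlt => /predU1P[<-|y0]; first exact: rhs0.
  by rewrite -hy; apply: hh; rewrite hy.
apply: (@le_trans _ _ (\sum_(t <- T) c%:R * \sum_(n <= j < m) side j *
      ((r j < eucl (jump X om t))%R : nat)%:R)%:E).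
  rewrite -sumEFin /T big_filter [leRHS]big_mkcond/=; apply: lee_sum => t _.
  by apply: le_trans (key t) _; case: ifP.
have cnt : \forall N \near \oo, forall j, (n <= j < m)%N ->
    \sum_(t <- T) ((r j < eucl (jump X om t))%R : nat)%:R <= incr_count X c (r j) N om.
  have h1 j : exists N0, forall N, (N0 <= N)%N ->
      \sum_(t <- T) ((r j < eucl (jump X om t))%R : nat)%:R <= incr_count X c (r j) N om.
    have [N0 _ hN0] := jumps_le_count hX hc (r j) om uT T01.
    by exists N0 => N; exact: hN0.
  have /choice[N0 hN0] := h1.
  exists (\max_(i < m) N0 i) => // N /= hN j /andP[_ jm]; apply: hN0.
  by apply: leq_trans hN; apply: (@leq_bigmax _ (fun i : 'I_m => N0 i) (Ordinal jm)).
have [N0 _ hN0] := cnt.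
apply: (@le_limn_einf _ _ _ N0) => N /hN0 hN.
rewrite lee_fin -mulr_sumr ler_pM2l// exchange_big/= big_nat [leRHS]big_nat.
apply: ler_sum => j jnm; rewrite -mulr_sumr ler_wpM2l ?side_ge0//.
exact: hN.
Qed.

Lemma levy_measure0 : levy_measure P X set0 = 0%E.
Proof.
rewrite /levy_measure; apply: integral0_eq => om _.
rewrite (_ : jumps_in X set0 om = set0) ?esum_set0//.
by apply/seteqP; split => // t [_ []].
Qed.

(** A simple function [h] below [phi] has integral above [c * Q]. Bounding [h] by thresholds and
    jump counts by grid counts, Fatou's lemma carries this to the expected grid counts. [norm_image]
    is handled as a set function only, so its integral is unfolded. *)
Lemma tail_sum_diverges n (Q : R) : exists m N0, forall N, (N0 <= N)%N ->
  Q < \sum_(n <= j < m) side j * (c%:R ^+ N * tail P X c (r j) N).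
Proof.
have c0 : 0 < c%:R :> R by rewrite ltr0n base_gt0.
have [e1 e10 he1] := phi_small (side_gt0 hc n).
have [e2 e20 he2] := (near0rP _).1 phi_inf.
pose e := Num.min (Num.min e0 e1) (e2 / 2).
have e_gt0 : 0 < e by rewrite !lt_min e00 e10 divr_gt0.
have ee0 : e <= e0 by rewrite !ge_min lexx.
have ee1 : e <= e1 by rewrite !ge_min lexx orbT.
have ee2 : e < e2.
  by rewrite gt_min; apply/orP; right; rewrite ltr_pdivrMr// ltr_pMr// ltr1n.
have hphi x : 0 < x -> x <= e -> phi x <= side n.
  by move=> x0 xe; apply: he1 => //; exact: le_trans ee1.
have := he2 e; rewrite e_gt0 ee2 => /(_ isT) inte.
pose g : R -> \bar R := ((fun x => (phi x)%:E) \_ `]0%R, e])%E.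
have gE x : g x = if 0 < x <= e then (phi x)%:E else 0%E.
  rewrite /g patchE; have [h|h] := boolP (0 < x <= e).
    by rewrite mem_set//= in_itv/=.
  by rewrite memNset//= in_itv/=; exact/negP.
have g0 x : (0 <= g x)%E.
  rewrite gE; case: ifP => // /andP[x0 xe]; rewrite lee_fin phi_ge0//.
  exact: le_trans ee0.
have sig0 : sigma set0 = 0%E by rewrite /norm_image preimage_set0 levy_measure0.
have sig_ge0 B : (0 <= sigma B)%E.
  by apply: integral_ge0 => om _; apply: esum_ge0.
have sintE (h : {nnsfun R >-> R}) : sintegral sigma h =
    (\sum_(y <- fset_set (range h)) y%:E * sigma (h @^-1` [set y]))%E.
  have fr : finite_set (range h) by exact: fimfunP.
  rewrite /sintegral -(fsbig_finite _ _ fr); symmetry; apply: fsbig_widen => //.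
  by move=> y [_ ny] /=; rewrite preimage10// sig0 mule0.
have hs0 (h : {nnsfun R >-> R}) y : y \in fset_set (range h) -> 0 <= y.
  rewrite in_fset_set; last exact: fimfunP.
  by move=> /set_mem[x _ <-].
have [h [hg hQ]] : exists h : {nnsfun R >-> R}, (forall x, (h x)%:E <= g x)%E /\
    ((c%:R * Q)%:E < sintegral sigma h)%E.
  have sint0 (h : {nnsfun R >-> R}) : (0 <= sintegral sigma h)%E.
    rewrite sintE big_seq; apply: sume_ge0 => y ys.
    by rewrite mule_ge0// lee_fin (hs0 _ _ ys).
  (* This excludes that the integral is infinite merely because the supremum for the negative part
     is [-oo]. *)
  have supE f : (0 <= ereal_sup [set sintegral sigma h | h in
      [set h : {nnsfun R >-> R} | forall x, ((h x)%:E <= f x)%E]])%E \/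
      forall h : {nnsfun R >-> R}, ~ forall x, ((h x)%:E <= f x)%E.
    have [[h hf]|nex] := pselect (exists h : {nnsfun R >-> R}, forall x, ((h x)%:E <= f x)%E).
      by left; apply: le_trans (sint0 h) _; apply: ereal_sup_ubound; exists h.
    by right => h hf; apply: nex; exists h.
  have gpos x : (g^\+)%E x = g x by rewrite funeposE; apply/max_idPl.
  have gneg x : (g^\-)%E x = 0%E 
    by rewrite funenegE; apply/max_idPr; rewrite leeNl oppe0.
  have : ereal_sup [set sintegral sigma h | h in
      [set h : {nnsfun R >-> R} | forall x, ((h x)%:E <= (g^\+)%E x)%E]] = +oo%E.
    move: inte; rewrite /integral -/g.
    have [] := supE (g^\-)%E; last first.
      move=> /(_ nnsfun0) [] x; rewrite gneg lee_fin; exact: lexx.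
    rewrite /=; case: (ereal_sup _) => [b| |]; case: (ereal_sup _) => [a| |] //=.
  move=> sup_oo; have : ((c%:R * Q)%:E < ereal_sup [set sintegral sigma h | h in
      [set h : {nnsfun R >-> R} | forall x, ((h x)%:E <= (g^\+)%E x)%E]])%E.
    by rewrite sup_oo ltry.
  move=> /ereal_sup_gt[_ [h hg <-] lt]; exists h; split => // x.
  by rewrite -gpos; exact: hg.
have hpos x : 0 < h x -> 0 < x /\ x <= e /\ h x <= phi x.
  move=> hx; have := hg x; rewrite gE; case: ifP => [/andP[x0 xe]|_].
    by rewrite lee_fin.
  by rewrite lee_fin leNgt hx.
(* The positive values of [h] are finitely many, so finitely many thresholds suffice. *)
have [m hm] : exists m, forall x, 0 < h x -> side m < h x.
  have [dl dl0 hdl] : exists2 dl : R, 0 < dl & forall x, 0 < h x -> dl <= h x.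
    have : forall s : seq R, exists2 dl : R, 0 < dl & forall y, y \in s -> 0 < y -> dl <= y.
      elim=> [|y s [dl dl0 hdl]]; first by exists 1.
      exists (if 0 < y then Num.min y dl else dl).
        by case: ifP => // y0; rewrite lt_min y0.
      move=> y'; rewrite inE => /predU1P[->|y's] y'0.
        by rewrite y'0 ge_min lexx.
      by case: ifP => _; rewrite ?ge_min hdl// orbT.
    move=> /(_ (fset_set (range h)))[dl dl0 hdl]; exists dl => // x hx.
    apply: hdl => //; rewrite in_fset_set; last exact: fimfunP.
    by apply: mem_set; exists x.
  have [N hN] := side_cvg0 hc dl0; exists N => x hx.
  exact: lt_le_trans (hN _ (leqnn _)) (hdl _ hx).
exists m.+1.
have hh x : 0 < h x -> h x <= c%:R * \sum_(n <= j < m.+1) side j * ((r j < x)%R : nat)%:R.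
  move=> hx; have [x0 [xe hphix]] := hpos _ hx.
  exact: (level_bound hphi ee0 x0 xe hx hphix (hm _ hx)).
have S0 N om : 0 <= c%:R * \sum_(n <= j < m.+1) side j * incr_count X c (r j) N om.
  apply: mulr_ge0; first exact: ltW.
  by apply: sumr_ge0 => j _; rewrite mulr_ge0 ?side_ge0//; apply: sumr_ge0.
have mS N : measurable_fun setT
    (fun om => (c%:R * \sum_(n <= j < m.+1) side j * incr_count X c (r j) N om)%:E).
  apply/measurable_EFinP; apply: measurable_funM; first exact: measurable_cst.
  apply: measurable_sum => j; apply: measurable_funM; first exact: measurable_cst.
  by apply: measurable_sum => i; apply: measurable_indic; exact: (measurable_big_incr hX hc).
have intS N : (\int[P]_om (c%:R * \sum_(n <= j < m.+1) side j * incr_count X c (r j) N om)%:E =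
    (c%:R * \sum_(n <= j < m.+1) side j * (c%:R ^+ N * tail P X c (r j) N))%:E)%E.
  transitivity (\int[P]_om (\sum_(n <= j < m.+1)
      ((c%:R * side j)%:E * (incr_count X c (r j) N om)%:E)))%E.
    apply: eq_integral => om _; rewrite mulr_sumr -sumEFin.
    by apply: eq_bigr => j _; rewrite mulrA EFinM.
  have cnt0 j om : 0 <= incr_count X c (r j) N om by apply: sumr_ge0.
  have mcnt j : measurable_fun setT (fun om => (incr_count X c (r j) N om)%:E).
    apply/measurable_EFinP.
    by apply: measurable_sum => i; apply: measurable_indic; exact: (measurable_big_incr hX hc).
  have cs0 j : 0 <= c%:R * side j by rewrite mulr_ge0 ?side_ge0// ltW.
  rewrite ge0_integral_sum//=; last 2 first.
  - by move=> j; apply: emeasurable_funM.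
  - by move=> j om _; rewrite mule_ge0// lee_fin ?cs0 ?cnt0.
  rewrite mulr_sumr -sumEFin; apply: eq_bigr => j _.
  rewrite ge0_integralZl_EFin//; last by move=> om _; rewrite lee_fin cnt0.
  by rewrite integral_incr_count// -EFinM mulrA.
have : ((c%:R * Q)%:E < limn_einf (fun N => (c%:R * \sum_(n <= j < m.+1) side j *
    (c%:R ^+ N * tail P X c (r j) N))%:E))%E.
  apply: lt_le_trans hQ _; rewrite sintE.
  have -> : (\sum_(y <- fset_set (range h)) y%:E * sigma (h @^-1` [set y]) =
     \sum_(y <- fset_set (range h)) `|y|%:E * sigma (h @^-1` [set y]))%E.
    by apply: eq_big_seq => y ys; rewrite ger0_norm// (hs0 _ _ ys).
  (* The Lévy measure is an expected jump count, so the finite sum moves inside the expectation by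
     superadditivity of lower integrals. *)
  apply: le_trans (integral_sum_lower P _ _ _) _ => //=.
  - by move=> y om; apply: esum_ge0.
  have := fatou P measurableT mS (fun N om _ => S0 N om).
  under [X in (_ <= limn_einf X)%E]eq_fun do rewrite intS.
  apply: le_trans; apply: ge0_le_integral_lower => om.
    by apply: sume_ge0 => y _; rewrite mule_ge0// esum_ge0.
  by apply: weighted_jumps_le => //; [exact: fset_uniq|exact: hs0].
move=> /lt_limn_einf[N0 hN0]; exists N0 => N /hN0.
by rewrite lte_fin ltr_pM2l.
Qed.

End Divergence.

Lemma sum_divn_eq (a D M : nat) : (0 < D)%N -> (a.+1 * D <= M)%N ->
  (\sum_(0 <= i < M) (i %/ D == a) = D)%N.
Proof.
move=> D0 aM.
have aD : (a * D <= a.+1 * D)%N by rewrite leq_mul2r leqnSn orbT.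
rewrite (big_cat_nat (leq0n _) aM)/= (big_cat_nat (leq0n _) aD)/=.
rewrite big_nat big1 => [|i /andP[_ ia]]; last first.
  by apply/eqP; rewrite eqb0 neq_ltn ltn_divLR// ia.
rewrite add0n [X in (_ + X)%N]big_nat [X in (_ + X)%N]big1 => [|i /andP[ia _]]; last first.
  by apply/eqP; rewrite eqb0 neq_ltn leq_divRL// ia orbT.
rewrite addn0; transitivity (\sum_(a * D <= i < a.+1 * D) 1)%N; last first.
  by rewrite sum_nat_const_nat muln1 mulSn addnK.
apply: eq_big_nat => i /andP[h1 h2]; have -> // : (i %/ D = a)%N.
  by apply/eqP; rewrite eqn_leq -ltnS ltn_divLR// h2 leq_divRL.
by rewrite eqxx.
Qed.

(** * Independence of the windows and the probability of a miss *)

Section Miss.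
Context (R : realType) (dO : measure_display) (Omega : measurableType dO)
  (P : probability Omega R) (d : nat) (X : R -> Omega -> 'rV[R]_d).
Hypothesis hX : is_levy_process P X.
Context (c : nat) (hc : (1 < c)%N).
Notation side := (@side R c).
Variables (thr : nat -> R).

(* Grid step i of level N lies in the level-j ancestor of the level-m cell y, but
   not in the level-(j+1) one: for fixed y these windows are pairwise disjoint. *)
Definition window (m y N j i : nat) : bool :=
  (i %/ c ^ (N - j) == y %/ c ^ (m - j))%N && (i %/ c ^ (N - j.+1) != y %/ c ^ (m - j.+1))%N.

(** If [i] and [y] share their ancestor of some level, they share those of all coarser levels. *)
Lemma window_uniq m y N j j' i : (m <= N)%N -> (j < m)%N -> (j' < m)%N ->
  window m y N j i -> window m y N j' i -> j = j'.
Proof.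
move=> mN.
have key a b : (a < b)%N -> (b < m)%N -> window m y N a i -> window m y N b i -> False.
  move=> ab bm /andP[_ h1] /andP[/eqP h2 _]; move/negP: h1; apply.
  have -> : (N - a.+1 = (N - b) + (b - a.+1))%N by lia.
  have -> : (m - a.+1 = (m - b) + (b - a.+1))%N by lia.
  by rewrite !expnD !divnMA h2.
move=> jm j'm wj wj'.
by have [lt|lt|//] := ltngtP j j'; [have := key _ _ lt j'm wj wj'|have := key _ _ lt jm wj' wj].
Qed.

(** A window consists of [D * c] steps less [D] of them, where [D] steps fill a cell of level
    [j.+1]; since [c >= 2] at least half remain. *)
Lemma window_count m y N j : (m <= N)%N -> (j < m)%N ->
  side j * c%:R ^+ N / 2 <= \sum_(0 <= i < y.+1 * c ^ N) ((window m y N j i : nat)%:R : R).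
Proof.
move=> mN jm; rewrite -natr_sum.
pose D := (c ^ (N - j.+1))%N; pose b := (y %/ c ^ (m - j.+1))%N.
have D0 : (0 < D)%N by rewrite expn_gt0 base_gt0.
have ND : (c ^ (N - j) = D * c)%N by rewrite -expnSr; congr (_ ^ _)%N; lia.
have mD : (c ^ (m - j) = c ^ (m - j.+1) * c)%N by rewrite -expnSr; congr (_ ^ _)%N; lia.
have E i : ((window m y N j i : nat) + (i %/ D == b) = (i %/ (D * c) == b %/ c))%N.
  rewrite /window ND mD -/D !divnMA -/b.
  case: (i %/ D =P b)%N => [->|_]; first by rewrite eqxx andbF.
  by rewrite andbT addn0.
have bM : (b.+1 * D <= y.+1 * c ^ N)%N.
  apply: leq_mul; first by rewrite ltnS leq_div.
  by rewrite leq_pexp2l ?base_gt0// leq_subr.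
have bM' : ((b %/ c).+1 * (D * c) <= y.+1 * c ^ N)%N.
  apply: leq_mul; first by rewrite ltnS (leq_trans (leq_div _ _))// leq_div.
  by rewrite -ND leq_pexp2l ?base_gt0// leq_subr.
have Dc0 : (0 < D * c)%N by rewrite muln_gt0 D0 base_gt0.
have : (\sum_(0 <= i < y.+1 * c ^ N) window m y N j i + D = D * c)%N.
  have h1 := sum_divn_eq D0 bM; have h2 := sum_divn_eq Dc0 bM'.
  transitivity (\sum_(0 <= i < y.+1 * c ^ N) (window m y N j i + (i %/ D == b)))%N.
    by rewrite big_split/= h1.
  by rewrite -[RHS]h2; apply: eq_bigr => i _; exact: E.
move=> h; have -> : side j * c%:R ^+ N = (D * c)%:R :> R.
  rewrite -ND natrX; have jN : (j <= N)%N by lia.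
  rewrite -{1}(subnK jN) exprD mulrCA mulrA mulfVK//.
  by rewrite expf_neq0// pnatr_eq0 -lt0n base_gt0.
rewrite ler_pdivrMr// -natrM ler_nat.
have : (D * 2 <= D * c)%N by rewrite leq_mul2l hc orbT.
lia.
Qed.

Definition no_big_incr (k n m y N : nat) : set Omega :=
  [set om | forall i j, (n <= j < m)%N -> window m y N j i ->
     ~ big_incr X c (thr (j - k)) N i om].

Lemma no_big_incr_setI k n m y N : (m <= N)%N ->
  no_big_incr k n m y N = \bigcap_(i < (y.+1 * c ^ N)%N)
    [set om | X (i.+1%:R * side N) om - X (i%:R * side N) om \in
      [set x : 'rV[R]_d | forall j, (n <= j < m)%N -> window m y N j i ->
        eucl x <= thr (j - k)]].
Proof.
move=> mN; apply/seteqP; split => om /=.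
  move=> h i _; apply/mem_set => j nj wj; rewrite leNgt; apply/negP.
  exact: h nj wj.
move=> h i j nj wj.
have iM : (i < y.+1 * c ^ N)%N.
  have cN : (0 < c ^ (N - j))%N by rewrite expn_gt0 base_gt0.
  move: wj => /andP[/eqP hi _].
  have : (i < (y %/ c ^ (m - j)).+1 * c ^ (N - j))%N by rewrite -hi -ltn_divLR.
  move=> /leq_trans; apply; apply: leq_mul; first by rewrite ltnS leq_div.
  by rewrite leq_pexp2l ?base_gt0// leq_subr.
have /set_mem/(_ _ nj wj) := h i iM.
by rewrite leNgt => /negP.
Qed.

Lemma measurable_no_big_incr k n m y N : measurable (no_big_incr k n m y N).
Proof.
rewrite (_ : no_big_incr _ _ _ _ _ = \bigcap_i \bigcap_j
   (if (n <= j < m)%N && window m y N j i then ~` big_incr X c (thr (j - k)) N i else setT)).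
  apply: bigcapT_measurable => i; apply: bigcapT_measurable => j.
  case: ifP => _; last exact: measurableT.
  by apply: measurableC; exact: (measurable_big_incr hX hc).
apply/seteqP; split => om h.
  by move=> i _ j _; case: ifP => // /andP[nj wj]; exact: h nj wj.
by move=> i j nj wj; have := h i I j I; rewrite nj wj.
Qed.

(** The event is a product of conditions on independent increments. A step in a window has factor
    [1 - p <= expR (- p)], and [window_count] bounds the number of steps, whence the division by
    2. *)
Lemma prob_no_big_incr k n m y N : (m <= N)%N ->
  (P (no_big_incr k n m y N) <= (expR (- (\sum_(n <= j < m)
     side j * (c%:R ^+ N * tail P X c (thr (j - k)) N)) / 2))%:E)%E.
Proof.
move=> mN; rewrite no_big_incr_setI//.
set M := (y.+1 * c ^ N)%N.
have [_ _ _ _ indep] := hX.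
pose B i := [set x : 'rV[R]_d | forall j, (n <= j < m)%N -> window m y N j i ->
        eucl x <= thr (j - k)].
(* As a step lies in at most one window, its condition is void or a single threshold. *)
have BE i : ((forall j, (n <= j < m)%N -> window m y N j i = false) /\ B i = setT) \/
    exists j, [/\ (n <= j < m)%N, window m y N j i &
     B i = [set x | eucl x <= thr (j - k)]].
  have [[j [nj wj]]|nex] := pselect (exists j, (n <= j < m)%N /\ window m y N j i).
    right; exists j; split => //; apply/seteqP; split => x /=.
      by move=> h; exact: h.
    move=> h j' nj' wj'; rewrite -(window_uniq mN _ _ wj wj')//.
      by case/andP: nj.
    by case/andP: nj'.
  have nw j : (n <= j < m)%N -> window m y N j i = false.
    by move=> nj; apply/negP => wj; apply: nex; exists j.
  by left; split => //; apply/seteqP; split => // x _ j nj; rewrite nw.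
have Bb i : borelRd (B i).
  have [[_ ->]|[j [_ _ ->]]] := BE i; last exact: borel_eucl_le.
  by apply: sub_gen_smallest; exact: openT.
have := indep M (fun i => i%:R * side N) B _ _ Bb.
rewrite mul0r lexx => /(_ isT) ->; last first.
  by move=> i _; rewrite ltr_pM2r ?side_gt0// ltr_nat.
pose p j := tail P X c (thr (j - k)) N.
have p01 j : 0 <= p j <= 1 by exact: tail_itv.
pose f i := fine (P [set w | (X (i.+1%:R * side N) w - X (i%:R * side N) w)%R \in B i]).
have factor i : P [set w | (X (i.+1%:R * side N) w - X (i%:R * side N) w)%R \in B i] = (f i)%:E /\
    0 <= f i <= expR (- \sum_(n <= j < m) (window m y N j i : nat)%:R * p j).
  have [[nw BT]|[j [nj wj Bj]]] := BE i.
    have E : [set w | (X (i.+1%:R * side N) w - X (i%:R * side N) w)%R \in B i] = setT.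
      by apply/seteqP; split => // om _ /=; rewrite BT in_setT.
    rewrite /f E probability_setT/=; split => //; rewrite ler01/=.
    rewrite big_nat big1 ?oppr0 ?expR0// => j nj.
    by rewrite nw// mul0r.
  have E : [set w | (X (i.+1%:R * side N) w - X (i%:R * side N) w)%R \in B i] =
      ~` big_incr X c (thr (j - k)) N i.
    apply/seteqP; split => om /=; rewrite Bj in_setE /big_incr/=.
      by rewrite leNgt => /negP.
    by move=> /negP; rewrite -leNgt.
  have mB := measurable_big_incr hX hc (thr (j - k)) N i.
  have PE : P (~` big_incr X c (thr (j - k)) N i) = (1 - p j)%:E.
    by rewrite probability_setC// prob_big_incr.
  rewrite /f E PE/=; split => //; have /andP[p0 p1] := p01 j.
  rewrite subr_ge0 p1/=.
  have -> : \sum_(n <= j' < m) (window m y N j' i : nat)%:R * p j' = p j.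
    rewrite (bigD1_seq j) ?iota_uniq ?mem_index_iota//= wj mul1r.
    rewrite big1_seq ?addr0// => j'; rewrite mem_index_iota => /andP[j'j nj'].
    case wj' : (window m y N j' i); last by rewrite mul0r.
    move: j'j; rewrite -(window_uniq mN _ _ wj wj') ?eqxx//.
      by case/andP: nj.
    by case/andP: nj'.
  exact: expR_ge1Dx.
rewrite (eq_bigr (fun i : 'I_M => (f i)%:E)); last by move=> i _; have [] := factor i.
rewrite prodEFin lee_fin.
apply: (@le_trans _ _ (\prod_(i < M) expR (- \sum_(n <= j < m) (window m y N j i : nat)%:R * p j))).
  by apply: ler_prod => i _; have [] := factor i.
rewrite -expR_sum ler_expR sumrN mulNr lerN2 exchange_big/= mulr_suml.
rewrite [leLHS]big_nat [leRHS]big_nat; apply: ler_sum => j /andP[nj jm].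
rewrite -mulr_suml -(big_mkord xpredT (fun i => (window m y N j i : nat)%:R)).
have := window_count y mN jm; have /andP[p0 p1] := p01 j.
rewrite -/(p j) => /(ler_wpM2r p0); rewrite -/M.
set a := \sum_(0 <= i < M) _.
by rewrite !mulrA mulrAC.
Qed.

End Miss.

(** * Almost sure richness of hit cells *)

Section Rich.
Context (R : realType) (dO : measure_display) (Omega : measurableType dO)
  (P : probability Omega R) (d : nat) (X : R -> Omega -> 'rV[R]_d).
Hypothesis hX : is_levy_process P X.
Context (c : nat) (hc : (1 < c)%N).
Notation side := (@side R c).
Variables (thr : nat -> R).
Hypothesis thr_gt0 : forall j, 0 < thr j.
Hypothesis diverges : forall n (Q : R), exists m N0, forall N, (N0 <= N)%N ->
  Q < \sum_(n <= j < m) side j * (c%:R ^+ N * tail P X c (thr j) N).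

Let hitX (om : Omega) (k j i : nat) : Prop :=
  exists2 s, i%:R * side j < s <= i.+1%:R * side j &
    jump_times X om s /\ thr (j - k) <= eucl (jump X om s).

(** A limit inferior over grids of events on increments, hence measurable; it replaces [missed],
    which speaks of jumps. The level [N + m] guarantees that the grid is at least as fine as level
    [m]. *)
Let eventually_missed k n m y : set Omega :=
  \bigcup_N1 \bigcap_(N in [set N | (N1 <= N)%N]) no_big_incr X c thr k n m y (N + m).

(** Each of the finitely many ancestors contains only jumps below its threshold, so
    [small_increments] bounds all its increments on fine grids. *)
Lemma missed_eventually om k n m y : missed c (hitX om k) n n m y ->
  eventually_missed k n m y om.
Proof.
move=> ms.
have /choice[N0 hN0] : forall j, exists N0, (n <= j < m)%N -> forall N i, (N0 <= N)%N ->
    (j <= N)%N -> (i %/ c ^ (N - j) = y %/ c ^ (m - j))%N -> ~ big_incr X c (thr (j - k)) N i om.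
  move=> j; have [nj|] := boolP (n <= j < m)%N; last by exists 0%N.
  set I := (y %/ c ^ (m - j))%N.
  have a0 : 0 <= I%:R * side j by rewrite mulr_ge0 ?side_ge0.
  have [nj1 nj2] := andP nj.
  have small s : I%:R * side j < s -> s <= I.+1%:R * side j ->
      eucl (jump X om s) < thr (j - k).
    move=> s1 s2; rewrite ltNge; apply/negP => le.
    apply: (ms j) => //; exists s; first by rewrite s1 s2.
    split => //; split; first exact: le_lt_trans s1.
    by rewrite -eucl_gt0; apply: lt_le_trans le.
  have [e e0 he] := small_increments (@levy_right _ _ _ _ _ _ hX om)
    (@levy_left _ _ _ _ _ _ hX om) a0 (thr_gt0 (j - k)) small.
  have [N0 hN0] := side_cvg0 hc e0.
  exists N0 => _ N i NN jN iI; rewrite /big_incr/=; apply/negP; rewrite -leNgt.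
  have sIi : sub c (N, i) (j, I) by rewrite /sub/= jN iI eqxx.
  have [h1 h2] := sub_bounds (R := R) hc sIi.
  apply: he => //.
    by rewrite ler_pM2r ?side_gt0// ler_nat.
  by rewrite -mulrBl -natr1 addrAC subrr add0r mul1r hN0.
exists (\max_(j < m) N0 j)%N => // N /= hN i j nj wj.
have [nj1 nj2] := andP nj.
apply: (hN0 j nj); last by case/andP: wj => /eqP.
  apply: leq_trans (leq_trans hN (leq_addr _ _)).
  exact: (@leq_bigmax _ (fun i : 'I_m => N0 i) (Ordinal nj2)).
by apply: leq_trans (leq_addl _ _); exact: ltnW.
Qed.

Lemma measurable_eventually_missed k n m y : measurable (eventually_missed k n m y).
Proof.
apply: bigcupT_measurable => N1.
rewrite (_ : \bigcap_(N in _) _ = \bigcap_N (if (N1 <= N)%N then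
    no_big_incr X c thr k n m y (N + m) else setT)).
  apply: bigcapT_measurable => N; case: ifP => _; last exact: measurableT.
  exact: (measurable_no_big_incr hX hc).
apply/seteqP; split => om h N; first by move=> _; case: ifP => // NN; exact: h.
by move=> /= NN; have := h N I; rewrite NN.
Qed.

(** The event is an increasing union, and each member is contained in events of probability at most
    [b]. *)
Lemma prob_eventually_missed k n m y (b : R) N0 :
  (forall N, (N0 <= N)%N -> (P (no_big_incr X c thr k n m y (N + m)) <= b%:E)%E) ->
  (P (eventually_missed k n m y) <= b%:E)%E.
Proof.
move=> hb.
pose F N1 := \bigcap_(N in [set N | (N1 <= N)%N]) no_big_incr X c thr k n m y (N + m).
have mF N1 : measurable (F N1).
  rewrite /F (_ : \bigcap_(N in _) _ = \bigcap_N (if (N1 <= N)%N then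
      no_big_incr X c thr k n m y (N + m) else setT)).
    apply: bigcapT_measurable => N; case: ifP => _; last exact: measurableT.
    exact: (measurable_no_big_incr hX hc).
  apply/seteqP; split => om h N; first by move=> _; case: ifP => // NN; exact: h.
  by move=> /= NN; have := h N I; rewrite NN.
have ndF : nondecreasing_seq F.
  move=> N1 N2 N12; apply/subsetPset => om h N /= NN; apply: h => /=.
  exact: leq_trans NN.
have cv := nondecreasing_cvg_mu (mu := P) mF (measurable_eventually_missed k n m y) ndF.
rewrite -(cvg_lim _ cv)//; apply: lime_le; first by apply/cvg_ex; eexists; exact: cv.
apply: nearW => N1 /=; apply: le_trans (hb (maxn N0 N1) (leq_maxl _ _)).
apply: le_measure; [exact/mem_set/mF|exact/mem_set/(measurable_no_big_incr hX hc)|].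
by move=> om; apply => /=; exact: leq_maxr.
Qed.

(** Reindexing by the shift multiplies the divergent sum by [side k]. Asking for a sum above
    [2 * x1 * c ^ k] compensates this factor and the 2 in the exponent. *)
Lemma exists_rare_level k n (eta : R) : (k <= n)%N -> 0 < eta ->
  exists2 m, (n <= m)%N & forall y, (P (eventually_missed k n m y) <= eta%:E)%E.
Proof.
move=> kn eta0.
have [x hx] : exists x, forall z, x <= z -> expR (- z) <= eta.
  have /(cvgr_le _)/(_ _ eta0)[x [_ hx]] := @cvgr_expR R.
  by exists (x + 1) => z xz; apply: hx; apply: lt_le_trans xz; rewrite ltrDl.
pose x1 := Num.max x 0.
have [m0 [N0 hN0]] := diverges (n - k) (2 * x1 * c%:R ^+ k).
have c0 : 0 < c%:R :> R by rewrite ltr0n base_gt0.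
have m0n : (n - k <= m0)%N.
  rewrite leqNgt; apply/negP => lt; have := hN0 N0 (leqnn _).
  rewrite big_geq ?(ltnW lt)// ltNge => /negP; apply.
  by rewrite mulr_ge0 ?exprn_ge0 ?(ltW c0)// mulr_ge0// le_max lexx orbT.
exists (m0 + k)%N; first by rewrite addnC -leq_subLR.
move=> y; apply: (@prob_eventually_missed _ _ _ _ _ N0) => N NN.
apply: le_trans (prob_no_big_incr hX hc _ _ _ _ (leq_addl _ _)) _.
rewrite lee_fin mulNr; apply: hx; rewrite ler_pdivlMr//.
have -> : \sum_(n <= j < m0 + k) side j * (c%:R ^+ (N + (m0 + k)) *
      tail P X c (thr (j - k)) (N + (m0 + k))) = side k *
    \sum_(n - k <= j < m0) side j * (c%:R ^+ (N + (m0 + k)) *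
      tail P X c (thr j) (N + (m0 + k))).
  rewrite -{1}(subnK kn) big_addn addnK mulr_sumr; apply: eq_bigr => j _.
  by rewrite addnK sideD [side j * _]mulrC -mulrA.
have hS := hN0 (N + (m0 + k))%N (leq_trans NN (leq_addr _ _)).
apply: (@le_trans _ _ (side k * (2 * x1 * c%:R ^+ k))); last first.
  by rewrite ler_pM2l ?side_gt0// ltW.
rewrite /side mulrCA mulVf ?mulr1 ?expf_neq0 ?gt_eqF// mulrC ler_pM2l//.
by rewrite le_max lexx.
Qed.

(** Choose [m t] with missing probability at most [e / t.+1]. By Markov's inequality the proportion
    missed exceeds [e] with probability at most [t.+1^-1]; failure for every [t] is then a null
    event. *)
Lemma rare_misses_ae k n (q : nat * nat) (e : R) : (k <= n)%N -> (q.1 <= n)%N -> 0 < e ->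
  {ae P, forall om, exists2 m, (n <= m)%N &
    \sum_(q.2 * c ^ (m - q.1) <= y < q.2.+1 * c ^ (m - q.1))
      \1_(eventually_missed k n m y) om <= e * c%:R ^+ (m - q.1)}.
Proof.
move=> kn qn e0.
have c0 : 0 < c%:R :> R by rewrite ltr0n base_gt0.
have /choice[m hm] : forall t : nat, exists m, (n <= m)%N /\
    forall y, (P (eventually_missed k n m y) <= (e * t.+1%:R^-1)%:E)%E.
  move=> t; have eta0 : 0 < e * t.+1%:R^-1 by rewrite mulr_gt0// invr_gt0.
  by have [m nm hm] := exists_rare_level kn eta0; exists m.
pose S t om := \sum_(q.2 * c ^ (m t - q.1) <= y < q.2.+1 * c ^ (m t - q.1))
      \1_(eventually_missed k n (m t) y) om : R.
pose A t := [set om | e * c%:R ^+ (m t - q.1) < S t om].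
have mS t : measurable_fun setT (S t).
  by apply: measurable_sum => y; apply: measurable_indic; exact: measurable_eventually_missed.
have mA t : measurable (A t).
  have := mS t measurableT `]e * c%:R ^+ (m t - q.1), +oo[%classic (measurable_itv _).
  rewrite setTI; congr (measurable _); apply/seteqP; split => om /=;
    by rewrite in_itv/= andbT.
have PA t : (P (A t) <= (t.+1%:R^-1)%:E)%E.
  pose D := (m t - q.1)%N.
  have cD : 0 < c%:R ^+ D :> R by rewrite exprn_gt0.
  have eD : 0 < e * c%:R ^+ D by rewrite mulr_gt0.
  have h1 : ((e * c%:R ^+ D)%:E * P (A t) <= \int[P]_om (S t om)%:E)%E.
    have -> : ((e * c%:R ^+ D)%:E * P (A t) =
        \int[P]_om ((e * c%:R ^+ D)%:E * (\1_(A t) om)%:E))%E.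
      rewrite ge0_integralZl_EFin//.
      - by rewrite integral_indic ?setIT.
      - by apply/measurable_EFinP; exact: measurable_indic.
      - exact: ltW.
    apply: ge0_le_integral_lower => om.
      by rewrite mule_ge0// lee_fin ltW.
    rewrite indicE; have [h|h] := boolP (om \in A t).
      by rewrite mule1 lee_fin; move: h => /set_mem/ltW.
    by rewrite mule0 lee_fin; apply: sumr_ge0.
  have h2 : (\int[P]_om (S t om)%:E <= (c%:R ^+ D * (e * t.+1%:R^-1))%:E)%E.
    rewrite /S; under eq_integral do rewrite -sumEFin.
    rewrite ge0_integral_sum//=; last first.
      by move=> y; apply/measurable_EFinP; apply: measurable_indic;
        exact: measurable_eventually_missed.
    apply: (@le_trans _ _ (\sum_(q.2 * c ^ D <= y < q.2.+1 * c ^ D) (e * t.+1%:R^-1)%:E)%E).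
      apply: lee_sum => y _; rewrite integral_indic ?setIT//; last exact: measurable_eventually_missed.
      by have [_] := hm t; apply.
    by rewrite sumEFin lee_fin sumr_const_nat mulSn addnK -natrX mulr_natl.
  have := le_trans h1 h2; rewrite -[X in (X <= _)%E]muleC -lee_pdivlMr// => /le_trans; apply.
  by rewrite lee_fin ler_pdivrMr// mulrCA [leRHS]mulrCA [t.+1%:R^-1 * _]mulrC.
exists (\bigcap_t A t); split.
- exact: bigcapT_measurable.
- apply/eqP; rewrite eq_le measure_ge0 andbT; apply/lee_addgt0Pr => x x0.
  rewrite add0e; pose t := Num.bound x^-1.
  apply: (@le_trans _ _ (P (A t))).
    apply: le_measure; [exact/mem_set/bigcapT_measurable|exact/mem_set/mA|].
    by move=> om; apply.
  apply: le_trans (PA t) _; rewrite lee_fin invf_ple ?posrE//.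
  apply: le_trans (ltW (archi_boundP _)) _; first by rewrite invr_ge0 ltW.
  by rewrite ler_nat leqnSn.
- move=> om /= nex t _; rewrite /A/= ltNge; apply/negP => le; apply: nex.
  by exists (m t) => //; have [] := hm t.
Qed.

(** Restricting [e] to the values [t.+1^-1] leaves countably many conditions. Starting at
    [maxn n (maxn j0 k)] is harmless, since forbidding hits on fewer levels only enlarges the set of
    missed cells. *)
Lemma rich_ae : {ae P, forall om, forall k q, @rich_at R c (hitX om k) q}.
Proof.
have H k j0 i0 n t : {ae P, forall om, exists2 m, (maxn n (maxn j0 k) <= m)%N &
    \sum_(i0 * c ^ (m - j0) <= y < i0.+1 * c ^ (m - j0))
      \1_(eventually_missed k (maxn n (maxn j0 k)) m y) om <= (t.+1%:R^-1 : R) * c%:R ^+ (m - j0)}.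
  have h1 : (k <= maxn n (maxn j0 k))%N by rewrite !leq_max leqnn !orbT.
  have h2 : (j0 <= maxn n (maxn j0 k))%N by rewrite !leq_max leqnn !orbT.
  have h3 : 0 < t.+1%:R^-1 :> R by rewrite invr_gt0.
  exact: (@rare_misses_ae k _ (j0, i0) _ h1 h2 h3).
have {}H : {ae P, forall om, forall k j0 i0 n t, exists2 m, (maxn n (maxn j0 k) <= m)%N &
    \sum_(i0 * c ^ (m - j0) <= y < i0.+1 * c ^ (m - j0))
      \1_(eventually_missed k (maxn n (maxn j0 k)) m y) om <= (t.+1%:R^-1 : R) * c%:R ^+ (m - j0)}.
  by do 5 (apply: ae_foralln => ?); exact: H.
apply: filterS H => om H k [j0 i0] n e e0 /=.
pose t := Num.bound e^-1.
have [m hm le] := H k j0 i0 n t; exists m; split.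
- by apply: leq_trans hm; rewrite leq_max leqnn.
- by apply: leq_trans hm; rewrite !leq_max leqnn !orbT.
have te : t.+1%:R^-1 <= e.
  rewrite invf_ple ?posrE//.
  apply: le_trans (ltW (archi_boundP _)) _; first by rewrite invr_ge0 ltW.
  by rewrite ler_nat leqnSn.
apply: (@le_trans _ _ (t.+1%:R^-1 * c%:R ^+ (m - j0))); last first.
  by rewrite ler_wpM2r// exprn_ge0.
apply: le_trans le; apply: ler_sum => y _; case: asboolP => // ms.
rewrite indicE mem_set//; apply: missed_eventually => j /andP[j1 j2] _.
apply: ms; first by rewrite j2 andbT (leq_trans _ j1)// !leq_max leqnn !orbT.
by rewrite (leq_trans _ j1)// leq_max leqnn.
Qed.

End Rich.

(** * Hausdorff measures *)

Section HausdorffCovers.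
Context {R : realType}.

Lemma diam_ge0 (U : set R) : 0 <= diam U.
Proof.
rewrite /diam; have [[[x Ux] ub]|h] := pselect (has_sup [set `|x - y| | x in U & y in U]).
  by apply: le_trans (ub_le_sup ub Ux); move: Ux => [a _ [b _ <-]].
by rewrite sup_out.
Qed.

Lemma diam_set0 : diam (set0 : set R) = 0.
Proof.
rewrite /diam (_ : [set _ | _ in _ & _ in _] = set0) ?sup0//.
by apply/seteqP; split => // x [y []].
Qed.

Lemma diam_le (U : set R) e : 0 <= e ->
  (forall x y, U x -> U y -> `|x - y| <= e) -> diam U <= e.
Proof.
move=> e0 h; have [->|/set0P[x Ux]] := eqVneq U set0; first by rewrite diam_set0.
apply: ge_sup; first by exists `|x - x|, x => //; exists x.
by move=> _ [a Ua [b Ub <-]]; exact: h.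
Qed.

Lemma le_diam (U : set R) e x y : (forall x y, U x -> U y -> `|x - y| <= e) ->
  U x -> U y -> `|x - y| <= diam U.
Proof.
move=> h Ux Uy; apply: ub_le_sup; last by exists x => //; exists y.
by exists e => _ [a Ua [b Ub <-]]; exact: h.
Qed.

Variables (g : R -> R) (dl : R).
Hypothesis dl0 : 0 <= dl.
Hypothesis g00 : g 0 = 0.
Hypothesis g_mono : forall x y, 0 <= x -> x <= y -> y <= dl -> g x <= g y.

Definition small_sets (U : nat -> set R) : Prop :=
  forall i x y, U i x -> U i y -> `|x - y| <= dl.

Definition covered (E : set R) (x : \bar R) : Prop :=
  exists U, [/\ E `<=` \bigcup_i U i, small_sets U &
    (\sum_(i <oo) (g (diam (U i)))%:E <= x)%E].

Lemma gdiam_ge0 U i : small_sets U -> (0 <= (g (diam (U i)))%:E)%E.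
Proof.
move=> sU; rewrite lee_fin -g00; apply: g_mono => //; first exact: diam_ge0.
by apply: diam_le => // x y; exact: sU.
Qed.

Lemma covered_le E x y : (x <= y)%E -> covered E x -> covered E y.
Proof. by move=> xy [U [h1 h2 h3]]; exists U; split => //; exact: le_trans xy. Qed.

Lemma covered_sub E F x : E `<=` F -> covered F x -> covered E x.
Proof. by move=> EF [U [h1 h2 h3]]; exists U; split => //; exact: subset_trans h1. Qed.

Lemma covered_setU E F x y : covered E x -> covered F y -> covered (E `|` F) (x + y)%E.
Proof.
move=> [U [U1 U2 U3]] [V [V1 V2 V3]].
exists (interleave U V); split.
- move=> t [/U1[i _ ti]|/V1[i _ ti]].
    by exists i.*2 => //; rewrite interleave_even.
  by exists i.*2.+1 => //; rewrite interleave_odd.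
- move=> i x' y'; move: i x' y'; rewrite -/(small_sets _).
  exact: (@interleave_ind _ (fun W => forall x y, W x -> W y -> `|x - y| <= dl)).
- apply: le_trans (leeD U3 V3).
  apply: (@nneseries_interleave_le _ _ (fun W => (g (diam W))%:E)) => i; exact: gdiam_ge0.
Qed.

Lemma covered_set0 : covered set0 0%E.
Proof.
exists (fun=> set0); split => //.
by rewrite eseries0// => i _ _; rewrite diam_set0 g00.
Qed.

Lemma covered_set (E : set R) (r : R) : 0 <= r -> r <= dl ->
  (forall x y, E x -> E y -> `|x - y| <= r) -> covered E (g r)%:E.
Proof.
move=> r0 rdl Er.
have Ed : diam E <= r by exact: diam_le.
exists (fun i => if i is 0%N then E else set0); split.
- by move=> t Et; exists 0%N.
- by move=> [|i] x y //= Ex Ey; apply: le_trans rdl; exact: Er.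
- have g0 i : (0 <= (g (diam (if i is 0%N then E else set0)))%:E)%E.
    case: i => [|i]; last by rewrite diam_set0 g00.
    by rewrite lee_fin -g00; apply: g_mono; rewrite ?diam_ge0// (le_trans Ed).
  apply: lime_le; first by apply: is_cvg_nneseries => *; exact: g0.
  apply: nearW => -[|n]; first by rewrite big_geq// lee_fin -g00; exact: g_mono.
  rewrite big_nat_recl// big1 ?adde0 => [|i _]; last by rewrite diam_set0 g00.
  by rewrite lee_fin; apply: g_mono; rewrite ?diam_ge0.
Qed.

Lemma covered_bigsetU (E : nat -> set R) (x : nat -> R) m n :
  (forall i, (m <= i < n)%N -> covered (E i) (x i)%:E) ->
  covered (\bigcup_(i in [set i | (m <= i < n)%N]) E i) (\sum_(m <= i < n) x i)%:E.
Proof.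
elim: n => [|n IH] h.
  rewrite big_geq// (_ : \bigcup_(i in _) _ = set0); first exact: covered_set0.
  by apply/seteqP; split => // t [i /=]; rewrite ltn0 andbF.
have [mn|nm] := leqP m n; last first.
  rewrite big_geq// (_ : \bigcup_(i in _) _ = set0); first exact: covered_set0.
  by apply/seteqP; split => // t [i /= /andP[h1 h2]]; lia.
rewrite big_nat_recr//= EFinD.
apply: covered_sub (covered_setU (IH _) (h n _)).
- move=> t [i /= /andP[mi]]; rewrite ltnS leq_eqVlt => /predU1P[->|lt] Ei; first by right.
  by left; exists i => //=; rewrite mi.
- by move=> i /andP[mi lt]; apply: h; rewrite mi ltnS ltnW.
- by rewrite mn ltnS leqnn.
Qed.

Definition negl (E : set R) : Prop := forall eta : R, 0 < eta -> covered E eta%:E.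

Lemma negl_sub E F : E `<=` F -> negl F -> negl E.
Proof. by move=> EF nF eta eta0; apply: covered_sub EF _; exact: nF. Qed.

Lemma negl_point t : negl [set t].
Proof.
move=> eta eta0; apply: covered_le (_ : (g 0)%:E <= _)%E _.
  by rewrite g00 lee_fin ltW.
by apply: covered_set => // x y -> ->; rewrite subrr normr0.
Qed.

Lemma nneseries_pair_le (u : nat -> nat -> \bar R) : (forall n i, 0 <= u n i)%E ->
  (\sum_(k <oo) (if @pickle_inv (nat * nat)%type k is Some p then u p.1 p.2 else 0) <=
   \sum_(n <oo) \sum_(i <oo) u n i)%E.
Proof.
move=> u0.
have c0 k : (0 <= if @pickle_inv (nat * nat)%type k is Some p then u p.1 p.2 else 0)%E.
  by case: (pickle_inv k) => // p.
pose f (k : nat) : \bar R := (if @pickle_inv (nat * nat)%type k is Some p then u p.1 p.2 else 0)%E.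
have f0 k : (0 <= f k)%E by exact: c0.
pose pk (p : nat * nat) : nat := pickle p.
rewrite (nneseries_esumT f0) (_ : (\esum_(k in [set: nat]) f k =
    \esum_(k in range pk) f k)%E); last first.
  rewrite [RHS]esum_mkcond; apply: eq_esum => k _; case: ifPn => // kn.
  rewrite /f; case E : (pickle_inv k) => [p|//]; exfalso; move/negP: kn; apply.
  apply/mem_set; exists p => //.
  by have := @pickle_invK (nat * nat)%type k; rewrite E.
rewrite esum_image; last by move=> x y _ _; exact: (pcan_inj pickleK_inv).
rewrite (eq_esum (b := fun p => u p.1 p.2)); last by move=> p _; rewrite /f pickleK_inv.
have -> : [set: nat * nat] = [set: nat] `*`` (fun=> [set: nat]).
  by apply/seteqP; split => // -[].
rewrite -(@esum_esum _ _ _ setT (fun=> setT) u)//.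
rewrite nneseries_esumT; last by move=> n; apply: nneseries_ge0.
by apply: le_esum => n _; rewrite nneseries_esumT.
Qed.

Lemma negl_bigcup (E : nat -> set R) : (forall n, negl (E n)) -> negl (\bigcup_n E n).
Proof.
move=> nE eta eta0.
have /choice[U hU] : forall n, exists U, [/\ E n `<=` \bigcup_i U i, small_sets U &
    (\sum_(i <oo) (g (diam (U i)))%:E <= (eta / (2 ^ n.+1)%:R)%:E)%E].
  by move=> n; apply: nE; rewrite divr_gt0// ltr0n expn_gt0.
exists (fun k => if @pickle_inv (nat * nat)%type k is Some p then U p.1 p.2 else set0); split.
- move=> t [n _ Et]; have [h _ _] := hU n; have [i _ ti] := h _ Et.
  by exists (pickle (n, i)) => //; rewrite pickleK_inv.
- by move=> k x y; case: (pickle_inv k) => // p; have [_ h _] := hU p.1; exact: h.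
- have := @nneseries_pair_le (fun n i => (g (diam (U n i)))%:E) _.
  have -> : (\sum_(k <oo) (g (diam (if @pickle_inv (nat * nat)%type k is Some p
        then U p.1 p.2 else set0)))%:E =
      \sum_(k <oo) (if @pickle_inv (nat * nat)%type k is Some p then
        (g (diam (U p.1 p.2)))%:E else 0))%E.
    by apply: eq_eseriesr => k _; case: (pickle_inv k) => [p|] //; rewrite diam_set0 g00.
  move=> h; apply: le_trans (h _) _.
    by move=> n i; have [_ s _] := hU n; exact: gdiam_ge0.
  apply: le_trans (epsilon_trick0 xpredT (ltW eta0)).
  apply: lee_nneseries => n *; last by have [] := hU n.
  by apply: nneseries_ge0 => i _ _; have [_ s _] := hU n; exact: gdiam_ge0.
Qed.

Lemma hausdorff_pre_negl (E F : set R) : negl F ->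
  (hausdorff_pre g dl (E `|` F) <= hausdorff_pre g dl E)%E.
Proof.
move=> nF; apply: le_ereal_inf_tmp => _ [U [EU sU] <-].
apply/lee_addgt0Pr => eta eta0.
have [W [h1 h2 h3]] : covered (E `|` F) (\sum_(i <oo) (g (diam (U i)))%:E + eta%:E)%E.
  by apply: covered_setU; [exists U|exact: nF].
by apply: le_trans h3; apply: ereal_inf_lbound; exists W.
Qed.

End HausdorffCovers.

Section HausdorffMono.
Context {R : realType}.

Lemma hausdorff_pre_sub (g : R -> R) dl (E F : set R) : E `<=` F ->
  (hausdorff_pre g dl E <= hausdorff_pre g dl F)%E.
Proof.
move=> EF; apply: le_ereal_inf => _ [U [FU sU] <-]; exists U => //; split => //.
exact: subset_trans FU.
Qed.

Lemma hausdorff_sub (g : R -> R) (E F : set R) : E `<=` F ->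
  (hausdorff g E <= hausdorff g F)%E.
Proof.
move=> EF; apply: ge_ereal_sup => _ [dl dl0 <-].
apply: le_trans (hausdorff_pre_sub g dl EF) _.
by apply: ereal_sup_ubound; exists dl.
Qed.

Lemma hausdorff_pre_scale (g : R -> R) dl dl' (E : set R) : dl <= dl' ->
  (hausdorff_pre g dl' E <= hausdorff_pre g dl E)%E.
Proof.
move=> dd; apply: le_ereal_inf => _ [U [EU sU] <-]; exists U => //; split => //.
by move=> i x y Ux Uy; apply: le_trans dd; exact: sU Ux Uy.
Qed.

Lemma hausdorff_negl (g : R -> R) (e : R) (E F : set R) : 0 < e -> g 0 = 0 ->
  (forall x y, 0 <= x -> x <= y -> y <= e -> g x <= g y) ->
  (forall dl, 0 < dl -> dl <= e -> negl g dl F) ->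
  (hausdorff g (E `|` F) <= hausdorff g E)%E.
Proof.
move=> e0 g00 gm nF; apply: ge_ereal_sup => _ [dl dl0 <-].
have {}dl0 : 0 < dl by move: dl0; rewrite /= in_itv/= andbT.
pose dl' := Num.min dl e.
have dl'0 : 0 < dl' by rewrite lt_min dl0.
have dl'e : dl' <= e by rewrite ge_min lexx orbT.
apply: (@le_trans _ _ (hausdorff_pre g dl' (E `|` F))).
  by apply: hausdorff_pre_scale; rewrite ge_min lexx.
apply: (@le_trans _ _ (hausdorff_pre g dl' E)).
  apply: hausdorff_pre_negl => //; first exact: ltW.
    by move=> x y x0 xy ye; apply: gm => //; exact: le_trans dl'e.
  exact: nF.
by apply: ereal_sup_ubound; exists dl' => //; rewrite /= in_itv/= dl'0.
Qed.

End HausdorffMono.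

(** * Infinite Hausdorff measure when the reduced gauge dominates length *)

Section HausdorffInfinite.
Context {R : realType} (c : nat) (hc : (1 < c)%N).
Notation side := (@side R c).
Notation sub := (@sub c).
Notation cell := (@cell R c).
Variables (H : nat -> R) (J0 : nat).
Hypothesis H_gt0 : forall j, (J0 <= j)%N -> 0 < H j.
Hypothesis H_le : forall j, (J0 <= j)%N -> H j.+1 <= H j.
Hypothesis H_ge : forall j, (J0 <= j)%N -> H j <= c%:R * H j.+1.
Hypothesis H_oo : forall A : R, exists N, forall j, (N <= j)%N -> A * side j <= H j.
Hypothesis H_small : forall x : R, 0 < x -> exists N, forall j, (N <= j)%N -> H j < x.
Variables (big : nat -> R -> Prop) (mu : nat -> nat).
Hypothesis mu_ge : forall j, (j <= mu j)%N.
Hypothesis H_mu : exists (C : R) (N : nat), 0 < C /\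
  forall j, (N <= j)%N -> C * side j <= H (mu j).
Hypothesis rich : forall k q, @rich_at R c (hit c big mu k) q.

(** Pigeonhole over the [c ^ (m - q.1)] cells of level [m] in [q]: one of them is good, and
    [descent] applies there. A cover cell containing a cell of level [m] equals it, so already costs
    [H m]. *)
Lemma uncovered_of_small_cost L m q : (J0 <= m)%N -> (q.1 <= m)%N -> fine_cover m L ->
  (\sum_(p <oo) weight H (L p) < (c%:R ^+ (m - q.1) * H m)%:E)%E ->
  exists t, [/\ cell q t, forall l, near_big c big l t & ~ covers c L t].
Proof.
move=> Jm qm fL small.
have fL' : fine_cover J0 L by move=> p r Lp; apply: leq_trans Jm (fL _ _ Lp).
pose D := (c ^ (m - q.1))%N.
have [y [ylo yhi gy]] : exists y, [/\ (q.2 * D <= y)%N, (y < q.2.+1 * D)%N & good c H L (m, y)].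
  apply: contrapT => nex.
  have bad y : (q.2 * D <= y < q.2.+1 * D)%N -> ((H m)%:E <= cost c H L (m, y))%E.
    move=> /andP[y1 y2]; rewrite leNgt; apply/negP => lt; apply: nex; exists y; split => //.
    split => // p r Lp; apply/negP => yr.
    have rE : (m, y) = r.
      by apply: (sub_level yr) => /=; have := fL _ _ Lp; move: yr => /andP[/=]; lia.
    have ry : sub r (m, y) by rewrite -rE sub_refl.
    have := cost_ge_term H_gt0 (I := (m, y)) Jm Lp ry.
    by rewrite -rE leNgt lt.
  move: small; rewrite ltNge => /negP; apply.
  have -> : ((c%:R ^+ (m - q.1) * H m)%:E = \sum_(q.2 * D <= y < q.2.+1 * D) (H m)%:E)%E.
    by rewrite sumEFin sumr_const_nat mulSn addnK /D -natrX mulr_natl.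
  apply: (@le_trans _ _ (\sum_(q.2 * D <= y < q.2.+1 * D) cost c H L (m, y))%E).
    by rewrite big_nat [leRHS]big_nat; apply: lee_sum => y; exact: bad.
  have t0 y p : (0 <= if L p is Some r then if sub r (m, y) then (H r.1)%:E else 0 else 0)%E.
    exact: (term_ge0 c H_gt0 L p (I := (m, y))).
  rewrite /cost -nneseries_sum; last by move=> *; exact: t0.
  apply: lee_nneseries => p *; first by apply: sume_ge0 => *; exact: t0.
  have w0 := weight_ge0 H_gt0 p fL'.
  case E : (L p) => [r|]; last by rewrite big1.
  rewrite E in w0.
  have [[y yr]|nr] := pselect (exists y, sub r (m, y)); last first.
    by rewrite big1 // => y _; case: ifP => // ry; exfalso; apply: nr; exists y.
  have uniq_y y' : sub r (m, y') -> y' = y.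
    by move: yr => /andP[/= _ /eqP <-] /andP[/= _ /eqP <-].
  rewrite (eq_bigr (fun y' => if y' == y then (H r.1)%:E else 0%E)); last first.
    move=> y' _; case: ifPn => [/uniq_y ->|]; first by rewrite eqxx.
    by case: eqP => // ->; rewrite yr.
  have [yin|yout] := boolP (y \in index_iota (q.2 * D) (q.2.+1 * D)).
    by rewrite (bigD1_seq y) ?iota_uniq//= eqxx big1 ?adde0// => y' /negbTE ->.
  rewrite big1_seq// => y' /andP[_ y'in]; case: eqP => // yy'.
  by move: yout; rewrite -yy' y'in.
have [t [yt nt unc]] := descent hc H_gt0 H_le H_ge H_oo mu_ge H_mu rich (q := (m, y)) Jm gy.
exists t; split => //.
  apply: sub_cell yt => //; rewrite /sub/= qm/=.
  have D0 : (0 < D)%N by rewrite expn_gt0 base_gt0.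
  by rewrite eqn_leq -ltnS ltn_divLR// leq_divRL// ylo yhi.
by move=> [p [r [Lr rt]]]; exact: unc Lr rt.
Qed.

Lemma level_of (D : R) m : 0 < D -> D <= side m ->
  exists2 l, (m <= l)%N & side l.+1 < D <= side l.
Proof.
move=> D0 Dm; have ex : exists j, side j < D.
  by have [N hN] := side_cvg0 hc D0; exists N; exact: hN.
case: (ex_minnP ex) => j jD jmin.
have mj : (m < j)%N.
  rewrite ltnNge; apply/negP => jm.
  have : side m <= side j.
    by rewrite -(mul_side hc jm) ler_peMl ?side_ge0// exprn_ege1// ler1n base_gt0.
  by rewrite leNgt (lt_le_trans jD).
case: j mj jD jmin => // j mj jD jmin.
exists j => //; rewrite jD/= leNgt; apply/negP => /jmin.
by rewrite ltnn.
Qed.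

Variables (g : R -> R) (e1 : R) (S : set R) (e : nat -> R).
Hypothesis e10 : 0 < e1.
Hypothesis g00 : g 0 = 0.
Hypothesis g_mono : forall x y, 0 <= x -> x <= y -> y <= e1 -> g x <= g y.
Hypothesis H_g : forall l D, (J0 <= l)%N -> side l.+1 < D -> D <= e1 -> H l.+1 <= g D.
Hypothesis S_range : S `<=` range e.

(** A set of diameter in []side l.+1, side l]] meets at most three consecutive cells of level [l],
    and [H l <= c * H l.+1] compares their cost with [g (diam U)]. The margin [eta] is for diameter
    0, where [g] gives nothing but a cell has positive cost. *)
Lemma cover_small_set (U : set R) (x eta : R) m : (J0 <= m)%N -> x <= e1 -> x <= side m ->
  0 <= x -> 0 < eta -> (forall s t, U s -> U t -> `|s - t| <= x) ->
  exists l k, [/\ (m <= l)%N, H l <= c%:R * g (diam U) + eta &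
    forall t, U t -> 0 <= t -> exists2 k', cell (l, k') t & (k' = k.-1 \/ k' = k \/ k' = k.+1)].
Proof.
move=> Jm xe xm x0 eta0 Ux.
have Dx : diam U <= x by exact: diam_le.
have [l ml [Dl Hl]] : exists2 l, (m <= l)%N &
    diam U <= side l /\ H l <= c%:R * g (diam U) + eta.
  have := diam_ge0 U; rewrite le_eqVlt => /predU1P[D0|D0].
    have [N hN] := H_small eta0; exists (maxn m N); first exact: leq_maxl.
    rewrite -D0 side_ge0//; split => //; rewrite g00 mulr0 add0r ltW// hN//.
    exact: leq_maxr.
  have [l ml /andP[l1 l2]] := level_of D0 (le_trans Dx xm).
  exists l => //; split => //; have Jl := leq_trans Jm ml.
  apply: (@le_trans _ _ (c%:R * H l.+1)); first exact: H_ge.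
  have hg : H l.+1 <= g (diam U) by apply: H_g => //; exact: le_trans xe.
  have c0 : 0 <= c%:R :> R by [].
  by have := ler_wpM2l c0 hg; lra.
have [[t0 [Ut0 t00]]|nex] := pselect (exists t, U t /\ 0 <= t); last first.
  by exists l, 0%N; split => // t Ut t0; exfalso; apply: nex; exists t.
have [k tk] := exists_cell hc l t00.
exists l, k; split => // t Ut t0'; have [k' tk'] := exists_cell hc l t0'.
exists k' => //.
have close : `|t - t0| <= side l by apply: le_trans Dl; exact: le_diam Ux Ut Ut0.
have s0 := side_gt0 (R := R) hc l.
move: tk tk' close; rewrite /cell/= ler_norml => /andP[a1 a2] /andP[b1 b2] /andP[h1 h2].
have k1 : (k' < k.+2)%N.
  have : k'%:R * side l < k.+2%:R * side l.
    by apply: (le_lt_trans b1); rewrite -(natr1 k.+1) mulrDl mul1r; lra.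
  by rewrite ltr_pM2r// ltr_nat.
have k2 : (k < k'.+2)%N.
  have : k%:R * side l < k'.+2%:R * side l.
    by apply: (le_lt_trans a1); rewrite -(natr1 k'.+1) mulrDl mul1r; lra.
  by rewrite ltr_pM2r// ltr_nat.
by move: k1 k2; clear; lia.
Qed.

(** A cover of cost below [K] by arbitrary sets is replaced by cells, with a cheap cover of [S]
    added. For deep [m] the total stays below the budget of [uncovered_of_small_cost], which
    produces an uncovered point. *)
Lemma hausdorff_infinite (V : set R) : open V -> V `<=` `]0, +oo[ -> V !=set0 ->
  hausdorff g ([set t | (forall l, near_big c big l t) /\ ~ S t] `&` V) = +oo%E.
Proof.
move=> oV V0 [v Vv]; set F := [set t | _]; apply/eqP; apply: contrapT => nfin.
have [K hK] : exists K : R, (hausdorff g (F `&` V) < K%:E)%E.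
  move/eqP: nfin; case: (hausdorff _ _) => [r _| |_] //.
    by exists (r + 1); rewrite lte_fin ltrDl.
  by exists 0; rewrite ltNyr.
have v0 : 0 <= v by have := V0 _ Vv; rewrite /= in_itv/= andbT => /ltW.
have [N1 hN1] := open_contains_cell hc oV Vv v0.
pose j0 := maxn N1 J0.
have [i0 vi0] := exists_cell hc j0 v0.
have cV : cell (j0, i0) `<=` V by apply: hN1 vi0; exact: leq_maxl.
have c0 : 0 <= c%:R :> R by [].
(* [T] bounds the cost of one cell per set. Three such families and the cover of the exceptional
   times cost at most [3 T + 1]. *)
pose T := c%:R * K + 1.
have [N2 hN2] := H_oo ((T + T + T + 2) / side j0).
have [N3 hN3] := side_cvg0 hc e10.
pose m := maxn j0 (maxn N2 N3).
have j0m : (j0 <= m)%N by exact: leq_maxl.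
have Jm : (J0 <= m)%N by apply: leq_trans j0m; exact: leq_maxr.
have Hm : T + T + T + 2 <= c%:R ^+ (m - j0) * H m.
  have : (T + T + T + 2) / side j0 * side m <= H m.
    by apply: hN2; rewrite /m !leq_max leqnn !orbT.
  rewrite -(mul_side hc j0m) invfM mulrA divfK ?gt_eqF ?side_gt0//.
  by rewrite ler_pdivrMr ?exprn_gt0 ?ltr0n ?base_gt0// mulrC.
have me1 : side m <= e1 by apply/ltW/hN3; rewrite /m !leq_max leqnn !orbT.
have [U [EU sU]] : exists U, [/\ F `&` V `<=` \bigcup_i U i,
    small_sets (side m) U & (\sum_(i <oo) (g (diam (U i)))%:E < K%:E)%E].
  have : (hausdorff_pre g (side m) (F `&` V) < K%:E)%E.
    apply: le_lt_trans hK; apply: ereal_sup_ubound; exists (side m) => //.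
    by rewrite /= in_itv/= side_gt0.
  by move=> /ereal_inf_lt[_ [U [h1 h2] <-] h3]; exists U; split.
move=> costU.
have /choice[l hl] : forall i, exists l, exists k, [/\ (m <= l)%N,
    H l <= c%:R * g (diam (U i)) + 1 / (2 ^ i.+1)%:R &
    forall t, U i t -> 0 <= t -> exists2 k', cell (l, k') t & (k' = k.-1 \/ k' = k \/ k' = k.+1)].
  move=> i; have eta0 : 0 < 1 / (2 ^ i.+1)%:R :> R by rewrite divr_gt0// ltr0n expn_gt0.
  exact: (cover_small_set Jm me1 (lexx _) (side_ge0 hc _) eta0 (@sU i)).
have /choice[k {}hl] := hl.
pose La i := Some (l i, (k i).-1); pose Lb i := Some (l i, k i); pose Lc i := Some (l i, (k i).+1).
have fa : fine_cover m La by move=> i _ [<-]; have [] := hl i.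
have fb : fine_cover m Lb by move=> i _ [<-]; have [] := hl i.
have fc : fine_cover m Lc by move=> i _ [<-]; have [] := hl i.
have Hm0 j : (m <= j)%N -> 0 < H j by move=> mj; apply: H_gt0; exact: leq_trans mj.
have [Ld [fd covd sumd]] := cover_countable hc e (ltr01 : 0 < (1 : R)) Hm0 H_small.
have sumH : (\sum_(i <oo) (H (l i))%:E <= T%:E)%E.
  have gm0 i : (0 <= (g (diam (U i)))%:E)%E.
    apply: (@gdiam_ge0 _ g (side m)) => //; first exact: side_ge0.
    by move=> x y x0 xy ym; apply: g_mono => //; exact: le_trans me1.
  apply: (@le_trans _ _ (\sum_(i <oo) (c%:R%:E * (g (diam (U i)))%:E + (1 / (2 ^ i.+1)%:R)%:E))%E).
    apply: lee_nneseries => i *; first by rewrite lee_fin ltW// Hm0//; have [] := hl i.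
    by rewrite -EFinM -EFinD lee_fin; have [] := hl i.
  rewrite nneseriesD; last 2 first.
    by move=> i *; rewrite mule_ge0.
    by move=> i *; rewrite lee_fin divr_ge0.
  rewrite nneseriesZl//.
  rewrite /T EFinD; apply: leeD; last exact: (epsilon_trick0 xpredT ler01).
  by rewrite EFinM lee_wpmul2l// ?lee_fin// ltW.
pose L := interleave (interleave La Lb) (interleave Lc Ld).
have fL : fine_cover m L by do 2 apply: fine_cover_interleave => //; apply: fine_cover_interleave.
have sumL : (\sum_(p <oo) weight H (L p) < (c%:R ^+ (m - j0) * H m)%:E)%E.
  have f1 := fine_cover_interleave fa fb; have f2 := fine_cover_interleave fc fd.
  apply: (@le_lt_trans _ _ (T + T + (T + 1))%:E); last by rewrite lte_fin; lra.
  apply: (le_trans (weight_interleave_le Hm0 f1 f2)); rewrite EFinD; apply: leeD.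
    by apply: (le_trans (weight_interleave_le Hm0 fa fb)); rewrite EFinD; apply: leeD.
  by apply: (le_trans (weight_interleave_le Hm0 fc fd)); rewrite EFinD; apply: leeD.
have [t [qt nt unc]] := uncovered_of_small_cost (q := (j0, i0)) Jm j0m fL sumL.
have Vt := cV _ qt.
have t0 : 0 <= t by have := V0 _ Vt; rewrite /= in_itv/= andbT => /ltW.
apply: unc; apply/covers_interleave.
have [/S_range[n _ en]|nS] := pselect (S t).
  by right; apply/covers_interleave; right; rewrite -en; apply: covd; rewrite en.
have [i _ Ut] := EU t (conj (conj nt nS) Vt).
have [_ _ /(_ t Ut t0)[k' tk' [kE|[kE|kE]]]] := hl i; rewrite kE in tk'.
- by left; apply/covers_interleave; left; exists i, (l i, (k i).-1).
- by left; apply/covers_interleave; right; exists i, (l i, k i).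
- by right; apply/covers_interleave; left; exists i, (l i, (k i).+1).
Qed.

End HausdorffInfinite.

(** * Negligible complement when the reduced gauge is comparable to length *)

Section HausdorffNegligible.
Context {R : realType} (c : nat) (hc : (1 < c)%N).
Notation side := (@side R c).
Notation sub := (@sub c).
Notation cell := (@cell R c).
Variables (big : nat -> R -> Prop) (mu : nat -> nat).
Hypothesis mu_ge : forall j, (j <= mu j)%N.
Hypothesis mu_side : exists (B : R) (N : nat), 0 < B /\
  forall j, (N <= j)%N -> B * side j <= side (mu j).
Hypothesis rich : forall k q, @rich_at R c (hit c big mu k) q.
Variables (g : R -> R) (dl A : R).
Hypothesis dl0 : 0 < dl.
Hypothesis g00 : g 0 = 0.
Hypothesis g_mono : forall x y, 0 <= x -> x <= y -> y <= dl -> g x <= g y.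
Hypothesis A0 : 0 < A.
Hypothesis g_lin : forall r, 0 < r -> exists rho, [/\ 0 < rho, rho <= r & g rho <= A * rho].

(** The cell is cut into pieces of a length [rho] at which [g] is at most linear. Rounding their
    number up at most doubles the total length, as [rho <= side m]. *)
Lemma covered_cell m y : covered g dl (cell (m, y)) (2 * A * side m)%:E.
Proof.
have s0 := side_gt0 (R := R) hc m.
have [rho [rho0 rhole grho]] : exists rho, [/\ 0 < rho, rho <= Num.min dl (side m) & g rho <= A * rho].
  by apply: g_lin; rewrite lt_min dl0.
move: rhole; rewrite le_min => /andP[rdl rs].
pose M := (Num.truncn (side m / rho)).+1.
have sr : 0 <= side m / rho by rewrite divr_ge0 ?ltW.
have /andP[M1 M2] := truncn_itv sr.
pose a : R := y%:R * side m.
apply: (covered_le (x := (\sum_(0 <= i < M) g rho)%:E)).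
  rewrite lee_fin sumr_const_nat subn0 -[g rho *+ _]mulr_natl.
  apply: (@le_trans _ _ (M%:R * (A * rho))); first by rewrite ler_wpM2l.
  have : (Num.truncn (side m / rho))%:R * rho <= side m by rewrite -ler_pdivlMr.
  rewrite /M -natr1 mulrCA mulrDl mul1r => h.
  by rewrite -mulrA mulrCA ler_pM2l//; lra.
apply: (@covered_sub _ _ _ _ (\bigcup_(i in [set i | (0 <= i < M)%N])
    [set t | a + i%:R * rho <= t < a + i.+1%:R * rho])).
  move=> t /andP[/= t1 t2]; pose i := Num.truncn ((t - a) / rho).
  have ta : 0 <= (t - a) / rho by rewrite divr_ge0 ?(ltW rho0)// subr_ge0.
  have /andP[i1 i2] := truncn_itv ta.
  exists i => /=; last first.
    rewrite -/i in i1 i2; rewrite ler_pdivlMr// in i1; rewrite ltr_pdivrMr// in i2.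
    by apply/andP; split; lra.
  have h : (t - a) / rho < side m / rho.
    rewrite ltr_pM2r ?invr_gt0//.
    by move: t2; rewrite -natr1 mulrDl mul1r /a; lra.
  by rewrite -(@ltr_nat R); exact: le_lt_trans i1 (lt_trans h M2).
apply: covered_bigsetU => //; first exact: ltW.
move=> i _; apply: covered_set => //; [exact: ltW|].
move=> x z /andP[x1 x2] /andP[z1 z2]; move: x2 z2; rewrite -natr1 mulrDl mul1r => x2 z2.
by rewrite ler_norml; apply/andP; split; lra.
Qed.

(** For the shift [k = l + K], a deep hit cell lies wholly within the required distance of its jump.
    So only missed cells need covering, and by [rich] and [covered_cell] these cost at most
    [eta]. *)
Lemma negl_cell_far q l : negl g dl (cell q `\` near_big c big l).
Proof.
move=> eta eta0.
have [B [N [B0 hB]]] := mu_side.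
have c0 : 0 < c%:R :> R by rewrite ltr0n base_gt0.
(* [K] absorbs the constant of [mu_side], and the summand [l] in [k] absorbs the factor [side l]. *)
have [K hK] : exists K : nat, 1 < B * c%:R ^+ K.
  exists (Num.bound B^-1); rewrite -ltr_pdivrMl// mulr1.
  apply: lt_le_trans (archi_boundP _) _; first by rewrite invr_ge0 ltW.
  by rewrite -natrX ler_nat ltnW// ltn_expl.
pose k := (l + K)%N.
pose ep := eta / (2 * A * side q.1).
have sq := side_gt0 (R := R) hc q.1.
have ep0 : 0 < ep by rewrite divr_gt0// !mulr_gt0.
have [m [nm qm cnt]] := rich k q (N + k + l) ep0.
pose D := (c ^ (m - q.1))%N.
pose ms y := missed c (hit c big mu k) (N + k + l) q.1 m y.
apply: (covered_le (x := (\sum_(q.2 * D <= y < q.2.+1 * D)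
    (`[< ms y >] : nat)%:R * (2 * A * side m))%:E)).
  rewrite lee_fin -mulr_suml.
  have As : 0 <= 2 * A * side m by rewrite !mulr_ge0 ?side_ge0 ?(ltW A0).
  apply: le_trans (ler_wpM2r As cnt) _; rewrite /ep.
  have -> : eta / (2 * A * side q.1) * c%:R ^+ (m - q.1) * (2 * A * side m) =
     eta / (2 * A * side q.1) * (2 * A * (c%:R ^+ (m - q.1) * side m)) by ring.
  by rewrite mul_side// divfK// gt_eqF// !mulr_gt0.
apply: (@covered_sub _ _ _ _ (\bigcup_(y in [set y | (q.2 * D <= y < q.2.+1 * D)%N])
   (if `[< ms y >] then cell (m, y) else set0))); last first.
  apply: covered_bigsetU => //; first exact: ltW.
  move=> y _; case: asboolP => _; first by rewrite mul1r; exact: covered_cell.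
  by rewrite mul0r; apply: covered_set0.
move=> t [qt far].
have t0 : 0 <= t.
  by have /andP[h _] := qt; apply: le_trans h; rewrite mulr_ge0 ?side_ge0.
have [y yt] := exists_cell hc m t0.
have yq : sub (m, y) q by exact: cell_sub yt qt qm.
have D0 : (0 < D)%N by rewrite expn_gt0 base_gt0.
exists y => /=.
  by move: yq => /andP[/= _ /eqP <-]; rewrite leq_trunc_div -ltn_divLR// leqnn.
case: asboolP => // nms; apply: nms => j /andP[qj jm] nj [s sI bigs]; apply: far.
exists s, (mu (j - k)).
have [kj lj Nj] : [/\ k <= j, l <= j - k & N <= j - k]%N.
  by move: nj; rewrite /k; clear => h; split; lia.
have lmu : (l <= mu (j - k))%N by exact: leq_trans (mu_ge _).
split => //.
have tI : cell (j, (y %/ c ^ (m - j))%N) t.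
  by apply: sub_cell yt => //; rewrite /sub/= eqxx (ltnW jm).
have close : `|t - s| <= side j.
  move: tI sI => /andP[/= t1 t2] /andP[s1 s2]; move: t2 s2.
  rewrite -natr1 mulrDl mul1r => t2 s2.
  by rewrite ler_norml; apply/andP; split; lra.
apply: le_lt_trans close _; rewrite sideD.
have h1 : B * side (j - k) <= side (mu (j - k)) by exact: hB.
have h2 : side (j - k) = c%:R ^+ k * side j.
  by rewrite -(mul_side hc (leq_subr k j)) subKn.
have sl := side_gt0 (R := R) hc l.
apply: lt_le_trans (_ : side l * (B * side (j - k)) <= _); last by rewrite ler_pM2l.
rewrite h2 /k exprD.
have -> : side l * (B * (c%:R ^+ l * c%:R ^+ K * side j)) =
   (c%:R ^+ l * side l) * (B * c%:R ^+ K) * side j by ring.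
rewrite /side divff ?mul1r; last by rewrite expf_neq0// gt_eqF.
by rewrite ltr_pMl// side_gt0.
Qed.

Lemma negl_far : negl g dl ([set t : R | 0 < t] `\` [set t | forall l, near_big c big l t]).
Proof.
apply: (@negl_sub _ _ _ _ (\bigcup_l \bigcup_i (cell (0%N, i) `\` near_big c big l))).
  move=> t [/= t0 /existsNP[l nl]]; exists l => //.
  by have [i ti] := exists_cell hc 0 (ltW t0); exists i.
apply: negl_bigcup => // [|l]; first exact: ltW.
apply: negl_bigcup => // [|i]; first exact: ltW.
exact: negl_cell_far.
Qed.

End HausdorffNegligible.

Lemma open_near_big (R : realType) (c : nat) (big : nat -> R -> Prop) l :
  open (near_big c big l).
Proof.
rewrite openE => t [s [m [lm bs ts]]]; apply/nbhs_ballP.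
exists (side c (l + m) - `|t - s|) => /=; first by rewrite subr_gt0.
move=> t' /=; rewrite /ball/= => tt'; exists s, m; split => //.
apply: le_lt_trans (_ : `|t - t'| + `|t - s| < _); last by rewrite -ltrBrDr.
by rewrite (distrC t t') -(subrKA t) ler_normD.
Qed.

(** The [n]-th open set also omits the point [e n] if it belongs to [S], so the intersection omits
    all of [S] and nothing else. *)
Lemma G_delta_near_big (R : realType) (c : nat) (big : nat -> R -> Prop) (S : set R)
    (e : nat -> R) : S `<=` range e ->
  G_delta ([set t | (forall l, near_big c big l t) /\ ~ S t] `&` `]0, +oo[).
Proof.
move=> Se.
exists (fun n => (near_big c big n `&` `]0, +oo[) `&`
  (if `[< S (e n) >] then ~` [set e n] else setT)); split.
  move=> n; apply: openI; first by apply: openI; [exact: open_near_big|exact: interval_open].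
  case: asboolP => _; last exact: openT.
  by apply: closed_openC; exact: closed_eq.
apply/seteqP; split => t.
  move=> [[nt nS] t0] n _; split => //; case: asboolP => // Sn /= tn.
  by apply: nS; rewrite tn.
move=> h; have nt l : near_big c big l t by have [[]] := h l I.
split; last by have [[_ ]] := h 0%N I.
split => // St; have [n _ en] := Se _ St.
by have [_] := h n I; rewrite en; case: asboolP => // _; apply.
Qed.

(** * Application to the Lévy process *)

Section Assembly.
Context (R : realType) (dO : measure_display) (Omega : measurableType dO)
  (P : probability Omega R) (d : nat) (X : R -> Omega -> 'rV[R]_d)
  (g w winv : R -> R) (c : nat).
Hypothesis hX : is_levy_process P X.
Hypothesis hg : is_gauge g.
Hypothesis hw : is_modulus_fun w.
Hypothesis hwinv : exists e0 : R, 0 < e0 /\ forall t : R, 0 <= t <= e0 -> winv (w t) = t.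
Hypothesis hinf : \forall e \near 0^'+,
  (\int[norm_image (levy_measure P X)]_(r in `]0%R, e]) (g1 g (winv r))%:E)%E = +oo%E.
Hypothesis hc : (1 < c)%N.
Notation side := (@side R c).

(** [winv] is only known on values of [w]; by the intermediate value theorem these fill a right
    neighbourhood of 0. *)
Lemma winv_local : exists2 z0, 0 < z0 &
  (forall x y, 0 <= x -> x < y -> y <= z0 -> w x < w y) /\ w 0 = 0 /\
  forall z x, 0 < z -> z <= z0 -> 0 < x -> x <= w z ->
    exists y, [/\ 0 < y, y <= z, w y = x & winv x = y].
Proof.
have [e [e0 [wc [wmono [w0 _]]]]] := hw.
have [e' [e'0 hi]] := hwinv.
exists (Num.min e e'); first by rewrite lt_min e0.
have mono x y : 0 <= x -> x < y -> y <= Num.min e e' -> w x < w y.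
  move=> x0 xy; rewrite le_min => /andP[ye _].
  rewrite wmono// in_itv/= ?x0/= ?ye ?andbT; first exact: le_trans (ltW xy) ye.
  exact: le_trans x0 (ltW xy).
split => //; split => // z x z0; rewrite le_min => /andP[ze ze'] x0 xw.
have wcz : {within `[0, z], continuous w}.
  apply: continuous_subspaceW wc => y /=; rewrite !in_itv/= => /andP[-> yz].
  exact: le_trans ze.
have xin : Num.min (w 0) (w z) <= x <= Num.max (w 0) (w z).
  by rewrite w0 ge_min (ltW x0)/= le_max xw orbT.
have [y] := IVT (ltW z0) wcz xin; rewrite in_itv/= => /andP[y0 yz] wy.
have y_gt0 : 0 < y.
  by rewrite lt_neqAle y0 andbT; apply/eqP => y0E; move: x0; rewrite -wy -y0E w0 ltxx.
exists y; split => //; rewrite -wy hi// y0/=.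
exact: le_trans ze'.
Qed.

(** If [g1] vanished near 0, so would the integrand, and the integral could not be infinite. *)
Lemma g1_nonvanishing e : 0 < e -> exists2 r, 0 < r <= e & g1 g r != 0.
Proof.
move=> e0; apply: contrapT => nex.
have [z0 z00 [wmono [w0 hz]]] := winv_local.
have [e2 e20 he2] := (near0rP _).1 hinf.
pose z := Num.min z0 e.
have zp : 0 < z by rewrite lt_min z00.
have wz : 0 < w z by rewrite -w0; apply: wmono => //; rewrite ge_min lexx.
pose x := Num.min (w z) (e2 / 2).
have x0 : 0 < x by rewrite lt_min wz divr_gt0.
have xe2 : x < e2.
  by rewrite gt_min; apply/orP; right; rewrite ltr_pdivrMr// ltr_pMr// ltr1n.
have := he2 x; rewrite x0 xe2 => /(_ isT).
rewrite /integral.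
have -> : ((fun r => (g1 g (winv r))%:E) \_ `]0%R, x])%E = cst 0%E.
  apply/funext => r; rewrite patchE; case: ifPn => // /set_mem/=.
  rewrite in_itv/= => /andP[r0 rx].
  have rw : r <= w z by apply: le_trans rx _; rewrite ge_min lexx.
  have zz0 : z <= z0 by rewrite ge_min lexx.
  have [y [y0 yz _ ->]] := hz z r zp zz0 r0 rw.
  congr EFin; apply: contrapT => /eqP ny; apply: nex; exists y => //.
  by rewrite y0 (le_trans yz)// ge_min lexx orbT.
have -> : (cst 0 : R -> \bar R)^\+%E = cst 0%E.
  by apply/funext => r; rewrite funeposE/= maxxx.
have -> : (cst 0 : R -> \bar R)^\-%E = cst 0%E.
  by apply/funext => r; rewrite funenegE/=; apply/max_idPr; rewrite lee_fin oppr0.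
(* Both suprema are the same; their difference is 0, or [-oo] by convention, but never [+oo]. *)
by case: (ereal_sup _) => [a| |] //=; rewrite subee.
Qed.

Section Levels.
Variables (J1 : nat) (mu : nat -> nat) (K C1 e1 : R).
Hypothesis K0 : 0 < K.
Hypothesis C10 : 0 < C1.
Hypothesis levels : forall j, (J1 <= j)%N -> [/\ K * side j <= g1 g (side j),
   g1 g (side j.+1) <= g1 g (side j), g1 g (side j) <= c%:R * g1 g (side j.+1) &
   g1 g (side j) <= g (side j)].
Hypothesis mu_prop : forall j, [/\ (j <= mu j)%N, (J1 <= mu j)%N & g1 g (side (mu j)) <= side j].
Hypothesis mu_low : forall j, (J1 <= j)%N -> C1 * side j <= g1 g (side (mu j)).
Hypothesis e10 : 0 < e1.
Hypothesis Je1 : side J1 <= e1.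
Hypothesis slope0 : 0 < lower_slope g e1.
Hypothesis g_mono : {in `[0, e1] &, {homo g : x y / x <= y}}.
Hypothesis g1_mono : forall r r', 0 < r -> r <= r' -> r' <= e1 ->
  g1 g r <= g1 g r' /\ lower_slope g r' <= lower_slope g r.
Hypothesis g1_le : forall r, 0 < r -> r <= e1 -> g1 g r <= g r.

Let side_le i j : (i <= j)%N -> side j <= side i.
Proof.
move=> ij; rewrite -(mul_side hc ij) ler_peMl ?side_ge0//.
by rewrite exprn_ege1// ler1n base_gt0.
Qed.

Let g1_ge0 r : 0 < r -> r <= e1 -> 0 <= g1 g r.
Proof.
move=> r0 re; rewrite /g1 -/(lower_slope g r) mulr_ge0 ?(ltW r0)//.
by have [_ h] := g1_mono r0 re (lexx _); apply: le_trans h; exact: ltW.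
Qed.

Let G_gt0 j : (J1 <= j)%N -> 0 < g1 g (side j).
Proof. by move=> /levels[h _ _ _]; apply: lt_le_trans h; rewrite mulr_gt0 ?side_gt0. Qed.

Lemma g1_small (x : R) : 0 < x -> exists N, forall j, (N <= j)%N -> g1 g (side j) < x.
Proof.
move=> x0; have [N hN] := gauge_small hc hg x0; exists (maxn N J1) => j.
rewrite geq_max => /andP[Nj /levels[_ _ _ h]]; exact: le_lt_trans h (hN _ Nj).
Qed.

(** The divergence and richness results are applied to the integrand [g1] of [winv] and the
    thresholds [w (side (mu j))]. *)
Lemma rich_big_jump (z0 : R) : side J1 <= z0 ->
  (forall x y, 0 <= x -> x < y -> y <= z0 -> w x < w y) -> w 0 = 0 ->
  (forall z x, 0 < z -> z <= z0 -> 0 < x -> x <= w z ->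
    exists y, [/\ 0 < y, y <= z, w y = x & winv x = y]) ->
  {ae P, forall om, forall k q, @rich_at R c (hit c (big_jump X om c w) mu k) q}.
Proof.
move=> Jz0 wmono w0 hz.
have sz j : (J1 <= j)%N -> side j <= z0 by move=> Jj; exact: le_trans (side_le Jj) Jz0.
have w_gt0 j : (J1 <= j)%N -> 0 < w (side j).
  by move=> Jj; rewrite -w0; apply: wmono; rewrite ?side_gt0// sz.
pose thr j := w (side (mu j)).
have thr_gt0 j : 0 < thr j by apply: w_gt0; have [] := mu_prop j.
apply: (rich_ae hX hc thr_gt0).
have wJ : 0 < w (side J1) by exact: w_gt0.
apply: (tail_sum_diverges hX hc wJ hinf).
- move=> x x0 xw; have [y [y0 yz _ ->]] := hz _ _ (side_gt0 hc J1) Jz0 x0 xw.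
  by apply: g1_ge0 => //; exact: le_trans Je1.
- move=> eta eta0; have [N hN] := g1_small eta0.
  pose j := maxn N J1; have Jj : (J1 <= j)%N by exact: leq_maxr.
  exists (w (side j)); first exact: w_gt0.
  move=> x x0 xw; have [y [y0 yz _ ->]] := hz _ _ (side_gt0 hc j) (sz _ Jj) x0 xw.
  have [h _] := g1_mono y0 yz (le_trans (side_le Jj) Je1).
  by apply: le_trans h _; apply/ltW/hN; exact: leq_maxl.
(* From [g1 g y > side j >= g1 g (side (mu j))] it follows that [y > side (mu j)], and [w] is
   increasing. *)
- move=> j x x0 xw; have [y [y0 yz wy ->]] := hz _ _ (side_gt0 hc J1) Jz0 x0 xw.
  move=> lt; rewrite /thr -wy; apply: wmono; [exact: side_ge0| |exact: le_trans yz Jz0].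
  rewrite ltNge; apply/negP => le; have [_ Jm hm] := mu_prop j.
  have [h _] := g1_mono y0 le (le_trans (side_le Jm) Je1).
  by move: lt; rewrite ltNge (le_trans h hm).
Qed.

Variable om : Omega.
Hypothesis rich : forall k q, @rich_at R c (hit c (big_jump X om c w) mu k) q.

Let Xr := @levy_right _ _ _ _ _ _ hX om.
Let Xl := @levy_left _ _ _ _ _ _ hX om.
Let mu_ge j : (j <= mu j)%N. Proof. by have [] := mu_prop j. Qed.
Let F0 := [set t | (forall l, near_big c (big_jump X om c w) l t) /\ ~ jump_times X om t].

Lemma F0_singular t : 0 < t -> F0 t -> Fw X w om t.
Proof. by move=> t0 [nt nS]; exact: (near_big_singular Xl hc hw). Qed.

Lemma singular_contains_class_G : exists F : set R,
  class_G c (g1 g) `]0, +oo[ F /\ F `<=` Fw X w om.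
Proof.
have [e Se] := jump_times_range Xr Xl.
exists (F0 `&` `]0, +oo[); split; last first.
  by move=> t [Ft]; rewrite /= in_itv/= andbT => t0; exact: F0_singular.
split; first exact: G_delta_near_big Se.
move=> gbar U gauge prec oU U0.
have -> : F0 `&` `]0, +oo[ `&` U = F0 `&` U.
  apply/seteqP; split => t; first by move=> [[]].
  by move=> [Ft Ut]; split => //; split => //; exact: U0.
have pl := prec_levels hc K0 (fun j Jj => let: And4 h _ _ _ := levels Jj in h) prec.
apply: (content_full hc mu_ge rich gauge _ _ Se oU U0).
(* As [g1] is at least [K] times the side, a large multiple of [g1] below [gbar] gives the multiple
   [A] of the side. *)
- move=> A; have [N hN] := pl (Num.max A 0 / K).
  exists (maxn N J1) => j; rewrite geq_max => /andP[Nj Jj].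
  apply: le_trans (hN _ Nj); have [h _ _ _] := levels Jj.
  have A0 : 0 <= Num.max A 0 / K by rewrite divr_ge0 ?(ltW K0)// le_max lexx orbT.
  apply: le_trans (ler_wpM2l A0 h); rewrite mulrA divfK ?gt_eqF//.
  by rewrite ler_wpM2r ?side_ge0// le_max lexx.
- have [N hN] := pl 1; exists C1, (maxn N J1); split => // j.
  rewrite geq_max => /andP[Nj Jj]; apply: le_trans (mu_low Jj) _.
  by have := hN (mu j) (leq_trans Nj (mu_ge j)); rewrite mul1r.
Qed.

Let g00 : g 0 = 0. Proof. by have [? [? [? []]]] := hg. Qed.

Let g_mono' x y : 0 <= x -> x <= y -> y <= e1 -> g x <= g y.
Proof.
move=> x0 xy ye; apply: g_mono => //; rewrite in_itv/=.
  by rewrite x0 (le_trans xy).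
by rewrite ye (le_trans x0).
Qed.

(** Either [g1] dominates every multiple of length and both sides are infinite, or its slope is
    bounded and what [V] loses is negligible. *)
Lemma hausdorff_singular (V : set R) : open V -> V `<=` `]0, +oo[ ->
  hausdorff g (Fw X w om `&` V) = hausdorff g V.
Proof.
move=> oV V0; apply/eqP; rewrite eq_le hausdorff_sub/=; last by move=> t [].
have [e Se] := jump_times_range Xr Xl.
have V_gt0 t : V t -> 0 < t by move=> /V0; rewrite /= in_itv/= andbT.
have FV : F0 `&` V `<=` Fw X w om `&` V.
  by move=> t [Ft Vt]; split => //; apply: F0_singular => //; exact: V_gt0.
have [->|/set0P Vne] := eqVneq V set0; first by rewrite setI0.
have [H_oo|] := pselect (forall A : R, exists N, forall j, (N <= j)%N ->
    A * side j <= g1 g (side j)).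
  have top : hausdorff g (F0 `&` V) = +oo%E.
    apply: (@hausdorff_infinite _ _ hc (fun j => g1 g (side j)) J1 G_gt0 _ _ H_oo g1_small
      _ _ mu_ge _ rich g e1 _ e e10 g00 g_mono' _ Se V oV V0 Vne).
    - by move=> j /levels[].
    - by move=> j /levels[].
    - by exists C1, J1; split.
    - move=> l D Jl lD De; have D0 := lt_trans (side_gt0 hc _) lD.
      have [h _] := g1_mono (side_gt0 hc _) (ltW lD) De.
      by apply: le_trans h _; exact: g1_le.
  apply: (@le_trans _ _ +oo%E); first exact: leey.
  by rewrite -top; exact: hausdorff_sub.
move=> /existsNP[A nA].
(* The slope is below [A] at arbitrarily deep levels, hence everywhere on []0, e1]], being
   nonincreasing. *)
have slopeA r : 0 < r -> r <= e1 -> lower_slope g r < A.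
  move=> r0 re; have [N hN] := side_cvg0 hc r0.
  have [j [Nj lt]] : exists j, (N <= j)%N /\ g1 g (side j) < A * side j.
    apply: contrapT => nex; apply: nA; exists N => j Nj; rewrite leNgt; apply/negP => lt.
    by apply: nex; exists j.
  have [_ h] := g1_mono (side_gt0 hc j) (ltW (hN _ Nj)) re.
  apply: le_lt_trans h _; move: lt; rewrite /g1 -/(lower_slope g _) mulrC.
  by rewrite ltr_pM2r// side_gt0.
have A0 : 0 < A by apply: lt_trans slope0 (slopeA _ e10 (lexx _)).
have mu_side : exists (B : R) (N : nat), 0 < B /\
    forall j, (N <= j)%N -> B * side j <= side (mu j).
  exists (C1 / A), J1; split; first by rewrite divr_gt0.
  move=> j Jj; rewrite mulrAC ler_pdivrMr//; apply: le_trans (mu_low Jj) _.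
  rewrite /g1 -/(lower_slope g _) ler_pM2l ?side_gt0//; apply/ltW/slopeA; first exact: side_gt0.
  by have [_ Jm _] := mu_prop j; exact: le_trans (side_le Jm) Je1.
have g_lin r : 0 < r -> exists rho, [/\ 0 < rho, rho <= r & g rho <= A * rho].
  move=> r0; have r'0 : 0 < Num.min r e1 by rewrite lt_min r0.
  have : lower_slope g (Num.min r e1) < A by apply: slopeA => //; rewrite ge_min lexx orbT.
  move=> /inf_lt[|_ [rho + <-]].
    by exists (g (Num.min r e1) / Num.min r e1), (Num.min r e1) => //; rewrite /= in_itv/= r'0 lexx.
  rewrite /= in_itv/= => /andP[rho0 rhor] lt; exists rho; split => //.
    by apply: le_trans rhor _; rewrite ge_min lexx.
  by rewrite -ler_pdivrMr// ltW.
pose N1 := [set t : R | 0 < t] `\` [set t | forall l, near_big c (big_jump X om c w) l t].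
(* A time of [V] outside [Fw] is badly approximated by large jumps or is a jump time; both sets are
   negligible, the latter being countable. *)
have VE : V `<=` ((Fw X w om `&` V) `|` N1) `|` jump_times X om.
  move=> t Vt; have [St|nS] := pselect (jump_times X om t); first by right.
  have [nt|nn] := pselect (forall l, near_big c (big_jump X om c w) l t); last first.
    by left; right; split => //; exact: V_gt0.
  by left; left; split => //; apply: F0_singular => //; exact: V_gt0.
apply: le_trans (hausdorff_sub g VE) _.
have gm dl (x y : R) : dl <= e1 -> 0 <= x -> x <= y -> y <= dl -> g x <= g y.
  by move=> de x0 xy yd; apply: g_mono' => //; exact: le_trans de.
apply: le_trans (hausdorff_negl ((Fw X w om `&` V) `|` N1) e10 g00 g_mono' _) _.
  move=> dl dl0 de; apply: (negl_sub Se).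
  apply: (@negl_sub _ _ _ _ (\bigcup_n [set e n])); first by move=> _ [n _ <-]; exists n.
  have gmdl x y := @gm dl x y de.
  apply: (negl_bigcup (ltW dl0) g00 gmdl) => n.
  exact: (negl_point (ltW dl0) g00 gmdl).
apply: (hausdorff_negl (Fw X w om `&` V) e10 g00 g_mono') => dl dl0 de.
by apply: (negl_far hc mu_ge mu_side rich dl0 g00 _ A0 g_lin) => x y; exact: gm.
Qed.

End Levels.

End Assembly.

Theorem theorem6 (R : realType) (dO : measure_display) (Omega : measurableType dO)
  (P : probability Omega R) (d : nat) (X : R -> Omega -> 'rV[R]_d)
  (g w winv : R -> R) (c : nat) :
  is_levy_process P X ->
  is_gauge g ->
  is_modulus_fun w ->
  (* winv is the inverse function w^{-1} of w (on the range of w near 0) *)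
  (exists e0 : R, 0 < e0 /\ forall t : R, 0 <= t <= e0 -> winv (w t) = t) ->
  (* \int_{0+} g_1(w^{-1}(r)) sigma(dr) = oo *)
  (\forall e \near 0^'+,
     (\int[norm_image (levy_measure P X)]_(r in `]0%R, e]) (g1 g (winv r))%:E)%E = +oo%E) ->
  (2 <= c)%N ->
  {ae P, forall om, exists F : set R,
      class_G c (g1 g) `]0, +oo[ F /\ F `<=` Fw X w om} /\
  {ae P, forall om, forall V : set R, open V -> V `<=` `]0, +oo[ ->
      hausdorff g (Fw X w om `&` V) = hausdorff g V}.
Proof.
move=> hX hg hw hwinv hinf hc.
have [z0 z00 [wmono [w0 hz]]] := winv_local hw hwinv.
(* Levels from [Jm] on have sides in the range where [winv] inverts [w]. *)
have [Jm hJm] := side_cvg0 hc z00.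
have [J1 [mu [K [C1 [[K0 C10 Jm1] levels mu_prop mu_low [e1 e10 [Je1 [s0 gm g1m gle]]]]]]]] :=
  reduced_levels hc hg (g1_nonvanishing hw hwinv hinf) Jm.
have rich := rich_big_jump hX hg hinf hc levels mu_prop Je1 s0 g1m
  (ltW (hJm _ Jm1)) wmono w0 hz.
split; apply: filterS rich => om rich.
  exact: (singular_contains_class_G hX hw hc K0 C10 levels mu_prop mu_low rich).
move=> V oV V0.
exact: (hausdorff_singular hX hg hw hc K0 C10 levels mu_prop mu_low e10 Je1 s0 gm g1m gle rich oV V0).
Qed.
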